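(* Let $A$ be a Hermitian unital Banach $\ast$-algebra and $\psi:A\to\mathbb{C}$ a positive normalized linear functional. Let $f$ be analytic in an open subset $G$ of $\mathbb{C}$, let $I\subset G$ be a real interval, and let $m<M$ be real numbers with $[m,M]\subset I$. Suppose there exist constants $K>k\ge0$ such that $K\ge f''(z)\ge k$ for every $z\in[m,M]$. Then for every selfadjoint element $c\in A$ with $\sigma(c)\subseteq[m,M]$ and every $t\in[m,M]$, $$\frac12K\,\psi\left[(c-t)^2\right]\ge\psi(f(c))-f'(t)(\psi(c)-t)-f(t)\ge\frac12k\,\psi\left[(c-t)^2\right]$$ and $$\frac12K\,\psi\left[(c-t)^2\right]\ge\psi(cf'(c))-t\,\psi(f'(c))+f(t)-\psi(f(c))\ge\frac12k\,\psi\left[(c-t)^2\right].$$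
   Context: A unital Banach $\ast$-algebra $A$ (complex, with unit $1$) is called Hermitian if every selfadjoint element $a$ ($a^\ast=a$) has real spectrum $\sigma(a)\subset\mathbb{R}$. An element $a\in A$ is nonnegative, written $a\ge 0$, if $a^\ast=a$ and $\sigma(a)\subset[0,\infty)$. A linear functional $\psi:A\to\mathbb{C}$ is positive if $\psi(a)\ge0$ whenever $a\ge0$, and normalized if $\psi(1)=1$. For $g$ analytic on an open set $G\supset\sigma(c)$, $g(c)\in A$ is defined by the holomorphic functional calculus, $g(c)=\frac{1}{2\pi i}\int_\gamma g(z)(z-c)^{-1}dz$, where $\gamma$ is a closed rectifiable curve in $G$ with $\sigma(c)$ in its inside; the result does not depend on the choice of $\gamma$. Here $f'$ and $f''$ are the complex derivatives of $f$, and $c-t$ means $c-t\cdot1$. An inequality between scalars includes the assertion that they are real. *)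

(* Defs.v *)
From HB Require Import structures.
From mathcomp Require Import all_boot all_order all_algebra.
From mathcomp Require Export complex.
From mathcomp Require Import all_classical all_reals all_analysis.

Set Implicit Arguments.
Unset Strict Implicit.
Unset Printing Implicit Defensive.

Import Order.TTheory GRing.Theory Num.Theory.
Import numFieldNormedType.Exports.

Local Open Scope classical_set_scope.
Local Open Scope ring_scope.
Local Open Scope complex_scope.

(* The ring operations are fields of the mixin because Hierarchy Builder cannot
   declare a join of normed modules and rings (the existing one is numDomainType);
   the unitAlgType instance is provided below. Requiring 1 != 0 excludes the zero
   algebra, on which no functional is normalized. *)
HB.mixin Record isBanachAlgebra (K : numFieldType) A
    of CompleteNormedModule K A := {
  bone : A;
  bmul : A -> A -> A;
  bmulA : associative bmul;
  bmul1l : left_id bone bmul;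
  bmul1r : right_id bone bmul;
  bmulDl : left_distributive bmul +%R;
  bmulDr : right_distributive bmul +%R;
  bone_neq0 : bone != 0;
  bscaleAl : forall (a : K) (x y : A), a *: bmul x y = bmul (a *: x) y;
  bscaleAr : forall (a : K) (x y : A), a *: bmul x y = bmul x (a *: y);
  bnormM_le : forall x y : A, `|bmul x y| <= `|x| * `|y|
}.

#[short(type="banachAlgType")]
HB.structure Definition BanachAlgebra (K : numFieldType) :=
  {A of CompleteNormedModule K A & isBanachAlgebra K A}.

Section Alg.
Variables (K : numFieldType) (A : banachAlgType K).

#[non_forgetful_inheritance]
HB.instance Definition _ := GRing.Zmodule_isNzRing.Build A
  (@bmulA K A) (@bmul1l K A) (@bmul1r K A) (@bmulDl K A) (@bmulDr K A)
  (@bone_neq0 K A).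
#[non_forgetful_inheritance]
HB.instance Definition _ := GRing.Lmodule_isLalgebra.Build K A (@bscaleAl K A).
#[non_forgetful_inheritance]
HB.instance Definition _ := GRing.Lalgebra_isAlgebra.Build K A (@bscaleAr K A).

Definition binv_rel (x : A) : set A := [set y | y * x = 1 /\ x * y = 1].
Definition bunit (x : A) : bool := `[< exists y, binv_rel x y >].
Definition binv (x : A) : A := xget x (binv_rel x).

Let binvP x : bunit x -> binv_rel x (binv x).
Proof. by move=> /asboolP[y yx]; exact: (xgetPex x (ex_intro _ y yx)). Qed.

Let bmulVr : {in bunit, left_inverse 1 binv *%R}.
Proof. by move=> x /binvP[]. Qed.
Let bdivrr : {in bunit, right_inverse 1 binv *%R}.
Proof. by move=> x /binvP[]. Qed.
Let bunitP x y : y * x = 1 /\ x * y = 1 -> bunit x.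
Proof. by move=> xy; apply/asboolP; exists y. Qed.
Let binv_out : {in [predC bunit], binv =1 id}.
Proof.
move=> x /asboolP xN; rewrite /binv.
case: xgetP => // y _ xy; exfalso; apply: xN; by exists y.
Qed.
#[non_forgetful_inheritance]
HB.instance Definition _ := GRing.NzRing_hasMulInverse.Build A
  bmulVr bdivrr bunitP binv_out.

End Alg.

(* The involution is not assumed to be isometric, nor even continuous. *)
Record is_involution (K : numClosedFieldType) (A : banachAlgType K)
    (star : A -> A) : Prop := IsInvolution {
  starD : forall x y : A, star (x + y) = star x + star y;
  starZ : forall (a : K) (x : A), star (a *: x) = Num.conj a *: star x;
  starM : forall x y : A, star (x * y) = star y * star x;
  starK : forall x : A, star (star x) = x
}.

Definition spectrum (K : numFieldType) (A : banachAlgType K) (a : A) : set K :=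
  [set z | z%:A - a \isn't a GRing.unit].

Section StarAlgebra.
Variables (K : numClosedFieldType) (A : banachAlgType K) (star : A -> A).

Definition selfadjoint (a : A) : Prop := star a = a.

Definition hermitian_algebra : Prop :=
  forall a : A, selfadjoint a -> spectrum a `<=` [set z | z \is Num.real].

(* In the partial order of K, 0 <= z entails that z is real. *)
Definition nonneg (a : A) : Prop :=
  selfadjoint a /\ spectrum a `<=` [set z | 0 <= z].

Definition positive_functional (psi : {scalar A}) : Prop :=
  forall a : A, nonneg a -> 0 <= psi a.

Definition normalized (psi : {scalar A}) : Prop := psi 1 = 1.

End StarAlgebra.

Definition analytic_in (R : realType) (G : set R[i]^o)
    (f : R[i]^o -> R[i]^o) : Prop :=
  open G /\ forall z, G z -> derivable f z 1.

(* Curves are parametrized by [0, 1]; their values elsewhere are irrelevant. *)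
Section Contour.
Variable R : realType.
Implicit Types gamma : R -> R[i]^o.

(* The division points of a partition of [0, 1] are t 0, ..., t n. *)
Definition is_partition (n : nat) (t : nat -> R) : Prop :=
  [/\ t 0%N = 0, t n = 1 & forall i, (i < n)%N -> t i <= t i.+1].

Definition rectifiable gamma : Prop :=
  exists L : R, forall n t, is_partition n t ->
    \sum_(i < n) `|gamma (t i.+1) - gamma (t i)| <= L%:C.

Definition closed_rectifiable_curve gamma : Prop :=
  [/\ {within `[0, 1]%classic, continuous gamma},
      gamma 0 = gamma 1
    & rectifiable gamma].

Definition riemann_stieltjes_sum (V : normedModType R[i])
    gamma (F : R[i] -> V) (n : nat) (t s : nat -> R) : V :=
  \sum_(i < n) (gamma (t i.+1) - gamma (t i)) *: F (gamma (s i)).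

Definition is_contour_integral (V : normedModType R[i])
    gamma (F : R[i] -> V) (v : V) : Prop :=
  forall e : R, 0 < e -> exists2 d : R, 0 < d &
    forall (n : nat) (t s : nat -> R), is_partition n t ->
      (forall i, (i < n)%N -> t i <= s i <= t i.+1 /\ t i.+1 - t i < d) ->
      `|riemann_stieltjes_sum gamma F n t s - v| < e%:C.

(* 0 if the integral does not exist *)
Definition contour_integral (V : normedModType R[i])
    gamma (F : R[i] -> V) : V :=
  xget 0 [set v | is_contour_integral gamma F v].

Definition two_pi_i : R[i] := 2 * pi%:C * 'i.

Definition winding_number gamma (w : R[i]) : R[i]^o :=
  two_pi_i^-1 * contour_integral (V := R[i]^o) gamma (fun z => (z - w)^-1).

(* gamma is a closed rectifiable curve in G, with S in its inside. The index
   vanishes off G, so that the points which gamma encloses belong to G; without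
   this, Cauchy integrals along gamma would depend on gamma. *)
Definition surrounds_in (G S : set R[i]^o) gamma : Prop :=
  [/\ closed_rectifiable_curve gamma,
      forall u : R, 0 <= u <= 1 -> G (gamma u) /\ ~ S (gamma u),
      forall w, S w -> winding_number gamma w = 1
    & forall w, ~ G w -> winding_number gamma w = 0].

(* The holomorphic functional calculus g(c): some curve is picked, which does
   not matter for g analytic in the open set G containing the spectrum of c.
   It is 0 if no curve exists. *)
Definition hol_calc (A : banachAlgType R[i]) (G : set R[i]^o)
    (g : R[i]^o -> R[i]^o) (c : A) : A :=
  xget 0 [set b | exists2 gamma, surrounds_in G (spectrum c) gamma &
    b = two_pi_i^-1 *:
          contour_integral gamma (fun z => g z *: (z%:A - c)^-1)].

End Contour.

(* Main.v *)
Require Import Defs.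
From mathcomp Require Import all_boot all_order all_algebra.
From mathcomp Require Import all_classical all_reals all_analysis.
From mathcomp Require Import ring lra.

(** On the segment [m, M] the hypothesis on [f''] gives, by Taylor's formula at [t],
    [k/2 (x - t)^2 <= f(x) - f(t) - f'(t) (x - t) <= K/2 (x - t)^2], and exchanging [x]
    and [t] gives the corresponding bounds for [x f'(x) - t f'(x) + f(t) - f(x)]
    ([Taylor_bounds]). The theorem is obtained by inserting [c] for [x] and applying [psi];
    the matter is to show that this preserves the inequalities.

    An element [b] is said to be represented by a function [phi] on the spectrum of [c] when
    it is a norm limit of rational functions of [c] that converge to [phi] uniformly on the
    spectrum ([represents]). Representation is compatible with sums, scalars and
    multiplication by [c], and two facts about it suffice.

    First, [g(c)] is represented by [g] when [g] is analytic on [G] ([represents_hol_calc]).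
    The Riemann-Stieltjes sums of the integral that defines [g(c)] are combinations of
    resolvents, so they are rational functions of [c]; their value at a point [x] of the
    spectrum is the corresponding sum for the Cauchy integral of [g(z) / (z - x)], and tends
    to [g(x)]. As the curve is an arbitrary closed rectifiable curve of index 0 off [G],
    this rests on the homological form of Cauchy's theorem ([global_Cauchy]). It is proved
    after Dixon: the integral of the difference quotient of [g] extends to an entire
    function that vanishes at infinity, hence is 0. The local theory that Dixon's argument
    requires comes from Goursat's theorem for triangles, from Cauchy's formula on
    circles, and from estimates of Taylor type, which also show that [f'] is analytic. A
    suitable curve exists: an ellipse with foci [m] and [M] ([surrounding_curve]); its
    index is computed from integral sums over roots of unity.

    Second, [psi b] is nonnegative if [b] is represented by a nonnegative function
    ([represents_psi_ge0]). A rational function of [c] has for spectrum its values on the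
    spectrum of [c], so that [psi] of its real and imaginary parts is controlled by these
    values. To pass to the limit, [psi] has to be continuous along the approximation,
    though neither [psi] nor the involution is assumed so. The elements that occur are
    normal, and for a normal element [a] one has [|psi a| <= 2 |a|] ([psi_normal_le]): [a]
    and its adjoint commute and have the same spectral radius, and the spectral radius is
    subadditive on commuting elements. The link between spectral radius and growth of
    powers is proved by Rickart's averaging over roots of unity ([power_bounded_at]),
    without complex analysis in the algebra. *)

Set Implicit Arguments.
Unset Strict Implicit.
Unset Printing Implicit Defensive.
Import Order.TTheory GRing.Theory Num.Theory.
Import numFieldNormedType.Exports.
Local Open Scope classical_set_scope.
Local Open Scope ring_scope.
Local Open Scope complex_scope.

(** * Real-valued moduli and norms *)

Section Modulus.
Variable R : realType.
Implicit Types (z w : R[i]) (r : R).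

(** The norm of [R[i]] takes its values in [R[i]], which is only partially ordered;
    a real-valued modulus makes all estimates take place in [R]. *)
Definition cabs z : R := complex.Re `|z|.

Lemma normcE_cabs z : `|z| = (cabs z)%:C.
Proof. by rewrite /cabs normc_def. Qed.

Lemma cabs_ge0 z : 0 <= cabs z.
Proof. by rewrite -ler0c -normcE_cabs. Qed.

Lemma cabsM z w : cabs (z * w) = cabs z * cabs w.
Proof. by apply: complexI; rewrite rmorphM -!normcE_cabs normrM. Qed.

Lemma cabsD z w : cabs (z + w) <= cabs z + cabs w.
Proof. by rewrite -lecR rmorphD -!normcE_cabs ler_normD. Qed.

Lemma cabsN z : cabs (- z) = cabs z.
Proof. by rewrite /cabs normrN. Qed.

Lemma cabsB z w : cabs (z - w) <= cabs z + cabs w.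
Proof. by rewrite -[cabs w]cabsN cabsD. Qed.

Lemma cabsC z w : cabs (z - w) = cabs (w - z).
Proof. by rewrite -cabsN opprB. Qed.

Lemma cabs0 : cabs 0 = 0. Proof. by rewrite /cabs normr0. Qed.
Lemma cabs1 : cabs 1 = 1. Proof. by rewrite /cabs normr1. Qed.

Lemma cabs_eq0 z : (cabs z == 0) = (z == 0).
Proof. by rewrite -(inj_eq (@complexI R)) -normcE_cabs normr_eq0. Qed.

Lemma cabs_gt0 z : (0 < cabs z) = (z != 0).
Proof. by rewrite lt_def cabs_eq0 cabs_ge0 andbT. Qed.

Lemma cabsV z : cabs z^-1 = (cabs z)^-1.
Proof. by apply: complexI; rewrite fmorphV -!normcE_cabs normfV. Qed.

Lemma cabsX z n : cabs (z ^+ n) = cabs z ^+ n.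
Proof. by apply: complexI; rewrite rmorphXn -!normcE_cabs normrX. Qed.

Lemma cabs_real r : cabs r%:C = `|r|.
Proof. by rewrite /cabs normc_def /= expr0n /= addr0 sqrtr_sqr. Qed.

Lemma cabs_ReIm z : cabs z ^+ 2 = complex.Re z ^+ 2 + complex.Im z ^+ 2.
Proof. by rewrite /cabs normc_def /= sqr_sqrtr // addr_ge0 ?sqr_ge0. Qed.

Lemma cabs_Re z : `|complex.Re z| <= cabs z.
Proof.
rewrite -(ler_pXn2r (n := 2)) ?nnegrE ?cabs_ge0 // cabs_ReIm real_normK ?num_real//.
by rewrite lerDl sqr_ge0.
Qed.

Lemma cabs_Im z : `|complex.Im z| <= cabs z.
Proof.
rewrite -(ler_pXn2r (n := 2)) ?nnegrE ?cabs_ge0 // cabs_ReIm real_normK ?num_real//.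
by rewrite lerDr sqr_ge0.
Qed.

Lemma cabs_le z : cabs z <= `|complex.Re z| + `|complex.Im z|.
Proof.
rewrite {1}[z]complexE (le_trans (cabsD _ _)) // cabsM !cabs_real lerD2l.
by rewrite {1}/cabs normc_def /= expr0n expr1n add0r sqrtr1 mul1r.
Qed.

Lemma cabs_nat n : cabs n%:R = n%:R.
Proof. by rewrite -(rmorph_nat (real_complex R)) cabs_real normr_nat. Qed.

Lemma cabs_gtB z w : cabs z - cabs w <= cabs (z - w).
Proof. by rewrite lerBlDr -{1}[z](subrK w) cabsD. Qed.

Lemma cabs_sum (I : Type) (s : seq I) (P : pred I) (F : I -> R[i]) :
  cabs (\sum_(i <- s | P i) F i) <= \sum_(i <- s | P i) cabs (F i).
Proof.
elim/big_ind2: _; rewrite ?cabs0 // => x1 x2 y1 y2 h1 h2.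
by rewrite (le_trans (cabsD _ _)) ?lerD.
Qed.

Lemma cabs_conj z : cabs (Num.conj z) = cabs z.
Proof. by rewrite /cabs norm_conjC. Qed.

Lemma eps_eq0 z : (forall e : R, 0 < e -> cabs z <= e) -> z = 0.
Proof.
move=> h; apply/eqP; rewrite -cabs_eq0 eq_le cabs_ge0 andbT.
by apply/ler_addgt0Pl => e e0; rewrite addr0 h.
Qed.

End Modulus.

Section RealNorm.
Variables (R : realType) (V : normedModType R[i]).
Implicit Types x y : V.

Definition nrm x : R := complex.Re `|x|.

Lemma normE_nrm x : `|x| = (nrm x)%:C.
Proof. by rewrite /nrm RRe_real // ger0_real. Qed.

Lemma nrm_ge0 x : 0 <= nrm x.
Proof. by rewrite -ler0c -normE_nrm. Qed.

Lemma nrmD x y : nrm (x + y) <= nrm x + nrm y.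
Proof. by rewrite -lecR rmorphD /= -!normE_nrm; exact: ler_normD. Qed.

Lemma nrmN x : nrm (- x) = nrm x.
Proof. by rewrite /nrm normrN. Qed.

Lemma nrmB x y : nrm (x - y) <= nrm x + nrm y.
Proof. by rewrite -[nrm y]nrmN nrmD. Qed.

Lemma nrmC x y : nrm (x - y) = nrm (y - x).
Proof. by rewrite -nrmN opprB. Qed.

Lemma nrm0 : nrm 0 = 0. Proof. by rewrite /nrm normr0. Qed.

Lemma nrm_eq0 x : (nrm x == 0) = (x == 0).
Proof. by rewrite -(inj_eq (@complexI R)) -normE_nrm normr_eq0. Qed.

Lemma nrmZ (a : R[i]) x : nrm (a *: x) = cabs a * nrm x.
Proof.
rewrite {1}/nrm normrZ.
have -> : `|a| * `|x| = (cabs a * nrm x)%:C by rewrite rmorphM /= -normcE_cabs -normE_nrm.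
by [].
Qed.

Lemma nrm_triangle y x z : nrm (x - z) <= nrm (x - y) + nrm (y - z).
Proof. by rewrite (le_trans _ (nrmD _ _)) // addrA subrK. Qed.

Lemma nrm_sum (I : Type) (s : seq I) (P : pred I) (F : I -> V) :
  nrm (\sum_(i <- s | P i) F i) <= \sum_(i <- s | P i) nrm (F i).
Proof.
elim/big_ind2: _; rewrite ?nrm0 // => x1 x2 y1 y2 h1 h2.
by rewrite (le_trans (nrmD _ _)) ?lerD.
Qed.

Lemma nrm_small_eq0 x : (forall e : R, 0 < e -> nrm x <= e) -> x = 0.
Proof.
move=> h; apply/eqP; rewrite -nrm_eq0 eq_le nrm_ge0 andbT.
by apply/ler_addgt0Pl => e e0; rewrite addr0 h.
Qed.

Lemma pos_complexP (e : R[i]) : 0 < e -> exists2 r : R, 0 < r & e = r%:C.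
Proof.
move=> e0; exists (complex.Re e); rewrite ?RRe_real ?gtr0_real //.
by rewrite -ltcR RRe_real ?gtr0_real.
Qed.

End RealNorm.

(** A notion shared by the Banach algebra and the plane, so that integrals exist in
    both for the same reason. *)
Definition complete_seq (R : realType) (V : normedModType R[i]) : Prop :=
  forall u : nat -> V,
    (forall e : R, 0 < e -> exists N, forall m n, (N <= m)%N -> (N <= n)%N ->
      nrm (u m - u n) <= e) ->
    exists l, forall e : R, 0 < e -> exists N, forall n, (N <= n)%N ->
      nrm (u n - l) <= e.

Lemma complete_seq_banach (R : realType) (V : completeNormedModType R[i]) :
  complete_seq V.
Proof.
move=> u uC.
have : cauchy (u @ \oo).
  apply/cauchy_ballP => _ /pos_complexP[e e0 ->].
  have [N NP] := uC (e / 2) ltac:(lra).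
  near_simpl; exists ([set n | (N <= n)%N], [set n | (N <= n)%N]).
    by split; exists N.
  move=> [m n] [/= Nm Nn]; rewrite -ball_normE /ball_ /= normE_nrm ltcR.
  by rewrite (le_lt_trans (NP _ _ Nm Nn))// ltr_pdivrMr //; lra.
move=> /cauchy_cvgP /cvg_ex [l ul]; exists l => e e0.
have /cvgrPdist_le/(_ e%:C) := ul.
rewrite ltcR => /(_ e0)[N _ NP]; exists N => n Nn.
by have := NP n Nn; rewrite /= normE_nrm lecR nrmC.
Qed.

Lemma complete_seq_complex (R : realType) : complete_seq (R[i]^o : normedModType R[i]).
Proof.
move=> u uC.
have cvg1 (p : R[i] -> R) : (forall z w, `|p z - p w| <= cabs (z - w)) ->
    exists l : R, forall e : R, 0 < e -> exists N, forall n, (N <= n)%N -> `|p (u n) - l| <= e.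
  move=> hp; have : cauchy ((p \o u) @ \oo).
    apply/cauchy_ballP => e e0; have [N NP] := uC (e / 2) ltac:(lra).
    near_simpl; exists ([set n | (N <= n)%N], [set n | (N <= n)%N]); first by split; exists N.
    move=> [m n] [/= Nm Nn]; rewrite -ball_normE /ball_ /=.
    by rewrite (le_lt_trans (hp _ _)) // (le_lt_trans (NP _ _ Nm Nn)) // ltr_pdivrMr //; lra.
  move=> /cauchy_cvgP /cvg_ex [l ul]; exists l => e e0.
  have /cvgrPdist_le/(_ e e0)[N _ NP] := ul.
  by exists N => n Nn; rewrite distrC; exact: NP.
have [|a ha] := cvg1 (@complex.Re R).
  by move=> z w; apply: le_trans (cabs_Re (z - w)); case: z w => [? ?] [? ?] /=.
have [|b hb] := cvg1 (@complex.Im R).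
  by move=> z w; apply: le_trans (cabs_Im (z - w)); case: z w => [? ?] [? ?] /=.
exists (a +i* b) => e e0.
have [N1 h1] := ha (e / 2) ltac:(lra); have [N2 h2] := hb (e / 2) ltac:(lra).
exists (maxn N1 N2) => n; rewrite geq_max => /andP[/h1 {}h1 /h2 {}h2].
apply: le_trans (cabs_le _) _; move: h1 h2; case: (u n) => x y /=; lra.
Qed.

(** * Compactness of segments and discs *)

Section Compactness.
Variable R : realType.

(** Compactness of a segment in the form of a Lebesgue number: a property of
    points and scales that holds near every point holds at one common scale. *)
Lemma lebesgue_number_itv (a b : R) (Q : R -> R -> Prop) :
  (forall x d d', d' <= d -> Q x d -> Q x d') ->
  (forall x, a <= x <= b ->
     exists2 d, 0 < d & forall x', `|x' - x| < d -> Q x' d) ->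
  exists2 d, 0 < d & forall x, a <= x <= b -> Q x d.
Proof.
move=> Qmono Qloc.
have /compact_near_coveringP := @segment_compact R a b.
move=> /(_ R (0^'+)%classic (fun d x => Q x d)) cov.
have {}cov : \forall d \near (0 : R)^'+, `[a, b]%classic `<=` (fun x => Q x d).
  apply: cov => x; rewrite /= in_itv /= => /Qloc [d d0 hd].
  exists (ball x d, [set e | 0 < e < d]) => /=.
    split; first exact: nbhsx_ballx.
    near=> e; apply/andP; split; near: e; first exact: nbhs_right_gt.
    exact: nbhs_right_lt.
  move=> [x' e] [/=]; rewrite -ball_normE /ball_ /= distrC => xx' /andP[_ ed].
  exact: Qmono (ltW ed) (hd _ xx').
near (0 : R)^'+ => d.
exists d => [|x xab]; first by near: d; exact: nbhs_right_gt.
have : `[a, b]%classic `<=` (fun x => Q x d) by near: d.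
by apply; rewrite /= in_itv.
Unshelve. all: end_near. Qed.

(** Two successive applications to the sides of a square give the version for a disc. *)
Lemma lebesgue_number_disc (r : R) (Q : R[i] -> R -> Prop) :
  (forall z d d', d' <= d -> Q z d -> Q z d') ->
  (forall z, cabs z <= r ->
     exists2 d, 0 < d & forall z', cabs (z' - z) < d -> Q z' d) ->
  exists2 d, 0 < d & forall z, cabs z <= r -> Q z d.
Proof.
move=> Qmono Qloc.
(* The hypothesis speaks of the disc only, so the property is weakened to hold
   trivially at the points outside, which have a neighbourhood outside. *)
pose Q' z d := cabs z <= r -> Q z d.
have Qloc' z : exists2 d, 0 < d & forall z', cabs (z' - z) < d -> Q' z' d.
  have [/Qloc[d d0 hd]|zr] := leP (cabs z) r.
    by exists d => // z' /hd qz _.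
  exists (cabs z - r) => [|z' z'z z'r]; first lra.
  by have := cabs_gtB z z'; rewrite cabsC; lra.
have Q'mono z d d' : d' <= d -> Q' z d -> Q' z d' by move=> dd q /q; exact: Qmono.
have [] := @lebesgue_number_itv (- r) r
    (fun x d => forall y, - r <= y <= r -> Q' (x +i* y) d).
- by move=> x d d' dd q y /q; exact: Q'mono.
- move=> x _.
  have [] := @lebesgue_number_itv (- r) r
      (fun y d => forall x', `|x' - x| < d -> Q' (x' +i* y) d).
  + by move=> y d d' dd q x' xx'; apply: (Q'mono _ _ _ dd); apply: q; lra.
  + move=> y _; have [d d0 hd] := Qloc' (x +i* y).
    exists (d / 2) => [|y' yy' x' xx']; first lra.
    apply: (Q'mono _ d); first lra.
    apply: hd; apply: le_lt_trans (cabs_le _) _ => /=.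
    by move: yy' xx'; rewrite /=; lra.
  by move=> d d0 hd; exists d => // x' xx' y yr; exact: hd.
move=> d d0 hd; exists d => // z zr.
suff : Q' z d by apply.
have := le_trans (cabs_Re z) zr; have := le_trans (cabs_Im z) zr.
case: z {zr} => x y /=; rewrite !ler_norml => hy hx.
exact: hd.
Qed.

Definition unif_cont01 (V : normedModType R[i]) (H : R -> V) : Prop :=
  forall e : R, 0 < e -> exists2 d : R, 0 < d &
    forall s t, 0 <= s <= 1 -> 0 <= t <= 1 -> `|s - t| < d -> nrm (H s - H t) <= e.

(** Heine's theorem. *)
Lemma pointwise_unif_cont01 (V : normedModType R[i]) (H : R -> V) :
  (forall s, 0 <= s <= 1 -> forall e : R, 0 < e -> exists2 d : R, 0 < d &
    forall t, 0 <= t <= 1 -> `|s - t| < d -> nrm (H s - H t) <= e) ->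
  unif_cont01 H.
Proof.
move=> Hc e e0.
pose Q s d := 0 <= s <= 1 -> forall t, 0 <= t <= 1 -> `|s - t| < d ->
  nrm (H s - H t) <= e.
have [| |d d0 hd] := @lebesgue_number_itv 0 1 Q.
- by move=> s d d' dd q s01 t t01 st; apply: q => //; lra.
- move=> s s01; have [d d0 hd] := Hc s s01 (e / 2) ltac:(lra).
  exists (d / 2); first by rewrite divr_gt0.
  move=> s' s's s'01 t t01 s't; rewrite (le_trans (nrm_triangle (H s) _ _)) //.
  have h1 := hd s' s'01; have h2 := hd t t01.
  have : nrm (H s - H s') <= e / 2 by apply: h1; rewrite distrC; lra.
  have : nrm (H s - H t) <= e / 2.
    by apply: h2; move: s's s't; rewrite !ltr_distl; lra.
  by rewrite (nrmC (H s')); lra.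
exists d => // s t s01; exact: hd.
Qed.

Lemma within_unif_cont01 (V : normedModType R[i]) (H : R -> V) :
  {within `[0, 1]%classic, continuous H} -> unif_cont01 H.
Proof.
move=> /subspace_continuousP Hc; apply: pointwise_unif_cont01 => s s01 e e0.
have /Hc /cvgrPdist_le /(_ e%:C) : `[0, 1]%classic s by rewrite /= in_itv.
rewrite ltcR => /(_ e0); rewrite near_withinE => /nbhs_ballP[d /= d0 hd].
exists d => // t t01 st; rewrite -lecR -normE_nrm; apply: hd => //.
Qed.

Lemma unif_cont01_within (V : normedModType R[i]) (H : R -> V) :
  unif_cont01 H -> {within `[0, 1]%classic, continuous H}.
Proof.
move=> Hu; apply/subspace_continuousP => s; rewrite /= in_itv /= => s01.
apply/cvgrPdist_le => _ /pos_complexP[e e0 ->]; rewrite near_withinE.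
have [d d0 hd] := Hu e e0; apply/nbhs_ballP; exists d => //= t st.
by rewrite in_itv /= => t01; rewrite normE_nrm lecR; apply: hd.
Qed.

Definition cont_at (q : R[i] -> R[i]) (z : R[i]) : Prop :=
  forall e : R, 0 < e -> exists2 d : R, 0 < d &
    forall w, cabs (w - z) < d -> cabs (q w - q z) <= e.

Lemma unif_cont01_comp (gamma : R -> R[i]^o) (q : R[i] -> R[i]) :
  unif_cont01 gamma -> (forall s, 0 <= s <= 1 -> cont_at q (gamma s)) ->
  unif_cont01 ((q : R[i] -> R[i]^o) \o gamma).
Proof.
move=> gc qc; apply: pointwise_unif_cont01 => s s01 e e0.
have [d d0 hd] := qc s s01 e e0; have [d' d'0 hd'] := gc (d / 2) ltac:(lra).
exists d' => // t t01 st; have := hd' s t s01 t01 st.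
rewrite nrmC => h; rewrite nrmC; apply: hd.
by apply: le_lt_trans h _; lra.
Qed.

Lemma unif_cont01_bounded (V : normedModType R[i]) (H : R -> V) :
  unif_cont01 H -> exists2 B : R, 0 < B & forall s, 0 <= s <= 1 -> nrm (H s) <= B.
Proof.
move=> Hu.
(* The scale d stands for the bound 1 / d. *)
pose Q s d := 0 <= s <= 1 -> 0 < d -> nrm (H s) <= d^-1.
have [| |d d0 hd] := @lebesgue_number_itv 0 1 Q.
- move=> s d d' dd q s01 d'0; have d0 : 0 < d by lra.
  by rewrite (le_trans (q _ _)) // lef_pV2.
- move=> s s01; have [d d0 hd] := Hu 1 ltr01.
  have N0 := nrm_ge0 (H s).
  exists (Num.min d (nrm (H s) + 1)^-1).
    by rewrite lt_min d0 invr_gt0; lra.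
  move=> s' s's s'01 _.
  have : (nrm (H s) + 1)^-1^-1 <= (Num.min d (nrm (H s) + 1)^-1)^-1.
    by rewrite lef_pV2 ?posrE ?lt_min ?d0 ?invr_gt0 ?ge_min ?lexx ?orbT //; lra.
  rewrite invrK; apply: le_trans.
  have : nrm (H s' - H s) <= 1.
    by apply: hd => //; move: s's; rewrite lt_min => /andP[].
  by have := nrmD (H s' - H s) (H s); rewrite subrK; lra.
by exists d^-1 => [|s s01]; rewrite ?invr_gt0 //; exact: hd.
Qed.

End Compactness.

(** * Riemann-Stieltjes sums along rectifiable curves *)

Section RiemannStieltjes.
Variables (R : realType) (V : normedModType R[i]).
Implicit Types (gamma : R -> R[i]^o) (F : R[i] -> V).

Definition length_le gamma (L : R) : Prop :=
  forall n t, is_partition n t ->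
    \sum_(i < n) cabs (gamma (t i.+1) - gamma (t i)) <= L.

Lemma rectifiableP gamma : rectifiable gamma ->
  exists2 L : R, 0 < L & length_le gamma L.
Proof.
move=> [L hL]; exists (Num.max L 1); first by rewrite lt_max ltr01 orbT.
move=> n t /hL; under eq_bigr do rewrite normcE_cabs.
by rewrite -rmorph_sum lecR => h; rewrite le_max h.
Qed.

Definition is_tagged (d : R) n (t s : nat -> R) : Prop :=
  is_partition n t /\
  forall i, (i < n)%N -> t i <= s i <= t i.+1 /\ t i.+1 - t i < d.

Lemma partition_mono n (t : nat -> R) : is_partition n t ->
  forall i j, (i <= j <= n)%N -> t i <= t j.
Proof.
move=> [_ _ tS] i j; elim: j => [|j IH]; first by rewrite leqn0 => /andP[/eqP->].
move=> /andP[]; rewrite leq_eqVlt => /predU1P[->//|]; rewrite ltnS => ij jn.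
by rewrite (le_trans (IH _)) ?tS // ij ltnW.
Qed.

Lemma partition01 n (t : nat -> R) : is_partition n t ->
  forall i, (i <= n)%N -> 0 <= t i <= 1.
Proof.
move=> tp i i_n; have [t0 t1 _] := tp.
by rewrite -{1}t0 -t1 !(partition_mono tp) ?leqnn ?i_n.
Qed.

Lemma tag01 d n (t s : nat -> R) : is_tagged d n t s ->
  forall i, (i < n)%N -> 0 <= s i <= 1.
Proof.
move=> [tp ts] i i_n; have [/andP[h1 h2] _] := ts i i_n.
have /andP[h3 _] := partition01 tp (ltnW i_n).
have /andP[_ h4] := partition01 tp i_n.
by rewrite (le_trans h3) // (le_trans h2).
Qed.

Definition grid (N i : nat) : R := i%:R / N%:R.

Lemma grid_partition N : (0 < N)%N -> is_partition N (grid N).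
Proof.
move=> N0; rewrite /grid; split; first by rewrite mul0r.
  by rewrite divff // pnatr_eq0 -lt0n.
by move=> i _; rewrite ler_wpM2r ?invr_ge0 ?ler0n // ler_nat.
Qed.

Lemma gridS N i : grid N i.+1 = grid N i + N%:R^-1.
Proof. by rewrite /grid -natr1 mulrDl mul1r. Qed.

Lemma grid_tagged (d : R) N (s : nat -> R) : N%:R^-1 < d -> (0 < N)%N ->
  (forall i, (i < N)%N -> grid N i <= s i <= grid N i.+1) ->
  is_tagged d N (grid N) s.
Proof.
move=> Nd N0 hs; split; first exact: grid_partition.
by move=> i iN; split; [exact: hs|rewrite gridS addrAC subrr add0r].
Qed.

Lemma inv_nat_small (e : R) : 0 < e ->
  exists N0, (0 < N0)%N /\ forall N, (N0 <= N)%N -> N%:R^-1 < e.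
Proof.
move=> e0; exists (Num.truncn e^-1).+1; split => // N hN.
have N0 : 0 < N%:R :> R by rewrite ltr0n (leq_trans _ hN).
rewrite -[e]invrK ltf_pV2 ?posrE ?invr_gt0 //.
apply: lt_le_trans (_ : (Num.truncn e^-1).+1%:R <= _); last by rewrite ler_nat.
exact: truncnS_gt.
Qed.

Local Notation rsum := riemann_stieltjes_sum.

Lemma sum_telescope_blocks n (k : nat -> nat) (W : zmodType) (f : nat -> W) :
  k 0%N = 0%N -> (forall i, (i < n)%N -> (k i <= k i.+1)%N) ->
  \sum_(i < n) \sum_(k i <= j < k i.+1) f j = \sum_(0 <= j < k n) f j.
Proof.
move=> k0; elim: n => [|n IH] hk; first by rewrite big_ord0 k0 big_geq.
rewrite big_ord_recr /= IH => [|i i_n]; last by apply: hk; rewrite ltnS ltnW.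
rewrite -big_cat_nat //=; last exact: hk.
Qed.

Section Compare.
Variables (gamma : R -> R[i]^o) (F : R[i] -> V) (L : R).
Hypotheses (gc : unif_cont01 gamma) (gL : length_le gamma L) (L0 : 0 < L).
Hypothesis Fc : unif_cont01 (F \o gamma).

(** Rounding the points of a tagged partition down to multiples of 1 / N makes
    it coarser than the grid, so no common refinement has to be built; as N
    grows the rounded sum tends to the original one. *)
Lemma rsum_grid_close (e d0 : R) n t s : 0 <= e ->
  (forall x y, 0 <= x <= 1 -> 0 <= y <= 1 -> `|x - y| < 2 * d0 ->
     nrm (F (gamma x) - F (gamma y)) <= e) ->
  is_tagged d0 n t s -> forall eta : R, 0 < eta ->
  exists N0, forall N, (N0 <= N)%N ->
    nrm (rsum gamma F n t s - rsum gamma F N (grid N) (grid N)) <= e * L + eta.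
Proof.
move=> e0 he ts eta eta0; have [tp hts] := ts; have [t0 tn tS] := tp.
have [B B0 hB] := unif_cont01_bounded Fc.
have [n0|n_gt0] := posnP n.
  by move: t0 tn; rewrite n0 => -> /esym/eqP; rewrite oner_eq0.
have d0_gt0 : 0 < d0.
  by have [/andP[h1 h2]] := hts 0%N n_gt0; have := le_trans h1 h2; lra.
pose eta1 := eta / (n%:R * (2 * B)).
have nB0 : 0 < n%:R * (2 * B) by rewrite mulr_gt0 ?ltr0n ?mulr_gt0.
have eta10 : 0 < eta1 by rewrite divr_gt0.
have [d1 d10 hd1] := gc eta10.
have d01 : 0 < Num.min d0 d1 by rewrite lt_min d0_gt0.
have [N0 [N00 hN0]] := inv_nat_small d01.
exists N0 => N NN0.
have N_gt0 : (0 < N)%N := leq_trans N00 NN0.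
have NR : 0 < N%:R :> R by rewrite ltr0n.
have /hN0 := NN0; rewrite lt_min => /andP[Nd0 Nd1].
have NV : 0 < N%:R^-1 :> R by rewrite invr_gt0.
pose k i := Num.truncn (N%:R * t i); pose u i := grid N (k i).
have t_ge0 i : (i <= n)%N -> 0 <= t i by move=> /(partition01 tp)/andP[].
have uP i : (i <= n)%N -> u i <= t i < u i + N%:R^-1.
  move=> /t_ge0 ti; have := truncn_itv (mulr_ge0 (ltW NR) ti).
  rewrite -/(k i) /u -gridS /grid ler_pdivrMr // ltr_pdivlMr //.
  by rewrite ![_ * N%:R]mulrC.
have u01 i : (i <= n)%N -> 0 <= u i <= 1.
  move=> i_n; have /andP[h1 _] := uP i i_n; have /andP[_ h2] := partition01 tp i_n.
  by rewrite (le_trans h1 h2) andbT divr_ge0 ?ler0n.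
have k0 : k 0%N = 0%N by rewrite /k t0 mulr0 truncn0.
have kn : k n = N by rewrite /k tn mulr1 natrK.
have kS i : (i < n)%N -> (k i <= k i.+1)%N.
  by move=> i_n; apply: le_truncn; rewrite ler_pM2l // tS.
have telescope (f : nat -> V) :
    \sum_(i < n) \sum_(k i <= j < k i.+1) f j = \sum_(0 <= j < N) f j.
  by rewrite sum_telescope_blocks // kn.
pose D j := gamma (grid N j.+1) - gamma (grid N j).
pose rounded := \sum_(i < n) (gamma (u i.+1) - gamma (u i)) *: F (gamma (s i)).
apply: le_trans (nrm_triangle rounded _ _) _; rewrite addrC lerD //.
- have -> : rounded = \sum_(i < n) \sum_(k i <= j < k i.+1) D j *: F (gamma (s i)).
    apply: eq_bigr => i _; rewrite -scaler_suml telescope_sumr //; exact: kS.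
  rewrite /rsum -(big_mkord xpredT (fun j => D j *: F (gamma (grid N j)))).
  rewrite -telescope -sumrB.
  apply: (@le_trans _ _ (\sum_(i < n) \sum_(k i <= j < k i.+1) cabs (D j) * e)).
    apply: le_trans (nrm_sum _ _ _) _; apply: ler_sum => i _.
    rewrite -sumrB; apply: le_trans (nrm_sum _ _ _) _.
    rewrite big_seq [leRHS]big_seq; apply: ler_sum => j.
    rewrite mem_index_iota => /andP[kj jk].
    rewrite -scalerBr nrmZ ler_wpM2l ?cabs_ge0 //.
    have i_n := ltn_ord i; have i_n' := ltnW i_n.
    have [/andP[h1 h2] h3] := hts i i_n.
    have /andP[g1 g2] := uP i i_n'; have /andP[g3 g4] := uP i.+1 i_n.
    have h4 : u i <= grid N j by rewrite ler_wpM2r ?ler_nat // ltW.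
    have h5 : grid N j.+1 <= u i.+1 by rewrite ler_wpM2r ?ler_nat // ltW.
    rewrite gridS in h5.
    have /andP[_ t1] := partition01 tp i_n; have := t_ge0 i i_n'.
    have /andP[a1 _] := u01 i i_n'.
    move=> ti0; apply: he; rewrite ?ler_norml ?ltr_norml; lra.
  rewrite sum_telescope_blocks // kn big_mkord -mulr_suml mulrC.
  by rewrite ler_wpM2l //; apply: gL; exact: grid_partition.
- rewrite -sumrB; apply: le_trans (nrm_sum _ _ _) _.
  apply: (@le_trans _ _ (\sum_(i < n) 2 * eta1 * B)); last first.
    rewrite sumr_const card_ord -mulr_natl /eta1.
    rewrite [X in X <= _](_ : _ = eta) //.
    by field; rewrite !gt_eqF // ltr0n.
  apply: ler_sum => i _; rewrite -scalerBl nrmZ.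
  have i_n := ltn_ord i; have i_n' := ltnW i_n.
  rewrite ler_pM ?cabs_ge0 ?nrm_ge0 //; last by apply: hB; exact: tag01 ts _ i_n.
  have close j : (j <= n)%N -> cabs (gamma (t j) - gamma (u j)) <= eta1.
    move=> j_n; apply: hd1; rewrite ?u01 ?(partition01 tp) //.
    have /andP[g1 g2] := uP j j_n; rewrite ltr_norml; lra.
  have -> : gamma (t i.+1) - gamma (t i) - (gamma (u i.+1) - gamma (u i)) =
      (gamma (t i.+1) - gamma (u i.+1)) - (gamma (t i) - gamma (u i)) by ring.
  apply: le_trans (cabsB _ _) _; have := close _ i_n; have := close _ i_n'; lra.
Qed.

(** The integral of a continuous function along a rectifiable curve exists in a
    complete space. The error of a sum is controlled by the oscillation of the
    integrand at the scale of the mesh alone, hence uniformly in families. *)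
Lemma contour_integral_exists : complete_seq V -> exists v,
  forall (e d0 : R) n t s, 0 <= e ->
  (forall x y, 0 <= x <= 1 -> 0 <= y <= 1 -> `|x - y| < 2 * d0 ->
     nrm (F (gamma x) - F (gamma y)) <= e) ->
  is_tagged d0 n t s -> nrm (rsum gamma F n t s - v) <= e * L.
Proof.
move=> Vc; pose U N := rsum gamma F N (grid N) (grid N).
have grid_tag (d : R) N : (0 < N)%N -> N%:R^-1 < d -> is_tagged d N (grid N) (grid N).
  move=> N0 Nd; apply: grid_tagged => // i _; rewrite lexx gridS lerDl.
  by rewrite invr_ge0 ler0n.
have UC : forall e : R, 0 < e -> exists N, forall m n, (N <= m)%N -> (N <= n)%N ->
    nrm (U m - U n) <= e.
  move=> e e0; pose e1 := e / 4 / L.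
  have e10 : 0 < e1 by rewrite !divr_gt0.
  have [d d_gt0 hd] := Fc e10.
  have [N0 [N00 hN0]] := inv_nat_small (divr_gt0 d_gt0 (ltr0n _ 2)).
  exists N0 => m n Nm Nn.
  have main p : (N0 <= p)%N -> exists Np, forall N, (Np <= N)%N ->
      nrm (U p - U N) <= e / 2.
    move=> Np; have hp := hN0 _ Np.
    have p0 : (0 < p)%N := leq_trans N00 Np.
    have osc x y : 0 <= x <= 1 -> 0 <= y <= 1 -> `|x - y| < 2 * (d / 2) ->
      nrm (F (gamma x) - F (gamma y)) <= e1 by move=> x01 y01 xy; apply: hd => //; lra.
    have [Np' h] := rsum_grid_close (ltW e10) osc (grid_tag _ _ p0 hp)
      (divr_gt0 e0 (ltr0n _ 4)).
    exists Np' => N /h; rewrite /e1 divfK ?gt_eqF // => /le_trans; apply; lra.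
  have [Nm' hm] := main m Nm; have [Nn' hn] := main n Nn.
  have := hm (maxn Nm' Nn') (leq_maxl _ _); have := hn (maxn Nm' Nn') (leq_maxr _ _).
  have := nrm_triangle (U (maxn Nm' Nn')) (U m) (U n).
  rewrite (nrmC (U (maxn _ _))); lra.
have [v hv] := Vc U UC; exists v => e d0 n t s e0 he ts.
apply/ler_addgt0Pl => eta eta0.
have [N1 h1] := rsum_grid_close e0 he ts (divr_gt0 eta0 (ltr0n _ 2)).
have [N2 h2] := hv (eta / 2) ltac:(lra).
have := h1 _ (leq_maxl N1 N2); have := h2 _ (leq_maxr N1 N2).
have := nrm_triangle (U (maxn N1 N2)) (rsum gamma F n t s) v.
rewrite /U; lra.
Qed.
End Compare.

Lemma is_contour_integralP gamma F v : is_contour_integral gamma F v <->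
  forall e : R, 0 < e -> exists2 d : R, 0 < d &
    forall n t s, is_tagged d n t s -> nrm (rsum gamma F n t s - v) < e.
Proof.
split=> h e /h[d d0 hd]; exists d => // n t s.
  by move=> [tp ts]; have := hd n t s tp ts; rewrite normE_nrm ltcR.
by move=> tp ts; rewrite normE_nrm ltcR; apply: hd.
Qed.

Lemma contour_integral_grid gamma F v : is_contour_integral gamma F v ->
  forall e : R, 0 < e -> exists N0, (0 < N0)%N /\ forall N, (N0 <= N)%N ->
    forall s, (forall i, (i < N)%N -> grid N i <= s i <= grid N i.+1) ->
    nrm (rsum gamma F N (grid N) s - v) < e.
Proof.
move=> /is_contour_integralP h e /h[d d0 hd].
have [N0 [N00 hN0]] := inv_nat_small d0; exists N0; split=> // N NN0 s hs.
by apply: hd; apply: grid_tagged => //; [exact: hN0|exact: leq_trans NN0].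
Qed.

Lemma grid_left N i : (i < N)%N -> grid N i <= grid N i <= grid N i.+1.
Proof. by move=> _; rewrite lexx gridS lerDl invr_ge0 ler0n. Qed.

Lemma grid_right N i : (i < N)%N -> grid N i <= grid N i.+1 <= grid N i.+1.
Proof. by move=> _; rewrite lexx gridS lerDl invr_ge0 ler0n. Qed.

Lemma grid01 N i : (i <= N)%N -> 0 <= grid N i <= 1.
Proof.
have [->|N0] := posnP N; first by rewrite leqn0 => /eqP ->; rewrite /grid mul0r lexx ler01.
by move=> iN; apply: (@partition01 N (grid N) _ i iN); exact: grid_partition.
Qed.

Lemma is_contour_integral_unique gamma F v w :
  is_contour_integral gamma F v -> is_contour_integral gamma F w -> v = w.
Proof.
move=> hv hw; apply/eqP; rewrite -subr_eq0; apply/eqP.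
apply: nrm_small_eq0 => e e0.
have [N1 [_ h1]] := contour_integral_grid hv (divr_gt0 e0 (ltr0n _ 2)).
have [N2 [_ h2]] := contour_integral_grid hw (divr_gt0 e0 (ltr0n _ 2)).
have := h1 _ (leq_maxl N1 N2) _ (@grid_left _).
have := h2 _ (leq_maxr N1 N2) _ (@grid_left _).
set S := rsum _ _ _ _ _ => ? ?.
have := nrm_triangle S v w; rewrite (nrmC v S); lra.
Qed.

Lemma contour_integralE gamma F v :
  is_contour_integral gamma F v -> contour_integral gamma F = v.
Proof.
by move=> h; apply: (@is_contour_integral_unique gamma F) => //;
  exact: xgetPex (ex_intro _ v h).
Qed.

Lemma is_contour_integral_ext gamma F F' v :
  (forall s, 0 <= s <= 1 -> F (gamma s) = F' (gamma s)) ->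
  is_contour_integral gamma F v -> is_contour_integral gamma F' v.
Proof.
move=> FF /is_contour_integralP h; apply/is_contour_integralP => e /h[d d0 hd].
exists d => // n t s ts; have := hd n t s ts; congr (nrm (_ - _) < _).
by apply: eq_bigr => i _; rewrite FF //; exact: tag01 ts _ _.
Qed.

Lemma is_contour_integralD gamma F F' v v' :
  is_contour_integral gamma F v -> is_contour_integral gamma F' v' ->
  is_contour_integral gamma (fun z => F z + F' z) (v + v').
Proof.
move=> /is_contour_integralP h /is_contour_integralP h'.
apply/is_contour_integralP => e e0.
have [d d0 hd] := h (e / 2) ltac:(lra); have [d' d'0 hd'] := h' (e / 2) ltac:(lra).
exists (Num.min d d') => [|n t s [tp ts]]; first by rewrite lt_min d0.
have -> : rsum gamma (fun z => F z + F' z) n t s - (v + v') =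
    (rsum gamma F n t s - v) + (rsum gamma F' n t s - v').
  rewrite addrACA -opprD -big_split; congr (_ - _).
  by apply: eq_bigr => i _; rewrite scalerDr.
have T1 : is_tagged d n t s.
  by split=> // i /ts[? ]; rewrite lt_min => /andP[].
have T2 : is_tagged d' n t s.
  by split=> // i /ts[? ]; rewrite lt_min => /andP[].
by have := nrmD (rsum gamma F n t s - v) (rsum gamma F' n t s - v');
  have := hd _ _ _ T1; have := hd' _ _ _ T2; lra.
Qed.

Lemma is_contour_integralZ gamma F (a : R[i]) v :
  is_contour_integral gamma F v ->
  is_contour_integral gamma (fun z => a *: F z) (a *: v).
Proof.
move=> /is_contour_integralP h; apply/is_contour_integralP => e e0.
have a0 := cabs_ge0 a; have a1 : 0 < cabs a + 1 by lra.
have [d d0 hd] := h _ (divr_gt0 e0 a1).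
exists d => // n t s ts.
have -> : rsum gamma (fun z => a *: F z) n t s - a *: v = a *: (rsum gamma F n t s - v).
  rewrite scalerBr scaler_sumr; congr (_ - _); apply: eq_bigr => i _.
  by rewrite !scalerA mulrC.
rewrite nrmZ; have := hd _ _ _ ts; rewrite ltr_pdivlMr // mulrC.
by have := nrm_ge0 (rsum gamma F n t s - v); lra.
Qed.

Lemma is_contour_integralB gamma F F' v v' :
  is_contour_integral gamma F v -> is_contour_integral gamma F' v' ->
  is_contour_integral gamma (fun z => F z - F' z) (v - v').
Proof.
move=> h /(is_contour_integralZ (-1)) /(is_contour_integralD h).
rewrite scaleN1r; apply: is_contour_integral_ext => s _.
by rewrite scaleN1r.
Qed.

Lemma rsum_le gamma F (L B : R) n t s d :
  length_le gamma L -> 0 <= B ->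
  (forall s, 0 <= s <= 1 -> nrm (F (gamma s)) <= B) ->
  is_tagged d n t s -> nrm (rsum gamma F n t s) <= B * L.
Proof.
move=> gL B0 hB ts; apply: le_trans (nrm_sum _ _ _) _.
apply: (@le_trans _ _ (\sum_(i < n) cabs (gamma (t i.+1) - gamma (t i)) * B)).
  apply: ler_sum => i _; rewrite nrmZ ler_wpM2l ?cabs_ge0 //; apply: hB.
  exact: tag01 ts _ _.
by rewrite -mulr_suml mulrC ler_wpM2l //; apply: gL; case: ts.
Qed.

Lemma contour_integral_le gamma F (L B : R) v :
  length_le gamma L -> 0 <= B ->
  (forall s, 0 <= s <= 1 -> nrm (F (gamma s)) <= B) ->
  is_contour_integral gamma F v -> nrm v <= B * L.
Proof.
move=> gL B0 hB /contour_integral_grid h; apply/ler_addgt0Pl => e e0.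
have [N [N0 hN]] := h e e0; have := hN N (leqnn _) _ (@grid_left _).
set S := rsum _ _ _ _ _ => hS.
have : nrm S <= B * L.
  apply: (rsum_le gL B0 hB (d := N%:R^-1 + 1)); apply: grid_tagged => //; first lra.
  exact: grid_left.
have := nrmB S (S - v); rewrite opprB addrC subrK; lra.
Qed.

End RiemannStieltjes.

(** * Integrals along segments, and primitives *)

Section Segments.
Variable R : realType.
Implicit Types (a b c z w p : R[i]) (q : R[i] -> R[i]).

Definition seg a b (s : R) : R[i]^o := a + s%:C * (b - a).

Lemma seg0 a b : seg a b 0 = a. Proof. by rewrite /seg mul0r addr0. Qed.
Lemma seg1 a b : seg a b 1 = b. Proof. by rewrite /seg mul1r addrC subrK. Qed.

Lemma segB a b s t : seg a b s - seg a b t = (s - t)%:C * (b - a).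
Proof. by rewrite /seg rmorphB /=; ring. Qed.

Lemma seg_dist a b s : 0 <= s <= 1 -> cabs (seg a b s - a) <= cabs (b - a).
Proof.
move=> s01; rewrite -{2}[a](seg0 a b) segB subr0 cabsM cabs_real.
by have := cabs_ge0 (b - a); rewrite ger0_norm; nra.
Qed.

Lemma seg_unif_cont a b : unif_cont01 (seg a b).
Proof.
move=> e e0; have B0 := cabs_ge0 (b - a).
have B1 : 0 < cabs (b - a) + 1 by lra.
exists (e / (cabs (b - a) + 1)); first by rewrite divr_gt0.
move=> s t _ _ st; rewrite -[nrm _]/(cabs _) segB cabsM cabs_real.
by move: st; rewrite ltr_pdivlMr // => ?; have := normr_ge0 (s - t); nra.
Qed.

Lemma seg_variation a b : length_le (seg a b) (cabs (b - a)).
Proof.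
move=> n t [t0 tn tS].
under eq_bigr => i _ do rewrite segB cabsM cabs_real ger0_norm ?subr_ge0 ?tS //.
rewrite -mulr_suml -(big_mkord xpredT (fun i => t i.+1 - t i)).
by rewrite telescope_sumr // t0 tn subr0 mul1r.
Qed.

Definition convex_region (D : set R[i]) : Prop :=
  forall a b s, D a -> D b -> 0 <= s <= 1 -> D (seg a b s).

Definition segment_int q a b : R[i] := contour_integral (V := R[i]^o) (seg a b) (q : R[i] -> R[i]^o).

Lemma contour_integralP (gamma : R -> R[i]^o) q (L : R) :
  unif_cont01 gamma -> length_le gamma L ->
  (forall s, 0 <= s <= 1 -> cont_at q (gamma s)) ->
  is_contour_integral gamma (q : R[i] -> R[i]^o)
    (contour_integral gamma (q : R[i] -> R[i]^o)).
Proof.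
move=> gc gL qc.
have gL' : length_le gamma (Num.max L 1).
  by move=> n t tp; rewrite le_max gL.
have L0 : 0 < Num.max L 1 by rewrite lt_max ltr01 orbT.
have Fc := unif_cont01_comp gc qc.
have [v hv] := contour_integral_exists gc gL' L0 Fc (@complete_seq_complex R).
suff h : is_contour_integral gamma (q : R[i] -> R[i]^o) v.
  by rewrite (contour_integralE h).
apply/is_contour_integralP => e e0.
have e1 : 0 < e / 2 / Num.max L 1 by rewrite !divr_gt0.
have [d d0 hd] := Fc _ e1; exists (d / 2) => [|n t s ts]; first lra.
apply: (@le_lt_trans _ _ (e / 2 / Num.max L 1 * Num.max L 1)).
  apply: hv ts; first exact: ltW.
  by move=> x y x01 y01 xy; apply: hd => //; lra.
by rewrite divfK ?gt_eqF //; lra.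
Qed.

(** The scalar case of the sums, with the product of [R[i]] in place of the action of
    [R[i]] on its regular module. *)
Definition csum (gamma : R -> R[i]) q n (t s : nat -> R) : R[i] :=
  \sum_(i < n) (gamma (t i.+1) - gamma (t i)) * q (gamma (s i)).

Lemma csum_grid (gamma : R -> R[i]^o) q (v : R[i]) :
  is_contour_integral gamma (q : R[i] -> R[i]^o) v ->
  forall e : R, 0 < e -> exists N0, (0 < N0)%N /\ forall N, (N0 <= N)%N ->
    forall s, (forall i, (i < N)%N -> grid R N i <= s i <= grid R N i.+1) ->
    cabs (csum gamma q N (grid R N) s - v) < e.
Proof. exact: contour_integral_grid. Qed.

(** The increments of a primitive telescope around a closed curve. The primitive is only
    needed along the curve, where it has to be one uniformly. *)
Lemma primitive_integral0 (gamma : R -> R[i]^o) q (u : R[i] -> R[i]) (L : R) (v : R[i]) :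
  unif_cont01 gamma -> length_le gamma L -> 0 < L -> gamma 0 = gamma 1 ->
  (forall e : R, 0 < e -> exists2 d : R, 0 < d & forall s t, 0 <= s <= 1 -> 0 <= t <= 1 ->
     cabs (gamma t - gamma s) <= d ->
     cabs ((gamma t - gamma s) * q (gamma s) - (u (gamma t) - u (gamma s)))
       <= e * cabs (gamma t - gamma s)) ->
  is_contour_integral gamma (q : R[i] -> R[i]^o) v -> v = 0.
Proof.
move=> gc gL L0 gcl hu hv; apply: eps_eq0 => e e0.
have L1 : 0 < L + 1 by lra.
pose e1 := e / (L + 1); have e10 : 0 < e1 by rewrite divr_gt0.
have e1L : e1 * (L + 1) = e by rewrite /e1 divfK ?gt_eqF.
clearbody e1.
have [d d0 hd] := hu e1 e10; have [d2 d20 hd2] := gc d d0.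
have [N1 [N10 hN1]] := inv_nat_small d20.
have [N2 [_ hN2]] := csum_grid hv e10.
pose N := maxn N1 N2.
have N0 : (0 < N)%N by rewrite (leq_trans N10) // leq_maxl.
have {}hN1 := hN1 N (leq_maxl _ _).
have := hN2 N (leq_maxr _ _) _ (@grid_left R N).
set S := csum _ _ _ _ _ => Sv.
suff SL : cabs S <= e1 * L.
  by have := cabsB S (S - v); rewrite (_ : S - (S - v) = v); [lra|ring].
pose g i := gamma (grid R N i).
have tele : \sum_(i < N) (u (g i.+1) - u (g i)) = 0.
  rewrite -(big_mkord xpredT (fun i => u (g i.+1) - u (g i))) telescope_sumr //.
  by rewrite /g /grid divff ?pnatr_eq0 -?lt0n // mul0r gcl subrr.
have -> : S = \sum_(i < N) ((g i.+1 - g i) * q (g i) - (u (g i.+1) - u (g i))).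
  by rewrite sumrB tele subr0.
apply: le_trans (cabs_sum _ _ _) _.
apply: (@le_trans _ _ (\sum_(i < N) e1 * cabs (g i.+1 - g i))); last first.
  by rewrite -mulr_sumr ler_pM2l //; apply: gL; exact: grid_partition.
apply: ler_sum => i _; have iN := ltn_ord i.
have g1 : 0 <= grid R N i <= 1 by apply: grid01; exact: ltnW.
have g2 : 0 <= grid R N i.+1 <= 1 by apply: grid01.
apply: hd => //; apply: hd2 => //.
by rewrite gridS addrAC subrr add0r ger0_norm.
Qed.

Section ContinuousOn.
Variables (D : set R[i]) (q : R[i] -> R[i]).
Hypotheses (Dconv : convex_region D) (qc : forall z, D z -> cont_at q z).

Lemma segment_intP a b : D a -> D b ->
  is_contour_integral (seg a b) (q : R[i] -> R[i]^o) (segment_int q a b).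
Proof.
move=> Da Db; apply: contour_integralP (@seg_unif_cont a b) (@seg_variation a b) _.
by move=> s s01; exact/qc/Dconv.
Qed.

#[local] Opaque segment_int.

(** Reversing the segment exchanges left and right tags. *)
Lemma segment_int_rev a b : D a -> D b -> segment_int q b a = - segment_int q a b.
Proof.
move=> Da Db; apply/eqP; rewrite -subr_eq0 opprK; apply/eqP.
apply: eps_eq0 => e e0.
have [N1 [N10 h1]] := csum_grid (segment_intP Da Db) (divr_gt0 e0 (ltr0n _ 2)).
have [N2 [_ h2]] := csum_grid (segment_intP Db Da) (divr_gt0 e0 (ltr0n _ 2)).
set N := maxn N1 N2.
have N0 : (0 < N)%N by rewrite (leq_trans N10) // leq_maxl.
have := h1 N (leq_maxl N1 N2) _ (@grid_right R N).
have := h2 N (leq_maxr N1 N2) _ (@grid_left R N).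
set S2 := csum _ _ _ _ _; set S1 := csum _ _ _ _ _.
have -> : S2 = - S1.
  rewrite /S1 /S2 /csum -sumrN (reindex_inj rev_ord_inj) /=.
  apply: eq_bigr => i _; rewrite -mulNr.
  have i_N := ltn_ord i.
  have flip k : (k <= N)%N -> seg b a (grid R N (N - k)) = seg a b (grid R N k).
    move=> kN; rewrite /seg /grid natrB // mulrBl divff ?pnatr_eq0 -?lt0n //.
    by rewrite rmorphB rmorph1; ring.
  rewrite -(flip i.+1) // -(flip i) 1?ltnW //.
  by rewrite subnSK // opprB.
clearbody S1; move: (segment_int q b a) (segment_int q a b) => x y.
have -> : x + y = - (- S1 - x) - (S1 - y) by ring.
move=> hh hh1; have := cabsB (- (- S1 - x)) (S1 - y).
by rewrite cabsN; lra.
Qed.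

(** Grids with an even number of steps on the whole segment restrict to grids on
    its halves. *)
Lemma segment_int_mid a b : D a -> D b ->
  segment_int q a b = segment_int q a ((a + b) / 2) + segment_int q ((a + b) / 2) b.
Proof.
move=> Da Db.
have midE : (a + b) / 2 = seg a b (1 / 2).
  by rewrite /seg rmorphM fmorphV rmorph1 rmorph_nat; field.
have Dm : D ((a + b) / 2) by rewrite midE; apply: Dconv => //; lra.
set m := (a + b) / 2 in midE Dm *; apply/eqP; rewrite -subr_eq0; apply/eqP.
apply: eps_eq0 => e e0.
have e3 := divr_gt0 e0 (ltr0n _ 3).
have [N1 [N10 h1]] := csum_grid (segment_intP Da Db) e3.
have [N2 [_ h2]] := csum_grid (segment_intP Da Dm) e3.
have [N3 [_ h3]] := csum_grid (segment_intP Dm Db) e3.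
set N := (N1 + N2 + N3)%N.
have N0 : (0 < N)%N by rewrite (leq_trans N10) // /N -addnA leq_addr.
have N1N : (N1 <= N + N)%N by rewrite /N -!addnA leq_addr.
have N2N : (N2 <= N)%N by rewrite /N addnAC leq_addl.
have N3N : (N3 <= N)%N by rewrite /N leq_addl.
clearbody N; have := h1 _ N1N _ (@grid_left R (N + N)); have := h2 _ N2N _ (@grid_left R N).
have := h3 _ N3N _ (@grid_left R N).
set S3 := csum (seg m b) _ _ _ _; set S2 := csum (seg a m) _ _ _ _.
set S1 := csum _ _ _ _ _.
have NN : N%:R != 0 :> R by rewrite pnatr_eq0 -lt0n.
have NC : N%:R != 0 :> R[i] by rewrite pnatr_eq0 -lt0n.
have NNC : N%:R + N%:R != 0 :> R[i] by rewrite -natrD pnatr_eq0 -lt0n addn_gt0 N0.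
have half1 k : seg a b (grid R (N + N) k) = seg a m (grid R N k).
  rewrite /seg /grid /m natrD !rmorphM !fmorphV rmorphD !rmorph_nat; field.
  by rewrite ?NC ?NNC.
have half2 k : seg a b (grid R (N + N) (N + k)) = seg m b (grid R N k).
  rewrite /seg /grid /m !natrD !rmorphM !fmorphV !rmorphD !rmorph_nat; field.
  by rewrite ?NC ?NNC.
have -> : S1 = S2 + S3.
  rewrite /S1 /S2 /S3 /csum big_split_ord /=; congr (_ + _).
    by apply: eq_bigr => i _; rewrite !half1.
  by apply: eq_bigr => i _; rewrite -addnS !half2.
clearbody S2 S3; move: (segment_int q a b) (segment_int q a m) (segment_int q m b) => x y z.
move=> hh3 hh2 hh1.
have -> : x - (y + z) = (S2 - y) + (S3 - z) - (S2 + S3 - x) by ring.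
have := cabsB ((S2 - y) + (S3 - z)) (S2 + S3 - x).
have := cabsD (S2 - y) (S3 - z); lra.
Qed.

Lemma segment_int_le a b (M : R) : D a -> D b -> 0 <= M ->
  (forall s, 0 <= s <= 1 -> cabs (q (seg a b s)) <= M) ->
  cabs (segment_int q a b) <= M * cabs (b - a).
Proof.
move=> Da Db M0 hM.
exact: (@contour_integral_le R (R[i]^o) (seg a b) q _ M _ (@seg_variation a b) M0 hM (segment_intP Da Db)).
Qed.

End ContinuousOn.

Lemma segment_int_affine (al be : R[i]) a b :
  is_contour_integral (seg a b) ((fun z => al + be * z) : R[i] -> R[i]^o)
    (al * (b - a) + be * (b ^+ 2 - a ^+ 2) / 2).
Proof.
set q := fun _ => _.
have qc z : cont_at q z.
  move=> e e0; have B0 := cabs_ge0 be; have B1 : 0 < cabs be + 1 by lra.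
  exists (e / (cabs be + 1)) => [|w]; first by rewrite divr_gt0.
  rewrite ltr_pdivlMr // => zw.
  have -> : q w - q z = be * (w - z) by rewrite /q; ring.
  by rewrite cabsM; have := cabs_ge0 (w - z); nra.
have hJ := segment_intP (D := setT) (fun _ _ _ _ _ _ => I) (fun z _ => qc z) (I : setT a) (I : setT b).
suff <- : segment_int q a b = al * (b - a) + be * (b ^+ 2 - a ^+ 2) / 2 by [].
apply/eqP; rewrite -subr_eq0; apply/eqP; apply: eps_eq0 => e e0.
have [N [N0 h]] := csum_grid hJ e0.
have := h N (leqnn _) _ (@grid_right R N); have := h N (leqnn _) _ (@grid_left R N).
set S1 := csum _ _ _ _ _; set S2 := csum _ _ _ _ _.
(* The mean of the left and right sums is exact for an affine integrand. *)
have SS : S1 + S2 = 2 * (al * (b - a) + be * (b ^+ 2 - a ^+ 2) / 2).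
  rewrite /S1 /S2 /csum -big_split /=.
  pose f i := 2 * al * seg a b (grid R N i) + be * seg a b (grid R N i) ^+ 2.
  rewrite (eq_bigr (fun i : 'I_N => f i.+1 - f i)); last first.
    move=> i _; rewrite /f /q; set x := seg _ _ _; set y := seg _ _ _.
    by ring.
  rewrite -(big_mkord xpredT (fun i => f i.+1 - f i)) telescope_sumr // /f.
  rewrite /grid divff ?pnatr_eq0 -?lt0n // mul0r seg0 seg1; by field.
set v := al * _ + _ in SS *.
clearbody S1 S2 v; move: (segment_int q a b) => x k1 k2.
have -> : x - v = - ((S1 - x) / 2 + (S2 - x) / 2).
  by rewrite -mulrDl addrACA SS; field.
have half z : cabs (z / 2) = cabs z / 2 by rewrite cabsM cabsV (cabs_nat R 2).
rewrite cabsN; have := cabsD ((S1 - x) / 2) ((S2 - x) / 2).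
rewrite !half; lra.
Qed.

End Segments.

(** * Goursat's theorem for triangles *)

Section Goursat.
Variable R : realType.
Implicit Types (a b c z w p : R[i]) (q : R[i] -> R[i]) (K D : set R[i]).

Definition cdiff q z (d : R[i]) : Prop :=
  forall e : R, 0 < e -> exists2 r : R, 0 < r &
    forall w, cabs (w - z) < r ->
      cabs (q w - q z - d * (w - z)) <= e * cabs (w - z).

Lemma cdiff_cont q z d : cdiff q z d -> cont_at q z.
Proof.
move=> h e e0; have [r r0 hr] := h 1 ltr01.
have d0 := cabs_ge0 d; have d1 : 0 < cabs d + 1 by lra.
exists (Num.min r (e / (cabs d + 1))) => [|w]; first by rewrite lt_min r0 divr_gt0.
rewrite lt_min ltr_pdivlMr // => /andP[/hr wr we].
have -> : q w - q z = q w - q z - d * (w - z) + d * (w - z) by ring.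
by apply: le_trans (cabsD _ _) _; rewrite cabsM; lra.
Qed.

#[local] Opaque segment_int.

Lemma segment_int_near_affine D q (al be : R[i]) a b (M : R) :
  convex_region D -> (forall z, D z -> cont_at q z) -> D a -> D b -> 0 <= M ->
  (forall s, 0 <= s <= 1 -> cabs (q (seg a b s) - (al + be * seg a b s)) <= M) ->
  cabs (segment_int q a b - (al * (b - a) + be * (b ^+ 2 - a ^+ 2) / 2)) <= M * cabs (b - a).
Proof.
move=> Dc qc Da Db M0 hM.
have h := is_contour_integralB (segment_intP Dc qc Da Db) (segment_int_affine al be a b).
exact: (@contour_integral_le R (R[i]^o) _ _ _ M _ (@seg_variation R a b) M0 hM h).
Qed.

Definition triangle_int q a b c := segment_int q a b + segment_int q b c + segment_int q c a.

Lemma convex_region_mid D a b : convex_region D -> D a -> D b -> D ((a + b) / 2).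
Proof.
move=> Dc Da Db; have -> : (a + b) / 2 = seg a b (1 / 2).
  by rewrite /seg rmorphM fmorphV rmorph1 rmorph_nat; field.
by apply: Dc => //; lra.
Qed.

Lemma triangle_int_split D q a b c : convex_region D -> (forall z, D z -> cont_at q z) ->
  D a -> D b -> D c ->
  triangle_int q a b c = triangle_int q a ((a + b) / 2) ((c + a) / 2) + triangle_int q ((a + b) / 2) b ((b + c) / 2) +
    triangle_int q ((c + a) / 2) ((b + c) / 2) c +
    triangle_int q ((a + b) / 2) ((b + c) / 2) ((c + a) / 2).
Proof.
move=> Dc qc Da Db Dcc; have Dab := convex_region_mid Dc Da Db.
have Dbc := convex_region_mid Dc Db Dcc; have Dca := convex_region_mid Dc Dcc Da.
rewrite /triangle_int (segment_int_mid Dc qc Da Db) (segment_int_mid Dc qc Db Dcc) (segment_int_mid Dc qc Dcc Da).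
move: (_ / 2) (_ / 2) (_ / 2) Dab Dbc Dca => m n o Dm Dn Do.
rewrite (segment_int_rev Dc qc Dm Dn) (segment_int_rev Dc qc Dn Do) (segment_int_rev Dc qc Do Dm).
by move: (segment_int _ _ _) (segment_int _ _ _) (segment_int _ _ _) (segment_int _ _ _)
  (segment_int _ _ _) (segment_int _ _ _) (segment_int _ _ _)
  (segment_int _ _ _) (segment_int _ _ _) => *; ring.
Qed.

Lemma triangle_intE q a b c : triangle_int q a b c = segment_int q a b + segment_int q b c + segment_int q c a.
Proof. by []. Qed.

#[local] Opaque triangle_int.

Definition closed_set_eps K : Prop :=
  forall z, (forall e : R, 0 < e -> exists2 w, K w & cabs (w - z) <= e) -> K z.

Lemma cabs_half z : cabs (z / 2) = cabs z / 2.
Proof. by rewrite cabsM cabsV (cabs_nat R 2). Qed.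

Lemma half_pow_small (d e : R) : 0 <= d -> 0 < e ->
  exists N, forall n, (N <= n)%N -> d / 2 ^+ n < e.
Proof.
move=> d0 e0; have [N [Np hN]] := inv_nat_small (divr_gt0 e0 (ltr_wpDl d0 (@ltr01 R))).
exists N => n Nn; have h := hN n Nn; have n0 : (0 < n)%N := leq_trans Np Nn.
have nR : 0 < n%:R :> R by rewrite ltr0n.
have n2 : n%:R <= 2 ^+ n :> R by rewrite -natrX ler_nat ltnW // ltn_expl.
have p2 : 0 < 2 ^+ n :> R by rewrite exprn_gt0.
rewrite ltr_pdivrMr //; move: h; rewrite invf_plt ?posrE ?divr_gt0 //; last lra.
by rewrite invf_div ltr_pdivrMr // => h; nra.
Qed.

Definition sides (x : R[i] * R[i] * R[i]) (d : R) : Prop :=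
  let: (a, b, c) := x in [/\ cabs (a - b) <= d, cabs (b - c) <= d & cabs (c - a) <= d].

(** Goursat's bisection. The integrals around the four triangles cut out by the midpoints
    add up to the whole, so one of them carries a quarter of it; the triangles chosen in
    this way shrink to a point, near which the integrand is affine up to a small error, and
    affine functions have primitives. *)
Lemma Goursat_triangle K q a b c : convex_region K -> closed_set_eps K ->
  (forall z, K z -> exists d, cdiff q z d) ->
  K a -> K b -> K c -> triangle_int q a b c = 0.
Proof.
move=> Kc Kcl Kd Ka Kb Kcc.
have qc z : K z -> cont_at q z by move=> /Kd[d /cdiff_cont].
pose Tr (x : R[i] * R[i] * R[i]) := triangle_int q x.1.1 x.1.2 x.2.
pose inK (x : R[i] * R[i] * R[i]) := [/\ K x.1.1, K x.1.2 & K x.2].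
(* [Nx x y]: the triangle [y] is a good quarter of [x]; the last bound makes the first
   vertices a Cauchy sequence. *)
pose Nx x y := inK x -> [/\ inK y, cabs (Tr x) <= 4 * cabs (Tr y) &
  forall d, sides x d -> sides y (d / 2) /\ cabs (y.1.1 - x.1.1) <= d].
have step x : exists y, Nx x y.
  have [xK|] := pselect (inK x); last by exists x.
  move: x xK => [[x y] z] [/= Kx Ky Kz].
  have Kxy := convex_region_mid Kc Kx Ky; have Kyz := convex_region_mid Kc Ky Kz.
  have Kzx := convex_region_mid Kc Kz Kx.
  have pigeon (t1 t2 t3 t4 t : R[i]) : t = t1 + t2 + t3 + t4 ->
      [\/ cabs t <= 4 * cabs t1, cabs t <= 4 * cabs t2, cabs t <= 4 * cabs t3
        | cabs t <= 4 * cabs t4].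
    move=> ->; have := cabsD (t1 + t2 + t3) t4; have := cabsD (t1 + t2) t3.
    have := cabsD t1 t2; move: (cabs (_ + t4)) (cabs (_ + t3)) => A B C1 C2 C3.
    have [h1|h1] := leP A (4 * cabs t1); first by constructor 1.
    have [h2|h2] := leP A (4 * cabs t2); first by constructor 2.
    have [h3|h3] := leP A (4 * cabs t3); first by constructor 3.
    by constructor 4; lra.
  have half u v w : u - v = w / 2 -> forall d, cabs w <= d -> cabs (u - v) <= d / 2.
    by move=> -> d wd; rewrite cabs_half; lra.
  have dd (d : R) w : cabs w <= d -> cabs w / 2 <= d by have := cabs_ge0 w; lra.
  have [h|h|h|h] := pigeon _ _ _ _ _ (triangle_int_split Kc qc Kx Ky Kz).
  - exists (x, (x + y) / 2, (z + x) / 2) => _; split=> //= {h}d [s1 s2 s3]; split.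
      by split; [apply: half s1; field|apply: half s2; field|apply: half s3; field].
    by rewrite subrr cabs0; have := cabs_ge0 (x - y); lra.
  - exists ((x + y) / 2, y, (y + z) / 2) => _; split=> //= {h}d [s1 s2 s3]; split.
      by split; [apply: half s1; field|apply: half s2; field|apply: half s3; field].
    have -> : (x + y) / 2 - x = - ((x - y) / 2) by field.
    by rewrite cabsN cabs_half; exact: dd.
  - exists ((z + x) / 2, (y + z) / 2, z) => _; split=> //= {h}d [s1 s2 s3]; split.
      by split; [apply: half s1; field|apply: half s2; field|apply: half s3; field].
    have -> : (z + x) / 2 - x = (z - x) / 2 by field.
    by rewrite cabs_half; exact: dd.
  - exists ((x + y) / 2, (y + z) / 2, (z + x) / 2) => _; split=> //= {h}d [s1 s2 s3]; split.
      split; [apply: (half _ _ (x - z))|apply: (half _ _ (y - x))|apply: (half _ _ (z - y))];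
        by rewrite 1?cabsC //; field.
    have -> : (x + y) / 2 - x = - ((x - y) / 2) by field.
    by rewrite cabsN cabs_half; exact: dd.
have [next nextP] := choice step.
have {next nextP step} [u u0 uS] : exists2 u, u 0%N = (a, b, c) & forall n, Nx (u n) (u n.+1).
  by exists (fun n => iter n next (a, b, c)) => // n; exact: nextP.
pose d0 := cabs (a - b) + cabs (b - c) + cabs (c - a).
have d00 : 0 <= d0 by rewrite !addr_ge0 ?cabs_ge0.
pose d n := d0 / 2 ^+ n.
have dS n : d n.+1 = d n / 2 by rewrite /d exprS invfM; field; rewrite expf_neq0.
have d_ge0 n : 0 <= d n by rewrite divr_ge0 // exprn_ge0.
have uP n : [/\ inK (u n), sides (u n) (d n) & cabs (triangle_int q a b c) <= 4 ^+ n * cabs (Tr (u n))].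
  elim: n => [|n [h1 h2 h3]].
    rewrite u0 expr0 mul1r /d expr0 divr1; split=> //; rewrite /d0.
    by have := cabs_ge0 (a - b); have := cabs_ge0 (b - c); have := cabs_ge0 (c - a);
      split; lra.
  have [h4 h5 h6] := uS n h1; have [h7 _] := h6 _ h2; split; first exact: h4.
    by rewrite dS; exact: h7.
  by apply: le_trans h3 _; rewrite exprSr -mulrA ler_wpM2l ?exprn_ge0.
pose v n := (u n).1.1.
have vstep n k : cabs (v (n + k)%N - v n) <= 2 * d n - 2 * d (n + k)%N.
  elim: k => [|k IH]; first by rewrite addn0 !subrr cabs0.
  rewrite addnS; have [h1 h2 _] := uP (n + k)%N; have [_ _ h6] := uS _ h1.
  have [_ h7] := h6 _ h2; rewrite dS.
  have -> : v (n + k).+1 - v n = (v (n + k).+1 - v (n + k)%N) + (v (n + k)%N - v n) by ring.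
  by apply: le_trans (cabsD _ _) _; move: h7; rewrite -!/(v _); lra.
have [|l hl] := @complete_seq_complex R v.
  move=> e e0; have [N hN] := half_pow_small d00 (divr_gt0 e0 (ltr0n _ 4)).
  exists N => m n /subnKC mN /subnKC nN; have h := hN N (leqnn _).
  rewrite -mN -nN -[nrm _]/(cabs _).
  have -> : v (N + (m - N))%N - v (N + (n - N))%N =
    (v (N + (m - N))%N - v N) - (v (N + (n - N))%N - v N) by ring.
  apply: le_trans (cabsB _ _) _.
  have := vstep N (m - N)%N; have := vstep N (n - N)%N.
  by have := d_ge0 (N + (m - N))%N; have := d_ge0 (N + (n - N))%N; move: h; rewrite -/(d N); lra.
have vl n : cabs (v n - l) <= 2 * d n.
  apply/ler_addgt0Pl => e e0; have [N hN] := hl e e0.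
  have := hN (n + N)%N (leq_addl _ _); rewrite -[nrm _]/(cabs _) => h.
  have := vstep n N; have := d_ge0 (n + N)%N.
  have -> : v n - l = (v (n + N)%N - l) - (v (n + N)%N - v n) by ring.
  by have := cabsB (v (n + N)%N - l) (v (n + N)%N - v n); lra.
have Kl : K l.
  apply: Kcl => e e0; have [N hN] := hl e e0.
  by exists (v N); [have [[]] := uP N|exact: hN].
have [g hg] := Kd l Kl.
apply: eps_eq0 => e e0.
have m0 : 0 < 12 * d0 ^+ 2 + 1 by have := sqr_ge0 d0; lra.
(* Three sides of length at most [d N], on which the error is at most [e1 * (4 * d N)],
   account for the constant 12. *)
pose e1 := e / (12 * d0 ^+ 2 + 1).
have e10 : 0 < e1 by rewrite divr_gt0.
have [r r0 hr] := hg e1 e10.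
have [N hN] := half_pow_small d00 (divr_gt0 r0 (ltr0n _ 5)).
have {}hN := hN N (leqnn _); rewrite -/(d N) in hN.
have [] := uP N; move: (vl N); rewrite /v.
case: (u N) => [[x y] z] /= xl [/= Kx Ky Kz] [xy yz zx] hT.
have edge s t : cabs (s - t) <= d N -> cabs (s - x) <= d N -> K s -> K t ->
    cabs (segment_int q s t - ((q l - g * l) * (t - s) + g * (t ^+ 2 - s ^+ 2) / 2))
      <= e1 * (4 * d N) * d N.
  move=> st sx Ks Kt; have dN := d_ge0 N; clear hT uP u0 Tr inK Nx uS.
  apply: (@le_trans _ _ (e1 * (4 * d N) * cabs (t - s))); last first.
    have c0 : 0 <= e1 * (4 * d N) := mulr_ge0 (ltW e10) (mulr_ge0 (ler0n _ 4) dN).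
    by apply: ler_wpM2l => //; rewrite cabsC.
  apply: segment_int_near_affine Kc qc Ks Kt _ _; first exact: mulr_ge0 (ltW e10) (mulr_ge0 (ler0n _ 4) dN).
  move=> o o01; move: (seg_dist s t o01); rewrite (cabsC t); move: (seg s t o) => p ps.
  have pl : cabs (p - l) <= 4 * d N.
    have -> : p - l = (p - s) + (s - x) + (x - l) by ring.
    by have := cabsD (p - s + (s - x)) (x - l); have := cabsD (p - s) (s - x); lra.
  have -> : q p - (q l - g * l + g * p) = q p - q l - g * (p - l) by ring.
  apply: le_trans (hr _ _) _; first lra.
  by apply: ler_wpM2l => //; exact: ltW.
have e1x := edge x y xy _ Kx Ky; rewrite subrr cabs0 in e1x.
have {e1x} h1 := e1x (d_ge0 N).
have h2 := edge y z yz _ Ky Kz; rewrite (cabsC y) in h2; have {}h2 := h2 xy.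
have h3 := edge z x zx zx Kz Kx.
apply: le_trans hT _; rewrite /Tr triangle_intE /=.
move: h1 h2 h3; move: (segment_int q x y) (segment_int q y z) (segment_int q z x) => j1 j2 j3 h1 h2 h3.
set A1 := (X in cabs (j1 - X)) in h1; set A2 := (X in cabs (j2 - X)) in h2.
set A3 := (X in cabs (j3 - X)) in h3.
have -> : j1 + j2 + j3 = (j1 - A1) + (j2 - A2) + (j3 - A3).
  by rewrite /A1 /A2 /A3; field.
have h4 : cabs (j1 - A1 + (j2 - A2) + (j3 - A3)) <= 12 * e1 * d N ^+ 2.
  apply: le_trans (cabsD _ _) _; have := cabsD (j1 - A1) (j2 - A2).
  by rewrite expr2; lra.
apply: le_trans (_ : 4 ^+ N * (12 * e1 * d N ^+ 2) <= e).
  by rewrite ler_wpM2l ?exprn_ge0.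
have -> : 4 ^+ N * (12 * e1 * d N ^+ 2) = e1 * (12 * d0 ^+ 2).
  rewrite /d expr_div_n -exprM mulnC exprM (_ : 2 ^+ 2 = 4 :> R); last by rewrite expr2; lra.
  by field; rewrite expf_neq0 // gt_eqF.
rewrite /e1 -mulrA ler_piMr ?(ltW e0) // mulrC ler_pdivrMr //; lra.
Qed.

End Goursat.

(** * Primitives in a disc with one exceptional point *)

Section Primitive.
Variable R : realType.
Implicit Types (a b c z w p d : R[i]) (q : R[i] -> R[i]) (K D : set R[i]).

#[local] Opaque segment_int triangle_int.

Lemma cabs_seg_le a b s (r : R) : 0 <= s <= 1 -> cabs a <= r -> cabs b <= r ->
  cabs (seg a b s) <= r.
Proof.
move=> s01 ar br; have -> : seg a b s = (1 - s)%:C * a + s%:C * b :> R[i].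
  by rewrite /seg rmorphB rmorph1; ring.
apply: le_trans (cabsD _ _) _; rewrite !cabsM !cabs_real !ger0_norm; first nra.
  lra.
lra.
Qed.

Lemma convex_open_disc (r : R) : convex_region [set z : R[i] | cabs z < r].
Proof.
move=> a b s /= ar br s01.
apply: le_lt_trans (cabs_seg_le s01 (_ : _ <= Num.max (cabs a) (cabs b)) _) _.
- by rewrite le_max lexx.
- by rewrite le_max lexx orbT.
by rewrite gt_max ar.
Qed.

(** The real scalar product of the plane. *)
Definition dot z d : R := complex.Re (z * Num.conj d).

Lemma dotD z w d : dot (z + w) d = dot z d + dot w d.
Proof. by rewrite /dot mulrDl; move: (z * _) (w * _) => [? ?] [? ?]. Qed.

Lemma dotZ (r : R) z d : dot (r%:C * z) d = r * dot z d.
Proof. by rewrite /dot -mulrA; move: (z * _) => [x y] /=; rewrite mul0r subr0. Qed.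

Lemma dot_le z d : `|dot z d| <= cabs z * cabs d.
Proof. by rewrite -(cabs_conj d) -cabsM cabs_Re. Qed.

Lemma dotzz z : dot z z = cabs z ^+ 2.
Proof.
rewrite /dot -normCK normcE_cabs -rmorphXn /=; exact: erefl.
Qed.

(** The part of a closed disc lying in a closed half-plane is the convex set to
    which Goursat's theorem is applied: it avoids the point [p]. *)
Definition disc_cap (r : R) p d (eta : R) : set R[i] :=
  [set z | cabs z <= r /\ eta <= dot (z - p) d].

Lemma disc_cap_convex r p d eta : convex_region (disc_cap r p d eta).
Proof.
move=> a b s [/= ar ap] [br bp] s01; split; first exact: cabs_seg_le.
have -> : seg a b s - p = (1 - s)%:C * (a - p) + s%:C * (b - p) :> R[i].
  by rewrite /seg rmorphB rmorph1; ring.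
rewrite dotD !dotZ; move: (dot _ _) (dot _ _) ap bp => x y; nra.
Qed.

Lemma disc_cap_closed r p d eta : closed_set_eps (disc_cap r p d eta).
Proof.
move=> z hz; split.
  apply/ler_addgt0Pl => e e0; have [w [/= wr _] zw] := hz e e0.
  by have := cabs_gtB z w; rewrite cabsC; lra.
have d0 := cabs_ge0 d; have d1 : 0 < cabs d + 1 by lra.
apply/ler_addgt0Pl => e e0; have [w [/= _ wp] zw] := hz _ (divr_gt0 e0 d1).
have := dotD (w - z) (z - p) d; rewrite addrA subrK => E.
have := dot_le (w - z) d; rewrite ler_norml => /andP[_].
move: zw; rewrite ler_pdivlMr // => zw; have := cabs_ge0 (w - z); lra.
Qed.

Section ExceptionalPoint.
Variables (R0 : R) (p : R[i]) (q : R[i] -> R[i]).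
Hypothesis pR : cabs p < R0.
Hypothesis qc : forall z, cabs z < R0 -> cont_at q z.
Hypothesis qd : forall z, cabs z < R0 -> z != p -> exists g, cdiff q z g.

Let D : set R[i] := [set z | cabs z < R0].
Let Dc : convex_region D := @convex_open_disc R0.
Let qcD : forall z, D z -> cont_at q z := qc.

(** The quadrilateral between the two triangles avoids [p]: it is cut into two triangles
    to which Goursat's theorem applies. *)
Lemma triangle_int_half a b d (eta : R) : D a -> D b -> 0 < eta ->
  eta <= dot (a - p) d -> eta <= dot (b - p) d ->
  triangle_int q p a b = triangle_int q p ((p + a) / 2) ((p + b) / 2).
Proof.
move=> Da Db eta0 ha hb; have Dp : D p by exact: pR.
have Da' := convex_region_mid Dc Dp Da; have Db' := convex_region_mid Dc Dp Db.
pose r1 := Num.max (Num.max (cabs a) (cabs b)) (cabs p).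
pose K := disc_cap r1 p d (eta / 2).
have KD z : K z -> D z.
  by move=> [/= zr _]; apply: le_lt_trans zr _; rewrite !gt_max Da Db Dp.
have Kd z : K z -> exists g, cdiff q z g.
  move=> Kz; apply: qd; first exact: KD.
  case: Kz => /= _; apply: contraTneq => ->; rewrite subrr /dot mul0r /= -ltNge; lra.
have mid (x : R[i]) : dot ((p + x) / 2 - p) d = dot (x - p) d / 2.
  have -> : (p + x) / 2 - p = (2^-1 : R)%:C * (x - p).
    by rewrite fmorphV rmorph_nat; field.
  by rewrite dotZ mulrC.
have half_r (x : R[i]) : cabs x <= r1 -> cabs ((p + x) / 2) <= r1.
  move=> xr; rewrite cabs_half; have := cabsD p x.
  have : cabs p <= r1 by rewrite /r1 le_max lexx orbT.
  lra.
have Ka : K a by split => /=; [rewrite /r1 !le_max lexx|lra].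
have Kb : K b by split => /=; [rewrite /r1 !le_max lexx orbT|lra].
have Ka' : K ((p + a) / 2) by split => /=; [apply: half_r; case: Ka|rewrite mid; lra].
have Kb' : K ((p + b) / 2) by split => /=; [apply: half_r; case: Kb|rewrite mid; lra].
have Kcv : convex_region K := @disc_cap_convex _ _ _ _; have Kcl : closed_set_eps K := @disc_cap_closed _ _ _ _.
have t1 := Goursat_triangle Kcv Kcl Kd Ka' Ka Kb.
have t2 := Goursat_triangle Kcv Kcl Kd Ka' Kb Kb'.
move: t1 t2; rewrite !triangle_intE (segment_int_mid Dc qcD Dp Da).
have -> : segment_int q b p = segment_int q b ((p + b) / 2) + segment_int q ((p + b) / 2) p.
  by rewrite (segment_int_mid Dc qcD Db Dp) [b + p]addrC.
move: Da' Db'; move: (_ / 2) (_ / 2) => m n Dm Dn.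
rewrite (segment_int_rev Dc qcD Db Dm) (segment_int_rev Dc qcD Dm Dn).
move: (segment_int q _ _) (segment_int q _ _) (segment_int q _ _) (segment_int q _ _) (segment_int q
  _ _) (segment_int q _ _) (segment_int q _ _) => j1 j2 j3 j4 j5 j6 j7.
move=> t1 t2.
have -> : j2 + j7 + j6 + (j4 + j1) =
    (j7 + j6 + j5) + (- j5 + j4 - j3) + (j2 + j3 + j1) by ring.
by rewrite t1 t2 !add0r.
Qed.

(** A triangle with a vertex at the exceptional point shrinks to it without
    changing the integral, as long as its other two vertices are seen from the
    exceptional point in a common open half-plane. *)
Lemma triangle_int0_cone z w : D z -> D w -> z != p -> 2 * cabs (w - z) <= cabs (z - p) ->
  triangle_int q p z w = 0.
Proof.
move=> Dz Dw zp wz; have Dp : D p by exact: pR.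
pose d := z - p; have d0 : 0 < cabs d by rewrite cabs_gt0 subr_eq0.
have hz : cabs d ^+ 2 / 2 <= dot (z - p) d by rewrite dotzz; have := exprn_gt0 2 d0; lra.
have hw : cabs d ^+ 2 / 2 <= dot (w - p) d.
  have -> : w - p = (w - z) + (z - p) by ring.
  rewrite dotD dotzz; have := dot_le (w - z) d; rewrite ler_norml => /andP[h _].
  move: h wz; rewrite -/d expr2; move: (cabs (w - z)) (cabs d) (dot _ _) d0 => x y o *; nra.
have eta0 : 0 < cabs d ^+ 2 / 2 by rewrite divr_gt0 ?exprn_gt0.
(* [sh n] is the homothety of centre [p] and ratio [2 ^- n]. *)
pose sh n (x : R[i]) : R[i] := p + (2 ^- n : R)%:C * (x - p).
have half2 : (2^-1 : R)%:C = 2^-1 by rewrite fmorphV rmorph_nat.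
have shS n x : (p + sh n x) / 2 = sh n.+1 x.
  by rewrite /sh exprSr invfM rmorphM /= half2; field; rewrite fmorph_eq0 expf_neq0.
have sh_dot n x : dot (sh n x - p) d = 2 ^- n * dot (x - p) d.
  by rewrite /sh addrC addKr dotZ.
have sh_dist n x y : cabs (sh n x - sh n y) = 2 ^- n * cabs (x - y).
  have -> : sh n x - sh n y = (2 ^- n : R)%:C * (x - y) by rewrite /sh; ring.
  by rewrite cabsM cabs_real ger0_norm // invr_ge0 exprn_ge0.
have shp n : sh n p = p by rewrite /sh subrr mulr0 addr0.
have sh0 x : sh 0%N x = x by rewrite /sh expr0 invr1 rmorph1; ring.
have p2 n : 0 < 2 ^- n :> R by rewrite invr_gt0 exprn_gt0.
have shD n x : D x -> D (sh n x).
  by elim: n => [|n IH] Dx; [rewrite sh0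
                            |rewrite -shS; apply: convex_region_mid Dc _ (IH Dx)].
have Tsh n : triangle_int q p z w = triangle_int q p (sh n z) (sh n w).
  elim: n => [|n IH].
    by rewrite !sh0.
  have h1 : 2 ^- n * (cabs d ^+ 2 / 2) <= dot (sh n z - p) d.
    by rewrite sh_dot ler_pM2l.
  have h2 : 2 ^- n * (cabs d ^+ 2 / 2) <= dot (sh n w - p) d.
    by rewrite sh_dot ler_pM2l.
  have := triangle_int_half (shD n _ Dz) (shD n _ Dw) (mulr_gt0 (p2 n) eta0) h1 h2.
  by rewrite !shS => <-.
have [r r0 hr] := qc pR ltr01.
pose C := cabs (z - p) + cabs (w - z) + cabs (p - w).
have C0 : 0 <= C by rewrite !addr_ge0 ?cabs_ge0.
pose M := cabs (q p) + 1; have M0 : 0 < M by have := cabs_ge0 (q p); rewrite /M; lra.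
apply: eps_eq0 => e e0.
have [N1 h1] := half_pow_small (mulr_ge0 (ltW M0) C0) e0.
have [N2 h2] := half_pow_small C0 r0.
pose N := maxn N1 N2; have {}h1 := h1 N (leq_maxl _ _).
have {}h2 := h2 N (leq_maxr _ _); rewrite (Tsh N) triangle_intE.
have edge x y : D x -> D y -> 2 ^- N * (cabs (x - p) + cabs (y - x)) < r ->
    cabs (segment_int q (sh N x) (sh N y)) <= M * (2 ^- N * cabs (y - x)).
  move=> Dx Dy xy; rewrite -sh_dist; apply: (segment_int_le Dc qcD).
  - exact: shD.
  - exact: shD.
  - exact: ltW.
  move=> s s01; set o := seg _ _ _.
  have : cabs (o - p) < r.
    have -> : o - p = (o - sh N x) + (sh N x - p) by ring.
    apply: le_lt_trans (cabsD _ _) _; apply: le_lt_trans xy.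
    have E1 := sh_dist N x p; rewrite shp in E1.
    rewrite mulrDr -E1 -sh_dist addrC lerD2l; exact: seg_dist.
  move=> /hr h; have := cabsD (q o - q p) (q p); rewrite subrK /M; lra.
have c1 := cabs_ge0 (z - p); have c2 := cabs_ge0 (w - z); have c3 := cabs_ge0 (p - w).
have bound X : X <= C -> 2 ^- N * X < r.
  by move=> XC; apply: le_lt_trans h2; rewrite mulrC ler_pM2r.
have e1 := edge p z Dp Dz; rewrite subrr cabs0 add0r in e1.
have k1 : cabs (z - p) <= C by rewrite /C -addrA lerDl addr_ge0.
have k2 : cabs (z - p) + cabs (w - z) <= C by rewrite /C lerDl.
have {}e1 := e1 (bound _ k1); have e2 := edge z w Dz Dw (bound _ k2).
have pw2 : cabs (p - w) <= cabs (z - p) + cabs (w - z).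
  by rewrite (cabsC p) (_ : w - p = (z - p) + (w - z)) ?cabsD //; ring.
have wp2 : cabs (w - p) + cabs (p - w) <= C by rewrite (cabsC w) /C lerD2r.
have e3 := edge w p Dw Dp (bound _ wp2).
rewrite !shp in e1 e3.
move: (segment_int q _ _) (segment_int q _ _) (segment_int q _ _) e1 e2 e3 => j1 j2 j3 e1 e2 e3.
apply: le_trans (ltW h1).
have -> : M * C / 2 ^+ N = M * (2 ^- N * cabs (z - p)) + M * (2 ^- N * cabs (w - z)) +
   M * (2 ^- N * cabs (p - w)) by rewrite /C; ring.
apply: le_trans (cabsD _ _) _; have := cabsD j3 j2; lra.
Qed.

Lemma segment_int_base z w : D z -> D w -> z != p -> 2 * cabs (w - z) <= cabs (z - p) ->
  segment_int q p w - segment_int q p z = segment_int q z w.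
Proof.
move=> Dz Dw zp wz;
  have := triangle_int0_cone Dz Dw zp wz; rewrite triangle_intE (segment_int_rev Dc qcD (pR : D p) Dw).
by move: (segment_int q p w) (segment_int q p z) (segment_int q z w) => x y t /eqP; rewrite subr_eq0
  addrC => /eqP <-; ring.
Qed.

(** The integral from the exceptional point along segments is a primitive away from that
    point. *)
Lemma closed_curve_integral0 (gamma : R -> R[i]^o) (L eta r : R) :
  unif_cont01 gamma -> length_le gamma L -> 0 < L -> gamma 0 = gamma 1 ->
  0 < eta -> r < R0 ->
  (forall s, 0 <= s <= 1 -> cabs (gamma s) <= r /\ eta <= cabs (gamma s - p)) ->
  is_contour_integral gamma (q : R[i] -> R[i]^o) 0.
Proof.
move=> gc gL L0 gcl eta0 rR gP.
have gD s : 0 <= s <= 1 -> D (gamma s) by move=> /gP[h _]; exact: le_lt_trans rR.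
have hv := contour_integralP gc gL (fun s s01 => qc (gD s s01)).
set v := contour_integral _ _ in hv *.
suff -> : (0 : R[i]) = v by [].
apply/esym/(primitive_integral0 (u := segment_int q p) gc gL L0 gcl _ hv) => e e0.
have [| |d d0 hd] := @lebesgue_number_disc R r
   (fun z (d : R) => forall w, cabs (w - z) < d -> cabs (q w - q z) <= e).
- by move=> z d d' dd h w wz; apply: h; lra.
- move=> z zr; have zR := le_lt_trans zr rR.
  have e12 : 0 < e / 2 by lra.
  have [d d0 hd] := qc zR e12; exists (d / 2) => [|z' z'z w wz']; first lra.
  have -> : q w - q z' = (q w - q z) - (q z' - q z) by ring.
  have h1 : cabs (q z' - q z) <= e / 2 by apply: hd; lra.
  have h2 : cabs (q w - q z) <= e / 2.
    apply: hd; have -> : w - z = (w - z') + (z' - z) by ring.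
    by have := cabsD (w - z') (z' - z); lra.
  by have := cabsB (q w - q z) (q z' - q z); lra.
exists (Num.min (d / 2) (eta / 2)) => [|s t s01 t01]; first by rewrite lt_min !divr_gt0.
rewrite le_min => /andP[st1 st2].
have Dg1 := gD _ s01; have Dg2 := gD _ t01; have [gr gp] := gP _ s01.
move: (gamma s) (gamma t) st1 st2 Dg1 Dg2 gr gp => z w st1 st2 Dz Dw zr zp0.
have zp : z != p by apply: contraTneq zp0 => ->; rewrite subrr cabs0 -ltNge.
rewrite (segment_int_base Dz Dw zp); last by apply: le_trans zp0; lra.
have := @segment_int_near_affine R D q (q z) 0 z w e Dc qcD Dz Dw (ltW e0).
rewrite !mul0r addr0 => h; rewrite cabsC mulrC; apply: h => o o01.
by rewrite mul0r addr0; apply: hd => //; apply: le_lt_trans (seg_dist _ _ o01) _; lra.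
Qed.

End ExceptionalPoint.
End Primitive.

(** * Rules of complex differentiation *)

Section ComplexDerivative.
Variable R : realType.
Implicit Types (z w p : R[i]) (q u : R[i] -> R[i]).

Lemma cont_at_ext (r : R) q u z : 0 < r ->
  (forall w, cabs (w - z) < r -> q w = u w) -> cont_at q z -> cont_at u z.
Proof.
move=> r0 qu h e e0; have [d d0 hd] := h e e0.
exists (Num.min d r) => [|w]; first by rewrite lt_min d0.
rewrite lt_min => /andP[wd wr]; rewrite -!qu ?hd //.
by rewrite subrr cabs0.
Qed.

Lemma cont_at_cst (a z : R[i]) : cont_at (fun=> a) z.
Proof. by move=> e e0; exists 1 => // w _; rewrite subrr cabs0 ltW. Qed.

Lemma cont_at_id z : cont_at id z.
Proof. by move=> e e0; exists e => // w /ltW. Qed.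

Lemma cont_atD q u z : cont_at q z -> cont_at u z -> cont_at (fun w => q w + u w) z.
Proof.
move=> hq hu e e0; have e2 : 0 < e / 2 by lra.
have [d d0 hd] := hq _ e2; have [d' d'0 hd'] := hu _ e2.
exists (Num.min d d') => [|w]; first by rewrite lt_min d0.
rewrite lt_min => /andP[/hd h1 /hd' h2].
by rewrite opprD addrACA; apply: le_trans (cabsD _ _) _; lra.
Qed.

Lemma cont_atM q u z : cont_at q z -> cont_at u z -> cont_at (fun w => q w * u w) z.
Proof.
move=> hq hu e e0; have a0 := cabs_ge0 (q z); have b0 := cabs_ge0 (u z).
pose B := cabs (q z) + cabs (u z) + 1; have B0 : 0 < B by rewrite /B; lra.
pose e1 := Num.min 1 (e / B / 2).
have e10 : 0 < e1 by rewrite lt_min ltr01 !divr_gt0.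
have [e11 e12] : e1 <= 1 /\ e1 <= e / B / 2 by rewrite /e1 !ge_min !lexx orbT.
have [d d0 hd] := hq _ e10; have [d' d'0 hd'] := hu _ e10.
exists (Num.min d d') => [|w]; first by rewrite lt_min d0.
rewrite lt_min => /andP[/hd h1 /hd' h2].
have -> : q w * u w - q z * u z = (q w - q z) * (u w - u z) + (q w - q z) * u z +
   q z * (u w - u z) by ring.
have e1B : e1 * B <= e / 2 by move: e12; rewrite ler_pdivlMr // ler_pdivlMr //; lra.
move: (cabsD ((q w - q z) * (u w - u z) + (q w - q z) * u z) (q z * (u w - u z))).
move: (cabsD ((q w - q z) * (u w - u z)) ((q w - q z) * u z)).
have c1 := cabs_ge0 (q w - q z); have c2 := cabs_ge0 (u w - u z).
rewrite !cabsM.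
have k1 : cabs (q w - q z) * cabs (u w - u z) <= e1 * 1 by apply: ler_pM => //; lra.
have k2 : cabs (q w - q z) * cabs (u z) <= e1 * cabs (u z) by apply: ler_pM.
have k3 : cabs (q z) * cabs (u w - u z) <= e1 * cabs (q z).
  by rewrite mulrC; apply: ler_pM.
by rewrite /B in e1B; lra.
Qed.

Lemma cont_atV q z : q z != 0 -> cont_at q z -> cont_at (fun w => (q w)^-1) z.
Proof.
rewrite -cabs_gt0 => q0 hq e e0.
pose m := Num.min (cabs (q z) / 2) (e * cabs (q z) ^+ 2 / 2).
have m0 : 0 < m by rewrite lt_min !divr_gt0 ?mulr_gt0 ?exprn_gt0.
have [d d0 hd] := hq _ m0; exists d => // w /hd.
rewrite /m le_min => /andP[h1 h2].
have h3 : cabs (q z) / 2 <= cabs (q w).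
  by have := cabs_gtB (q z) (q w); rewrite cabsC; lra.
have qw0 : q w != 0 by rewrite -cabs_gt0; lra.
have qz0 : q z != 0 by rewrite -cabs_gt0.
have -> : (q w)^-1 - (q z)^-1 = - ((q w - q z) / (q w * q z)).
  by field; rewrite ?qw0 ?qz0.
rewrite cabsN cabsM cabsV cabsM ler_pdivrMr ?mulr_gt0 ?cabs_gt0 //.
apply: le_trans h2 _; rewrite expr2 -!mulrA ler_pM2l //.
by rewrite mulrC -mulrA [cabs (q w) * _]mulrC ler_pM2l //; lra.
Qed.

(** Caratheodory's description of the derivative reduces the rules of calculus to
    those of continuity. *)
Lemma cdiff_slope q z d : cdiff q z d <->
  exists s, [/\ cont_at s z, s z = d & forall w, q w = q z + s w * (w - z)].
Proof.
split=> [h|[s [sc sz qs]]].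
  exists (fun w => if w == z then d else (q w - q z) / (w - z)); split; first 1 last.
  - by rewrite eqxx.
  - move=> w; have [->|wz] := eqVneq w z; first by rewrite (subrr z) mulr0 addr0.
    by rewrite divfK ?subr_eq0 // addrC subrK.
  move=> e e0; have [r r0 hr] := h e e0; exists r => // w /hr {}hr.
  rewrite eqxx; have [_|wz] := eqVneq w z; first by rewrite subrr cabs0 ltW.
  have wz0 : w - z != 0 by rewrite subr_eq0.
  have -> : (q w - q z) / (w - z) - d = (q w - q z - d * (w - z)) / (w - z).
    by field.
  by rewrite cabsM cabsV ler_pdivrMr ?cabs_gt0.
move=> e e0; have [r r0 hr] := sc e e0; exists r => // w /hr h.
have -> : q w - q z - d * (w - z) = (s w - s z) * (w - z) by rewrite qs sz; ring.
by rewrite cabsM ler_wpM2r // cabs_ge0.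
Qed.

Lemma cdiff_ext (r : R) q u z d : 0 < r ->
  (forall w, cabs (w - z) < r -> q w = u w) -> cdiff q z d -> cdiff u z d.
Proof.
move=> r0 qu h e e0; have [r' r'0 hr'] := h e e0.
exists (Num.min r' r) => [|w]; first by rewrite lt_min r'0.
rewrite lt_min => /andP[w1 w2]; rewrite -!qu ?hr' //.
by rewrite subrr cabs0.
Qed.

Lemma cdiff_cst (a z : R[i]) : cdiff (fun=> a) z 0.
Proof.
apply/cdiff_slope; exists (fun=> 0); split=> [|//|w]; first exact: cont_at_cst.
by rewrite mul0r addr0.
Qed.

Lemma cdiff_id z : cdiff id z 1.
Proof.
apply/cdiff_slope; exists (fun=> 1); split=> [|//|w]; first exact: cont_at_cst.
by rewrite mul1r addrC subrK.
Qed.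

Lemma cdiffD q u z a b : cdiff q z a -> cdiff u z b ->
  cdiff (fun w => q w + u w) z (a + b).
Proof.
move=> /cdiff_slope[s [sc <- qs]] /cdiff_slope[s' [sc' <- us]].
apply/cdiff_slope; exists (fun w => s w + s' w); split=> [|//|w]; first exact: cont_atD.
by rewrite qs us; ring.
Qed.

Lemma cdiffM q u z a b : cdiff q z a -> cdiff u z b ->
  cdiff (fun w => q w * u w) z (a * u z + q z * b).
Proof.
move=> hq hu; have uc := cdiff_cont hu.
move: hq hu => /cdiff_slope[s [sc <- qs]] /cdiff_slope[s' [sc' <- us]].
apply/cdiff_slope; exists (fun w => s w * u w + q z * s' w); split=> [|//|w].
  apply: cont_atD; first exact: cont_atM.
  by apply: cont_atM => //; exact: cont_at_cst.
by rewrite qs [X in _ = X + _]mulrC; rewrite (us w); ring.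
Qed.

Lemma cdiffV q z a : q z != 0 -> cdiff q z a ->
  cdiff (fun w => (q w)^-1) z (- a / q z ^+ 2).
Proof.
move=> q0 hq; have qc := cdiff_cont hq.
have [r r0 hr] := qc _ (divr_gt0 (etrans (cabs_gt0 _) q0) (ltr0n _ 2)).
move: hq => /cdiff_slope[s [sc sz qs]].
apply/cdiff_slope; exists (fun w => if q w == 0 then ((q w)^-1 - (q z)^-1) / (w - z)
   else - s w * ((q w)^-1 * (q z)^-1)); split.
- apply: (@cont_at_ext r (fun w => - 1 * s w * ((q w)^-1 * (q z)^-1))) => //.
    move=> w /hr h; have: q w != 0.
      rewrite -cabs_gt0; have := cabs_gtB (q z) (q w); rewrite cabsC.
      by have := q0; rewrite -cabs_gt0; lra.
    by move=> /negPf ->; ring.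
  apply: cont_atM; first by apply: cont_atM => //; exact: cont_at_cst.
  by apply: cont_atM; [exact: cont_atV|exact: cont_at_cst].
- by rewrite (negPf q0) sz; field.
move=> w; have [->|wz] := eqVneq w z; first by rewrite (subrr z) mulr0 addr0.
have wz0 : w - z != 0 by rewrite subr_eq0.
case: ifPn => qw; first by rewrite divfK // addrC subrK.
have -> : s w = (q w - q z) / (w - z) by rewrite [q w]qs; field.
by field; rewrite ?qw ?wz0 ?q0.
Qed.

Lemma cdiff_unique q z a b : cdiff q z a -> cdiff q z b -> a = b.
Proof.
move=> ha hb; apply/eqP; rewrite -subr_eq0; apply/eqP; apply: eps_eq0 => e e0.
have e2 : 0 < e / 2 by lra.
have [r r0 hr] := ha _ e2; have [r' r'0 hr'] := hb _ e2.
pose m := Num.min r r' / 2; have m0 : 0 < m by rewrite divr_gt0 // lt_min r0.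
have mm : m < r /\ m < r'.
  have : Num.min r r' <= r /\ Num.min r r' <= r' by rewrite !ge_min !lexx orbT.
  by rewrite /m; lra.
have cm : cabs (z + m%:C - z) = m.
  by rewrite addrC addKr cabs_real ger0_norm // ltW.
have := hr (z + m%:C); have := hr' (z + m%:C); rewrite cm => h1 h2.
have {}h1 := h1 mm.2; have {}h2 := h2 mm.1.
have : cabs ((a - b) * m%:C) <= e * m.
  have -> : (a - b) * m%:C = (q (z + m%:C) - q z - b * (z + m%:C - z)) -
     (q (z + m%:C) - q z - a * (z + m%:C - z)) by ring.
  by apply: le_trans (cabsB _ _) _; lra.
by rewrite cabsM cabs_real ger0_norm ?(ltW m0) // ler_pM2r.
Qed.

Lemma derivable_cdiff (f : R[i]^o -> R[i]^o) z :
  derivable f z 1 -> cdiff f z (derive1 f z).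
Proof.
move=> fz e e0.
have : (fun h => h^-1 *: (f (h + z) - f z)) @ (0 : R[i]^o)^' --> derive1 f z.
  rewrite /derive1; move: fz; rewrite /derivable.
  under [X in cvg (X @ _)]eq_fun do rewrite /= -[_ *: 1]/(_ * 1) mulr1.
  by move=> fz; exact: fz.
move=> /cvgrPdist_le /(_ e%:C); rewrite ltcR => /(_ e0).
rewrite near_withinE => /nbhs_ballP[_ /= /pos_complexP[r r0 ->] hr].
exists r => // w wz; have [->|wz0] := eqVneq w z.
  by rewrite !subrr mulr0 subr0 cabs0 mulr0.
have hw0 : w - z != 0 by rewrite subr_eq0.
have := hr (w - z); rewrite /ball /= sub0r normrN normcE_cabs ltcR => /(_ wz hw0).
rewrite subrK normcE_cabs lecR => h.
have -> : f w - f z - derive1 f z * (w - z) =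
  ((w - z)^-1 * (f w - f z) - derive1 f z) * (w - z) by field.
by rewrite cabsM; apply: ler_wpM2r; [exact: cabs_ge0|rewrite cabsC].
Qed.

Lemma cdiff_derivable (f : R[i]^o -> R[i]^o) z d :
  cdiff f z d -> derivable f z 1 /\ derive1 f z = d.
Proof.
move=> fz.
have lim1 : (fun h => h^-1 *: (f (h + z) - f z)) @ (0 : R[i]^o)^' --> (d : R[i]^o).
  apply/cvgrPdist_le => _ /pos_complexP[e e0 ->].
  have [r r0 hr] := fz e e0; rewrite near_withinE; apply/nbhs_ballP.
  exists r%:C; first by rewrite /= ltcR.
  move=> h; rewrite /ball /= sub0r normrN normcE_cabs ltcR => hr0 h0.
  rewrite normcE_cabs lecR cabsC.
  have := hr (h + z); rewrite addrK => /(_ hr0).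
  have -> : h^-1 *: (f (h + z) - f z) - d = (f (h + z) - f z - d * h) / h.
    by rewrite -[_ *: _]/(_ * _); field.
  by rewrite cabsM cabsV ler_pdivrMr ?cabs_gt0.
split; last exact: cvg_lim lim1.
rewrite /derivable.
under [X in cvg (X @ _)]eq_fun do rewrite /= -[_ *: 1]/(_ * 1) mulr1.
by apply/cvg_ex; exists d.
Qed.

End ComplexDerivative.

(** * Roots of unity *)

Section RootsOfUnity.
Variable R : realType.

(** The average of the resolvent over the N-th roots of unity is the resolvent of
    the N-th power. *)
Lemma sum_resolvent_roots (A : algType R[i]) (N : nat) (om : R[i]) (a : A) (y : nat -> A) :
  om ^+ N = 1 -> (forall k, (0 < k < N)%N -> om ^+ k != 1) ->
  (forall j, (j < N)%N -> y j * (1 - om ^+ j *: a) = 1) ->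
  (\sum_(j < N) y j) * (1 - a ^+ N) = N%:R.
Proof.
move=> omN om1 hy.
have yj j : (j < N)%N -> y j * (1 - a ^+ N) = \sum_(k < N) om ^+ (j * k) *: a ^+ k.
  move=> jN; have := subrX1 (om ^+ j *: a) N.
  rewrite exprZn -exprM mulnC exprM omN expr1n scale1r => E.
  have -> : 1 - a ^+ N = (1 - om ^+ j *: a) * \sum_(k < N) (om ^+ j *: a) ^+ k.
    by rewrite -opprB E -mulNr opprB.
  rewrite mulrA hy // mul1r; apply: eq_bigr => k _.
  by rewrite exprZn -exprM.
rewrite mulr_suml (eq_bigr (fun j : 'I_N => \sum_(k < N) om ^+ (j * k) *: a ^+ k)).
  rewrite exchange_big /=; case: N omN om1 {hy yj} => [|N] omN om1.
    by rewrite big_ord0.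
  rewrite big_ord_recl /= [X in _ + X]big1 => [|k _].
    rewrite addr0 (eq_bigr (fun=> 1)) ?sumr_const ?card_ord // => j _.
    by rewrite muln0 expr0 scale1r expr0.
  rewrite -scaler_suml.
  suff -> : \sum_(j < N.+1) om ^+ (j * bump 0 k) = 0 by rewrite scale0r.
  have kN : (0 < bump 0 k < N.+1)%N by rewrite /bump /= add1n ltnS ltn_ord.
  have /negPf k1 := om1 _ kN.
  have := subrX1 (om ^+ bump 0 k) N.+1.
  rewrite -exprM mulnC exprM omN expr1n subrr => /esym/eqP.
  rewrite mulf_eq0 subr_eq0 k1 /= => /eqP; under eq_bigr do rewrite -exprM mulnC.
  by [].
by move=> j _; rewrite yj.
Qed.

End RootsOfUnity.

Section Circle.
Variable R : realType.
Implicit Types (z w p : R[i]) (s t : R).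

Lemma pi2_gt0 : 0 < 2 * pi :> R.
Proof. by rewrite mulr_gt0 // pi_gt0. Qed.

Definition cis s : R[i] := cos (2 * pi * s) +i* sin (2 * pi * s).

Lemma cisD s t : cis (s + t) = cis s * cis t.
Proof.
by rewrite /cis mulrDr cosD sinD; apply/eqP; rewrite eq_complex /= addrC [X in _ && X]eq_sym;
  apply/andP; split; apply/eqP; rewrite ?[_ * sin _ + _]addrC //; ring.
Qed.

Lemma cis0 : cis 0 = 1.
Proof. by rewrite /cis mulr0 cos0 sin0. Qed.

Lemma cis1 : cis 1 = 1.
Proof. by rewrite /cis mulr1 mulrC -[2]/(1 + 1) mulrDr mulr1 -mulr2n cos2pi sin2pi. Qed.

Lemma cabs_cis s : cabs (cis s) = 1.
Proof.
apply/eqP; rewrite -(@eqrXn2 _ 2) ?cabs_ge0 // cabs_ReIm /= cos2Dsin2 expr1n.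
by [].
Qed.

Lemma cis_neq0 s : cis s != 0.
Proof. by rewrite -cabs_gt0 cabs_cis. Qed.

Lemma cisX s n : cis s ^+ n = cis (n%:R * s).
Proof.
elim: n => [|n IH]; first by rewrite expr0 mul0r cis0.
by rewrite exprSr IH -cisD -natr1 mulrDl mul1r.
Qed.

Lemma cis_grid N j : cis (grid R N j) = cis N%:R^-1 ^+ j.
Proof. by rewrite cisX. Qed.

Lemma MVT_segment (u du : R -> R) (m M : R) :
  (forall x, m <= x <= M -> is_derive x 1 u (du x)) ->
  forall x y, m <= x <= M -> m <= y <= M ->
  exists2 th, 0 <= th <= 1 & u y - u x = du (x + th * (y - x)) * (y - x).
Proof.
move=> ud.
have lt x y : m <= x <= M -> m <= y <= M -> x < y -> exists2 z, x < z < y & u y - u x = du z * (y - x).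
  move=> xm ym xy; have [||z] := @MVT _ u du x y xy.
  - by move=> z; rewrite in_itv /= => zxy; apply: ud; lra.
  - apply: derivable_within_continuous => z; rewrite in_itv /= => zxy.
    by apply: (@ex_derive _ _ _ _ _ _ (du z)); apply: ud; lra.
  by rewrite in_itv /= => zxy E; exists z.
move=> x y xm ym; have [xy|xy|->] := ltgtP x y.
- have [z zxy E] := lt _ _ xm ym xy; exists ((z - x) / (y - x)).
    by rewrite divr_ge0 ?ler_pdivrMr /=; lra.
  by rewrite divfK ?subr_eq0 ?gt_eqF // E; congr (du _ * _); lra.
- have [z zxy E] := lt _ _ ym xm xy; exists ((x - z) / (x - y)).
    by rewrite divr_ge0 ?ler_pdivrMr /=; lra.
  rewrite -(opprB x y) !mulrN divfK ?subr_eq0 ?gt_eqF //.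
  by rewrite (_ : x - (x - z) = z) ?(opprB u) -?E ?opprB //; ring.
- by exists 0; rewrite ?lexx ?ler01 // !subrr mulr0.
Qed.

Lemma MVT_any (u du : R -> R) : (forall x : R, is_derive x 1 u (du x)) ->
  forall x y, exists2 c, `|c - x| <= `|y - x| & u y - u x = du c * (y - x).
Proof.
move=> ud x y; have xm : Num.min x y <= x <= Num.max x y by rewrite ge_min le_max lexx.
have ym : Num.min x y <= y <= Num.max x y by rewrite ge_min le_max lexx !orbT.
have [th /andP[th0 th1] ->] := MVT_segment (fun v _ => ud v) xm ym.
exists (x + th * (y - x)) => //; rewrite [x + _]addrC addrK normrM ger0_norm //.
by rewrite ler_piMl.
Qed.

Lemma sin_lip s t : `|sin s - sin t| <= `|s - t|.
Proof.
have [c _ ->] := MVT_any (fun x => is_derive_sin x) t s.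
by rewrite normrM ler_piMl // cos_max.
Qed.

Lemma cos_lip s t : `|cos s - cos t| <= `|s - t|.
Proof.
have [c _ ->] := MVT_any (fun x => is_derive_cos x) t s.
by rewrite normrM ler_piMl // normrN sin_max.
Qed.

Lemma cis_lip s t : cabs (cis s - cis t) <= 4 * pi * `|s - t|.
Proof.
apply: le_trans (cabs_le _) _ => /=.
have := cos_lip (2 * pi * s) (2 * pi * t); have := sin_lip (2 * pi * s) (2 * pi * t).
rewrite -mulrBr normrM (ger0_norm (ltW pi2_gt0)); lra.
Qed.

Lemma cis_root N k : (0 < k < N)%N -> cis N%:R^-1 ^+ k != 1.
Proof.
move=> /andP[k0 kN]; have N0 : (0 < N)%N := leq_ltn_trans (leq0n _) kN.
rewrite cisX /cis; apply/negP; rewrite eq_complex /= => /andP[/eqP c1 _].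
pose y : R := pi * (k%:R * N%:R^-1).
have y2 : 2 * pi * (k%:R * N%:R^-1) = y *+ 2 by rewrite /y mulr2n; ring.
move: c1; rewrite y2 cos_mulr2n cos2sin2 => c1.
have : 0 < sin y.
  apply: sin_gt0_pi; rewrite /y mulr_gt0 ?pi_gt0 ?divr_gt0 ?ltr0n //=.
  by rewrite gtr_pMr ?pi_gt0 // ltr_pdivrMr ?ltr0n // mul1r ltr_nat.
by move=> s0; have := exprn_gt0 2 s0; move: c1; rewrite !mulr2n; lra.
Qed.

(** The integral of [1 / z] over the circle is the limit of these sums. *)
Lemma cis_first_order N : (0 < N)%N ->
  cabs ((cis N%:R^-1 - 1) * N%:R - two_pi_i R) <= 8 * pi ^+ 2 * N%:R^-1.
Proof.
move=> N0; have NR : 0 < N%:R :> R by rewrite ltr0n.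
pose x : R := 2 * pi * N%:R^-1.
have x0 : 0 <= x by rewrite mulr_ge0 ?invr_ge0 ?ler0n ?(ltW pi2_gt0).
have cosx : `|cos x - 1| <= x ^+ 2.
  have [c cx E] := MVT_any (fun x => is_derive_cos x) 0 x.
  move: cx E; rewrite cos0 !subr0 => cx ->; rewrite normrM normrN expr2 (ger0_norm x0).
  apply: ler_wpM2r => //; have := sin_lip c 0; rewrite sin0 !subr0 => h.
  by apply: le_trans h _; rewrite -(ger0_norm x0).
have sinx : `|sin x - x| <= x ^+ 2.
  have [c cx E] := MVT_any (fun x => is_derive_sin x) 0 x.
  move: cx E; rewrite sin0 !subr0 => cx E.
  have -> : sin x - x = (cos c - 1) * x by rewrite E; ring.
  rewrite normrM expr2 (ger0_norm x0); apply: ler_wpM2r => //.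
  have := cos_lip c 0; rewrite cos0 !subr0 => h.
  by apply: le_trans h _; rewrite -(ger0_norm x0).
have -> : (cis N%:R^-1 - 1) * N%:R - two_pi_i R =
    N%:R%:C * ((cos x - 1) +i* (sin x - x)).
  rewrite /two_pi_i /cis -/x.
  apply/eqP; rewrite eq_complex -(rmorph_nat (real_complex R)) /=.
  rewrite /x; apply/andP; split; apply/eqP; field; rewrite gt_eqF //.
rewrite cabsM cabs_real ger0_norm ?ler0n //.
have := cabs_le ((cos x - 1) +i* (sin x - x)) => /= h.
have xE : N%:R * x ^+ 2 * 2 = 8 * pi ^+ 2 * N%:R^-1.
  by rewrite /x; field; rewrite gt_eqF.
rewrite -xE -mulrA ler_pM2l //; lra.
Qed.

End Circle.

(** * Cauchy's formula on circles *)

Section CauchyFormula.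
Variable R : realType.
Implicit Types (z w p h : R[i]) (F q : R[i] -> R[i]).

Lemma cabs_two_pi_i : cabs (two_pi_i R) = 2 * pi.
Proof.
have -> : two_pi_i R = (2 * pi)%:C * 'i by rewrite /two_pi_i rmorphM rmorph_nat.
rewrite cabsM cabs_real ger0_norm ?(ltW (pi2_gt0 R)) //.
by rewrite {1}/cabs normc_def /= expr0n expr1n add0r sqrtr1 mulr1.
Qed.

Lemma two_pi_i_neq0 : two_pi_i R != 0.
Proof. by rewrite -cabs_gt0 cabs_two_pi_i pi2_gt0. Qed.

(** All explicit curves below are Lipschitz. *)
Lemma lipschitz_curve (gamma : R -> R[i]^o) (k : R) : 0 <= k ->
  (forall s t, cabs (gamma s - gamma t) <= k * `|s - t|) ->
  unif_cont01 gamma /\ length_le gamma k.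
Proof.
move=> k0 hk; split=> [e e0|n t [t0 tn tS]].
  have k1 : 0 < k + 1 by lra.
  exists (e / (k + 1)) => [|s t _ _]; first by rewrite divr_gt0.
  rewrite ltr_pdivlMr // => st; apply: le_trans (hk s t) _.
  by have := normr_ge0 (s - t); lra.
apply: (@le_trans _ _ (\sum_(i < n) k * (t i.+1 - t i))).
  by apply: ler_sum => i _; rewrite (le_trans (hk _ _)) // ger0_norm // subr_ge0 tS.
rewrite -mulr_sumr -(big_mkord xpredT (fun i => t i.+1 - t i)).
by rewrite telescope_sumr // t0 tn subr0 mulr1.
Qed.

Definition circle (r : R) : R -> R[i]^o := fun s => r%:C * cis s.

Lemma cabs_circle r s : 0 <= r -> cabs (circle r s) = r.
Proof. by move=> r0; rewrite cabsM cabs_cis mulr1 cabs_real ger0_norm. Qed.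

Lemma circle_curve r : 0 <= r -> unif_cont01 (circle r) /\ length_le (circle r) (4 * pi * r).
Proof.
move=> r0; apply: lipschitz_curve; first by rewrite !mulr_ge0 // pi_ge0.
move=> s t; have -> : circle r s - circle r t = r%:C * (cis s - cis t) by rewrite /circle; ring.
rewrite cabsM cabs_real ger0_norm //; have := cis_lip s t; nra.
Qed.

Lemma pow_small (x e : R) : 0 <= x < 1 -> 0 < e ->
  exists N0, forall N, (N0 <= N)%N -> x ^+ N <= e.
Proof.
move=> /andP[x0 x1] e0; have x1' : `|x| < 1 by rewrite ger0_norm.
have /cvgrPdist_le/(_ e e0)[N _ hN] := cvg_expr x1'.
exists N => n /hN /=; rewrite sub0r normrN ger0_norm // exprn_ge0 //.
Qed.

Lemma subf_neq0 p w : w != p -> w - p != 0. Proof. by rewrite subr_eq0. Qed.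

Lemma cdiff_sub p w : cdiff (fun z => z - p) w 1.
Proof. by rewrite -[1]addr0; exact: cdiffD (cdiff_id _) (cdiff_cst _ _). Qed.

Lemma cdiff_inv_sub p w : w != p -> cdiff (fun z => (z - p)^-1) w (- 1 / (w - p) ^+ 2).
Proof. by move=> wp; exact: (@cdiffV R (fun z => z - p) w 1 (subf_neq0 wp) (cdiff_sub _ _)). Qed.

Lemma cont_at_inv_sub p w : w != p -> cont_at (fun z => (z - p)^-1) w.
Proof. by move=> wp; apply: cdiff_cont (cdiff_inv_sub wp). Qed.

(** The integral sums over the roots of unity are known in closed form: they are
    [(om - 1) N / (1 - (p / r)^N)], with [om] the first root of unity. *)
Lemma circle_index r p : cabs p < r ->
  is_contour_integral (circle r) ((fun z => (z - p)^-1) : R[i] -> R[i]^o) (two_pi_i R).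
Proof.
move=> pr; have p0 := cabs_ge0 p; have r0 : 0 < r by lra.
have [gc gL] := circle_curve (ltW r0).
have circ_p s : circle r s != p.
  by apply: contraTneq pr => <-; rewrite cabs_circle ?ltxx ?ltW.
have hv := contour_integralP gc gL (fun s _ => cont_at_inv_sub (circ_p s)).
set v := contour_integral _ _ in hv.
suff <- : v = two_pi_i R by [].
apply/eqP; rewrite -subr_eq0; apply/eqP/eps_eq0 => e e0.
have e4 : 0 < e / 4 by lra.
pose x := p / r%:C.
have rC : r%:C != 0 by rewrite fmorph_eq0 gt_eqF.
have cx : cabs x = cabs p / r by rewrite cabsM cabsV cabs_real gtr0_norm.
have x01 : 0 <= cabs x < 1.
  rewrite cx; apply/andP; split; first exact: divr_ge0 p0 (ltW r0).
  by rewrite ltr_pdivrMr // mul1r.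
have [N1 [N10 h1]] := csum_grid hv e4.
have B0 : 0 < 8 * pi ^+ 2 + 1 :> R by have := sqr_ge0 (pi : R); lra.
have [N2 [_ h2]] := inv_nat_small (divr_gt0 e4 B0).
have V0 : 0 < cabs v + e + 1 by have := cabs_ge0 v; lra.
have [N3 h3] := pow_small x01 (divr_gt0 e4 V0).
pose N := maxn N1 (maxn N2 N3).
have N1N : (N1 <= N)%N by rewrite leq_maxl.
have N2N : (N2 <= N)%N by rewrite /N !leq_max leqnn orbT.
have N3N : (N3 <= N)%N by rewrite /N !leq_max leqnn !orbT.
have N0 : (0 < N)%N by rewrite (leq_trans N10).
have {}h2 := h2 _ N2N; have {}h3 := h3 _ N3N.
have {h1} := h1 _ N1N _ (@grid_left R N).
have h4 := cis_first_order R N0.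
set S := csum _ _ _ _ _.
pose om := cis (N%:R^-1 : R).
have SE : S * (1 - x ^+ N) = (om - 1) * N%:R.
  have omV0 : om^-1 != 0 by rewrite invr_eq0 cis_neq0.
  pose y (j : nat) : R[i] := (1 - om^-1 ^+ j * x)^-1.
  have -> : S = (om - 1) * \sum_(j < N) y j.
    rewrite mulr_sumr; apply: eq_bigr => j _.
    rewrite /circle !cis_grid -/om exprS.
    have omj : om ^+ j != 0 by rewrite expf_neq0 ?cis_neq0.
    have den : r%:C * om ^+ j - p != 0.
      by have := circ_p (grid R N j); rewrite /circle cis_grid -/om subr_eq0.
    have -> : y j = r%:C * om ^+ j / (r%:C * om ^+ j - p).
      have E : 1 - om^-1 ^+ j * x = (r%:C * om ^+ j - p) / (r%:C * om ^+ j).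
        by rewrite /x exprVn; field; rewrite ?rC ?omj.
      by rewrite /y E invf_div.
    by field.
  rewrite -mulrA; congr (_ * _).
  have omVN : om^-1 ^+ N = 1.
    rewrite exprVn /om cisX divff ?cis1 ?invr1 //.
    by rewrite pnatr_eq0 -lt0n.
  have omV1 k : (0 < k < N)%N -> om^-1 ^+ k != 1.
    by move=> /(@cis_root R); rewrite exprVn invr_eq1.
  apply: (@sum_resolvent_roots R (R[i]^o) N _ x y omVN omV1) => j jN.
  apply: mulVf; have := circ_p (grid R N j).
  rewrite /circle cis_grid -/om; apply: contraNneq => /eqP.
  rewrite subr_eq0 => /eqP E.
  have : r%:C * om ^+ j = r%:C * om ^+ j * (om^-1 ^+ j * x) by rewrite -E mulr1.
  move=> ->; apply/eqP; rewrite /x exprVn; field.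
  by rewrite rC expf_neq0 // cis_neq0.
clearbody S; move=> Sv.
have SB : cabs S <= cabs v + e.
  by have := cabsD (S - v) v; rewrite subrK; lra.
have h5 : cabs (S * x ^+ N) <= e / 4.
  rewrite cabsM cabsX; move: h3; rewrite ler_pdivlMr // => h3.
  apply: le_trans h3; rewrite mulrC; apply: ler_wpM2l; first by rewrite exprn_ge0 // cabs_ge0.
  lra.
have h6 : cabs ((om - 1) * N%:R - two_pi_i R) <= e / 4.
  apply: le_trans h4 _; move: h2; rewrite ltr_pdivlMr // => h2.
  have : 0 <= (N%:R : R)^-1 by rewrite invr_ge0 ler0n.
  lra.
have -> : v - two_pi_i R = (S * x ^+ N + ((om - 1) * N%:R - two_pi_i R)) - (S - v).
  by rewrite -SE; ring.
apply: le_trans (cabsB _ _) _; have := cabsD (S * x ^+ N) ((om - 1) * N%:R - two_pi_i R).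
lra.
Qed.

Section Disc.
Variables (F : R[i] -> R[i]) (R0 r : R).
Hypothesis Fd : forall z, cabs z < R0 -> exists d, cdiff F z d.
Hypotheses (r0 : 0 < r) (rR : r < R0).

(** The difference quotient is differentiable except perhaps at [p], where it is
    continuous; this is what the exceptional point is for. *)
Lemma Cauchy_formula p : cabs p < r ->
  is_contour_integral (circle r) ((fun z => F z / (z - p)) : R[i] -> R[i]^o)
    (two_pi_i R * F p).
Proof.
move=> pr; have pR : cabs p < R0 := lt_trans pr rR.
have [g hg] := Fd pR.
pose q z := if z == p then g else (F z - F p) / (z - p).
have qp : cont_at q p.
  have /cdiff_slope[s [sc sp Fs]] := hg.
  apply: (@cont_at_ext R 1 s q) => // w _; rewrite /q; case: eqVneq => [->//|wp].
  by rewrite Fs; field; rewrite subf_neq0.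
have qd z : cabs z < R0 -> z != p -> exists d, cdiff q z d.
  move=> zR zp; have [d hd] := Fd zR; have zp0 := subf_neq0 zp.
  have h1 : cdiff (fun w => F w - F p) z (d + 0) := cdiffD hd (cdiff_cst _ _).
  have h := cdiffM h1 (cdiff_inv_sub zp).
  have zp1 : 0 < cabs (z - p) by rewrite cabs_gt0.
  eexists; apply: (@cdiff_ext _ (cabs (z - p)) _ _ _ _ zp1 _ h) => w wz.
  rewrite /q ifF //; apply/negbTE; apply: contraTneq wz => ->.
  by rewrite cabsC ltxx.
have qc z : cabs z < R0 -> cont_at q z.
  by have [->//|zp zR] := eqVneq z p; have [d /cdiff_cont] := qd z zR zp.
have [gc gL] := circle_curve (ltW r0).
have L0 : 0 < 4 * pi * r by rewrite !mulr_gt0 // pi_gt0.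
have closed : circle r 0 = circle r 1 by rewrite /circle cis0 cis1.
have eta0 : 0 < r - cabs p by lra.
have circ_out s : cabs (circle r s) <= r /\ r - cabs p <= cabs (circle r s - p).
  have := cabs_gtB (circle r s) p; rewrite !(cabs_circle _ (ltW r0)) => h; split; first exact: lexx.
  exact: h.
have := closed_curve_integral0 pR qc qd gc gL L0 closed eta0 rR.
move=> h; have {h} h0 := h (fun s _ => circ_out s).
have hF := is_contour_integralZ (F p) (circle_index pr).
have := is_contour_integralD h0 hF.
rewrite add0r -[_ *: _]/(_ * _) mulrC; apply: is_contour_integral_ext => s s01.
have cp : circle r s != p.
  by apply: contraTneq pr => <-; rewrite cabs_circle ?ltxx ?ltW.
rewrite /q (negPf cp) -[_ *: _]/(_ * _); field; exact: subf_neq0.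
Qed.

(** The coefficients are Cauchy integrals, and the remainder after expanding
    the kernel to third order is the integral of a bounded function. *)
Lemma Taylor3 (M : R) : (forall z, cabs z = r -> cabs (F z) <= M) ->
  exists a1 a2, [/\ cabs a1 <= 2 * M / r, cabs a2 <= 2 * M / r ^+ 2 &
    forall h, cabs h <= r / 2 ->
    cabs (F h - F 0 - a1 * h - a2 * h ^+ 2) <= 4 * M / r ^+ 3 * cabs h ^+ 3].
Proof.
move=> FM; have [gc gL] := circle_curve (ltW r0).
have cr s : cabs (circle r s) = r := cabs_circle s (ltW r0).
have circ0 s : circle r s != 0 by rewrite -cabs_gt0 cr.
have circR s : cabs (circle r s) < R0 by rewrite cr.
have M0 : 0 <= M.
  by apply: le_trans (FM r%:C _); rewrite ?cabs_ge0 // cabs_real gtr0_norm.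
have inv n : exists v, is_contour_integral (circle r)
    ((fun z => F z / z ^+ n) : R[i] -> R[i]^o) v.
  eexists; apply: (contour_integralP gc gL) => s _; have [d /cdiff_cont hd] := Fd (circR s).
  apply: cont_atM => //; apply: cont_atV; first by rewrite expf_neq0.
  elim: n => [|n IH]; first exact: cont_at_cst.
  have -> : (fun w => w ^+ n.+1) = (fun w : R[i] => w * w ^+ n).
    by apply/funext => w; rewrite exprS.
  by apply: cont_atM => //; exact: cont_at_id.
have [v1 h1] := inv 2; have [v2 h2] := inv 3.
exists (v1 / two_pi_i R), (v2 / two_pi_i R).
have pi0 : 0 < pi :> R := pi_gt0 R.
have coef n v : is_contour_integral (circle r)
    ((fun z => F z / z ^+ n) : R[i] -> R[i]^o) v ->
    cabs (v / two_pi_i R) <= 2 * (M / r ^+ n) * r.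
  move=> hv; rewrite cabsM cabsV cabs_two_pi_i ler_pdivrMr ?pi2_gt0 //.
  have B0 : 0 <= M / r ^+ n by rewrite divr_ge0 // exprn_ge0 // ltW.
  have hB s : 0 <= s <= 1 -> cabs (F (circle r s) / circle r s ^+ n) <= M / r ^+ n.
    move=> _; rewrite cabsM cabsV cabsX cr ler_wpM2r ?FM //.
    by rewrite invr_ge0 exprn_ge0 // ltW.
  have := @contour_integral_le R (R[i]^o) _ _ _ _ _ gL B0 hB hv.
  by rewrite -[nrm _]/(cabs _); lra.
split.
- by apply: le_trans (coef _ _ h1) _; rewrite le_eqVlt; apply/orP; left;
    apply/eqP; field; rewrite gt_eqF.
- by apply: le_trans (coef _ _ h2) _; rewrite le_eqVlt; apply/orP; left;
    apply/eqP; field; rewrite gt_eqF.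
move=> h hr.
have hr' : cabs h < r by have := r0; lra.
have z0r : cabs (0 : R[i]) < r by rewrite cabs0.
have hv := is_contour_integralB (is_contour_integralB (is_contour_integralB
  (Cauchy_formula hr') (Cauchy_formula z0r)) (is_contour_integralZ h h1))
  (is_contour_integralZ (h ^+ 2) h2).
set v := _ - _ in hv.
have -> : F h - F 0 - v1 / two_pi_i R * h - v2 / two_pi_i R * h ^+ 2 = v / two_pi_i R.
  by rewrite /v -![_ *: _]/(_ * _); field; exact: two_pi_i_neq0.
rewrite cabsM cabsV cabs_two_pi_i ler_pdivrMr ?pi2_gt0 //.
pose B := M * (cabs h ^+ 3 / (r ^+ 3 * (r / 2))).
have r30 : 0 < r ^+ 3 * (r / 2) by rewrite mulr_gt0 ?exprn_gt0 ?divr_gt0.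
have h30 : 0 <= cabs h ^+ 3 by rewrite exprn_ge0 // cabs_ge0.
have B0 : 0 <= B by rewrite mulr_ge0 // divr_ge0 // ltW.
have hB s : 0 <= s <= 1 ->
  cabs (F (circle r s) / (circle r s - h) - F (circle r s) / (circle r s - 0) -
    h *: (F (circle r s) / circle r s ^+ 2 : R[i]^o) -
    h ^+ 2 *: (F (circle r s) / circle r s ^+ 3 : R[i]^o)) <= B.
  move=> _; rewrite -![_ *: _]/(_ * _); have := cr s; move: (circle r s) (circ0 s) => z z0 zr.
  have zh : r / 2 <= cabs (z - h) by have := cabs_gtB z h; rewrite zr; lra.
  have zh0 : z - h != 0 by rewrite -cabs_gt0; have := r0; lra.
  have -> : F z / (z - h) - F z / (z - 0) - h * (F z / z ^+ 2) - h ^+ 2 * (F z / z ^+ 3) =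
    F z * (h ^+ 3 / (z ^+ 3 * (z - h))) by field; rewrite ?subr0 ?z0 ?zh0.
  rewrite (cabsM (F z)) (cabsM (h ^+ 3)) cabsV (cabsM (z ^+ 3)) !cabsX zr; apply: ler_pM; rewrite ?cabs_ge0 ?FM //.
    by rewrite divr_ge0 // mulr_ge0 ?cabs_ge0 // exprn_ge0 // ltW.
  rewrite ler_wpM2l // lef_pV2 ?posrE //.
    by rewrite ler_pM2l ?exprn_gt0.
  by rewrite mulr_gt0 ?exprn_gt0 ?cabs_gt0.
have := @contour_integral_le R (R[i]^o) _ _ _ _ _ gL B0 hB hv.
rewrite -[nrm _]/(cabs _) => /le_trans; apply; rewrite le_eqVlt; apply/orP; left.
by apply/eqP; rewrite /B; field; rewrite gt_eqF.
Qed.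
End Disc.
End CauchyFormula.

(** * Taylor estimates; derivatives are differentiable *)

Section LocalTheory.
Variable R : realType.
Implicit Types (z w p h d : R[i]) (F q : R[i] -> R[i]).

Definition diff_disc F z0 (r : R) : Prop :=
  forall z, cabs (z - z0) < r -> exists d, cdiff F z d.

Lemma cont_disc_bounded F z0 (r : R) :
  (forall z, cabs (z - z0) <= r -> cont_at F z) ->
  exists2 M : R, 0 < M & forall z, cabs (z - z0) <= r -> cabs (F z) <= M.
Proof.
move=> Fc.
pose Q z (m : R) := 0 < m -> cabs (F (z0 + z)) <= m^-1.
have [| |m m0 hm] := @lebesgue_number_disc R r Q.
- move=> z m m' mm q m'0; have m0 : 0 < m by lra.
  by apply: le_trans (q m0) _; rewrite lef_pV2.
- move=> z zr; have [|d d0 hd] := Fc (z0 + z) _ 1 ltr01.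
    by rewrite addrC addKr.
  have N0 := cabs_ge0 (F (z0 + z)).
  have N1 : 0 < (cabs (F (z0 + z)) + 1)^-1 by rewrite invr_gt0; lra.
  exists (Num.min d (cabs (F (z0 + z)) + 1)^-1); first by rewrite lt_min d0.
  move=> z' z'z _.
  have : (cabs (F (z0 + z)) + 1)^-1^-1 <= (Num.min d (cabs (F (z0 + z)) + 1)^-1)^-1.
    by rewrite lef_pV2 ?posrE ?lt_min ?d0 ?N1 // ge_min lexx orbT.
  rewrite invrK; apply: le_trans.
  have : cabs (F (z0 + z') - F (z0 + z)) <= 1.
    apply: hd; rewrite opprD addrACA subrr add0r.
    by move: z'z; rewrite lt_min => /andP[].
  by have := cabsD (F (z0 + z') - F (z0 + z)) (F (z0 + z)); rewrite subrK; lra.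
exists m^-1 => [|z zr]; first by rewrite invr_gt0.
by have := hm _ zr m0; rewrite (_ : z0 + (z - z0) = z) //; ring.
Qed.

Lemma cdiff_quadratic F z0 d (r C : R) : 0 < r -> 0 <= C ->
  (forall h, cabs h <= r -> cabs (F (z0 + h) - F z0 - d * h) <= C * cabs h ^+ 2) ->
  cdiff F z0 d.
Proof.
move=> r0 C0 hF e e0; have C1 : 0 < C + 1 by lra.
exists (Num.min r (e / (C + 1))) => [|w]; first by rewrite lt_min r0 divr_gt0.
rewrite lt_min ltr_pdivlMr // => /andP[wr we].
have E : z0 + (w - z0) = w by ring.
have := hF (w - z0); rewrite E => /(_ (ltW wr)) h.
apply: le_trans h _; rewrite expr2 mulrA; apply: ler_wpM2r; first exact: cabs_ge0.
by have := cabs_ge0 (w - z0); lra.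
Qed.

Section Estimates.
Variables (F : R[i] -> R[i]) (z0 : R[i]) (R0 r M : R).
Hypotheses (Fd : diff_disc F z0 R0) (r0 : 0 < r) (rR : r < R0).
Hypothesis FM : forall z, cabs (z - z0) = r -> cabs (F z) <= M.

Lemma Taylor3_at : exists a1 a2,
  [/\ cabs a1 <= 2 * M / r, cabs a2 <= 2 * M / r ^+ 2 &
    forall h, cabs h <= r / 2 ->
    cabs (F (z0 + h) - F z0 - a1 * h - a2 * h ^+ 2) <= 4 * M / r ^+ 3 * cabs h ^+ 3].
Proof.
have Fd' z : cabs z < R0 -> exists d, cdiff (fun h => F (z0 + h)) z d.
  move=> zR; have [|d hd] := Fd (z := z0 + z); first by rewrite addrC addKr.
  exists d => e e0; have [m m0 hm] := hd e e0; exists m => // w wz.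
  by have := hm (z0 + w); rewrite opprD addrACA subrr add0r; exact.
have FM' z : cabs z = r -> cabs (F (z0 + z)) <= M.
  by move=> zr; apply: FM; rewrite addrC addKr.
have [a1 [a2 [h1 h2 h3]]] := Taylor3 Fd' r0 rR FM'.
by exists a1, a2; split=> // h /h3; rewrite addr0.
Qed.

Let M0 : 0 <= M.
Proof.
have := FM (z := z0 + r%:C); rewrite addrC addKr cabs_real gtr0_norm // => /(_ erefl).
exact/le_trans/cabs_ge0.
Qed.

Let D0 n : 0 <= 4 * M / r ^+ n.
Proof. exact: divr_ge0 (mulr_ge0 (ler0n _ 4) M0) (exprn_ge0 n (ltW r0)). Qed.

(** The first coefficient is necessarily the derivative. *)
Lemma Taylor2 d : cdiff F z0 d -> cabs d <= 2 * M / r /\ forall h, cabs h <= r / 2 ->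
  cabs (F (z0 + h) - F z0 - d * h) <= 4 * M / r ^+ 2 * cabs h ^+ 2.
Proof.
move=> hd; have [a1 [a2 [h1 h2 h3]]] := Taylor3_at.
have h4 h : cabs h <= r / 2 ->
    cabs (F (z0 + h) - F z0 - a1 * h) <= 4 * M / r ^+ 2 * cabs h ^+ 2.
  move=> hr; have := h3 h hr; set X := _ - a1 * h.
  have c0 := cabs_ge0 h; have c2 : 0 <= cabs h ^+ 2 by rewrite exprn_ge0.
  have k1 : cabs (a2 * h ^+ 2) <= 2 * M / r ^+ 2 * cabs h ^+ 2.
    by rewrite cabsM cabsX ler_wpM2r.
  have k2 : 4 * M / r ^+ 3 * cabs h ^+ 3 <= 2 * M / r ^+ 2 * cabs h ^+ 2.
    rewrite (exprS (cabs h)) mulrA ler_wpM2r //.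
    have -> : 2 * M / r ^+ 2 = 4 * M / r ^+ 3 * (r / 2) by field; rewrite gt_eqF.
    by rewrite ler_wpM2l // D0.
  have := cabsD (X - a2 * h ^+ 2) (a2 * h ^+ 2); rewrite subrK.
  clearbody X; lra.
have -> : d = a1; last by [].
apply: cdiff_unique hd _; apply: (cdiff_quadratic _ _ h4).
  by rewrite divr_gt0.
exact: (D0 2).
Qed.

Lemma Lipschitz_at h : cabs h <= r / 2 -> cabs (F (z0 + h) - F z0) <= 4 * M / r * cabs h.
Proof.
have [|d hd] := Fd (z := z0); first by rewrite subrr cabs0; exact: lt_trans rR.
have [h1 h2] := Taylor2 hd => hr; have {}h2 := h2 h hr.
have c0 := cabs_ge0 h.
have k1 : cabs (d * h) <= 2 * M / r * cabs h by rewrite cabsM ler_wpM2r.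
have k2 : 4 * M / r ^+ 2 * cabs h ^+ 2 <= 2 * M / r * cabs h.
  rewrite (expr2 (cabs h)) mulrA ler_wpM2r //.
  have -> : 2 * M / r = 4 * M / r ^+ 2 * (r / 2) by field; rewrite gt_eqF.
  by rewrite ler_wpM2l // D0.
have := cabsD (F (z0 + h) - F z0 - d * h) (d * h); rewrite subrK; lra.
Qed.

End Estimates.

Definition dquot F (dF : R[i] -> R[i]) w z : R[i] :=
  if z == w then dF w else (F z - F w) / (z - w).

Lemma dquot_diff_off F dF w z d : z != w -> cdiff F z d ->
  cdiff (dquot F dF w) z ((d * (z - w) - (F z - F w)) / (z - w) ^+ 2).
Proof.
move=> zw hd; have zw0 := subf_neq0 zw.
have h1 : cdiff (fun x => F x - F w) z (d + 0) := cdiffD hd (cdiff_cst _ _).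
have := cdiffM h1 (cdiff_inv_sub zw).
have -> : (d + 0) * (z - w)^-1 + (F z - F w) * (-1 / (z - w) ^+ 2) =
  (d * (z - w) - (F z - F w)) / (z - w) ^+ 2 by field.
have zp1 : 0 < cabs (z - w) by rewrite cabs_gt0.
apply: (cdiff_ext zp1) => x xz; rewrite /dquot ifF //.
by apply/negbTE; apply: contraTneq xz => ->; rewrite cabsC ltxx.
Qed.

Lemma diff_disc_bounded F z0 (R0 r : R) : diff_disc F z0 R0 -> r < R0 ->
  exists2 M : R, 0 < M & forall z, cabs (z - z0) <= r -> cabs (F z) <= M.
Proof.
move=> Fd rR; apply: cont_disc_bounded => z zr.
by have [|d /cdiff_cont] := Fd z; first exact: le_lt_trans rR.
Qed.

(** The second order term of the expansion is the derivative of the difference quotient. *)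
Lemma dquot_diff_at F dF w (R0 : R) : 0 < R0 -> diff_disc F w R0 -> cdiff F w (dF w) ->
  exists d, cdiff (dquot F dF w) w d.
Proof.
move=> R00 Fd hd; pose r := R0 / 2; have r0 : 0 < r by rewrite divr_gt0.
have rR : r < R0 by rewrite /r; lra.
have [M M0 hM] := diff_disc_bounded Fd rR.
have FM z : cabs (z - w) = r -> cabs (F z) <= M by move=> zr; apply: hM; rewrite zr.
have [a1 [a2 [h1 h2 h3]]] := Taylor3_at Fd r0 rR FM.
have C0 : 0 <= 4 * M / r ^+ 3 by rewrite divr_ge0 ?mulr_ge0 ?ltW // exprn_gt0.
have r2 : 0 < r / 2 by rewrite divr_gt0.
have a1E : a1 = dF w.
  apply: cdiff_unique hd.
  apply: (@cdiff_quadratic _ _ _ (r / 2) (cabs a2 + 4 * M / r ^+ 3 * (r / 2))) => //.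
    by rewrite addr_ge0 ?cabs_ge0 // mulr_ge0 // ltW.
  move=> h hr; have := h3 h hr; set X := _ - a1 * h => k.
  have c0 := cabs_ge0 h; have c2 : 0 <= cabs h ^+ 2 by rewrite exprn_ge0.
  have k1 : cabs (a2 * h ^+ 2) <= cabs a2 * cabs h ^+ 2 by rewrite cabsM cabsX.
  have k2 : 4 * M / r ^+ 3 * cabs h ^+ 3 <= 4 * M / r ^+ 3 * (r / 2) * cabs h ^+ 2.
    by rewrite (exprS (cabs h)) mulrA ler_wpM2r // ler_wpM2l.
  have := cabsD (X - a2 * h ^+ 2) (a2 * h ^+ 2); rewrite subrK.
  clearbody X; lra.
exists a2; apply: (@cdiff_quadratic _ _ _ (r / 2) (4 * M / r ^+ 3)) => // h hr.
rewrite /dquot eqxx; have [->|h0] := eqVneq h 0.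
  by rewrite addr0 eqxx subrr mulr0 subrr cabs0 expr0n mulr0.
have -> : (w + h == w) = false by rewrite -subr_eq0 addrC addKr (negPf h0).
have -> : w + h - w = h by rewrite addrC addKr.
have -> : (F (w + h) - F w) / h - dF w - a2 * h =
  (F (w + h) - F w - a1 * h - a2 * h ^+ 2) / h by rewrite a1E; field.
rewrite cabsM cabsV ler_pdivrMr ?cabs_gt0 //.
have -> : 4 * M / r ^+ 3 * cabs h ^+ 2 * cabs h = 4 * M / r ^+ 3 * cabs h ^+ 3 by ring.
exact: h3.
Qed.

(** Derivatives are differentiable: the difference quotient [q] at [z0] is
    differentiable, and the derivative of [F] at [z] is [q z + (z - z0) q' z]. *)
Lemma derivative_diff F dF z0 (R0 : R) : 0 < R0 ->
  (forall z, cabs (z - z0) < R0 -> cdiff F z (dF z)) -> exists d, cdiff dF z0 d.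
Proof.
move=> R00 hF.
have Fd : diff_disc F z0 R0 by move=> z /hF; exists (dF z).
have F0 : cdiff F z0 (dF z0) by apply: hF; rewrite subrr cabs0.
have [a2 ha] := dquot_diff_at R00 Fd F0.
set q := dquot F dF z0 in ha.
pose dq z := (dF z * (z - z0) - (F z - F z0)) / (z - z0) ^+ 2.
have qd z : cabs (z - z0) < R0 -> z != z0 -> cdiff q z (dq z).
  by move=> /hF Fz zz; exact: dquot_diff_off.
have qD : diff_disc q z0 R0.
  move=> z zR; have [->|zz] := eqVneq z z0; first by exists a2.
  by exists (dq z); exact: qd.
pose r := R0 / 4; have r0 : 0 < r by rewrite divr_gt0.
have [rR r2R] : r < R0 /\ 2 * r < R0 by rewrite /r; lra.
have [M M0 hM] := diff_disc_bounded qD r2R.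
pose C := 4 * M / r ^+ 2.
have C0 : 0 <= C by rewrite divr_ge0 ?mulr_ge0 ?ltW // exprn_gt0.
have qM z : cabs (z - z0) = r -> cabs (q z) <= M.
  by move=> zr; apply: hM; rewrite zr; lra.
have [_ T0] := Taylor2 qD r0 rR qM ha.
exists (2 * a2); apply: (@cdiff_quadratic _ _ _ (r / 2) (3 * C)).
- by rewrite divr_gt0.
- exact: mulr_ge0 (ler0n _ 3) C0.
move=> h hr; have [->|h0] := eqVneq h 0.
  by rewrite addr0 mulr0 !subrr cabs0 expr0n mulr0.
have zh : cabs (z0 + h - z0) = cabs h by rewrite addrC addKr.
have zz : z0 + h != z0 by rewrite -subr_eq0 addrC addKr.
have hR : cabs (z0 + h - z0) < R0 by rewrite zh; lra.
have qD' : diff_disc q (z0 + h) (2 * r).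
  move=> z zh'; apply: qD; have -> : z - z0 = (z - (z0 + h)) + h by ring.
  by apply: le_lt_trans (cabsD _ _) _; move: hr; rewrite /r in zh' *; lra.
have qM' z : cabs (z - (z0 + h)) = r -> cabs (q z) <= M.
  move=> zh'; apply: hM; have -> : z - z0 = (z - (z0 + h)) + h by ring.
  by apply: le_trans (cabsD _ _) _; lra.
have r2 : r < 2 * r by lra.
have [_ T1] := Taylor2 qD' r0 r2 qM' (qd _ hR zz).
have {}T0 := T0 h hr; have := T1 (- h); rewrite cabsN addrK => /(_ hr) {}T1.
have dFE : dF (z0 + h) = q (z0 + h) + dq (z0 + h) * h.
  rewrite /q /dquot (negPf zz) /dq; have -> : z0 + h - z0 = h by rewrite addrC addKr.
  by field.
have q0 : q z0 = dF z0 by rewrite /q /dquot eqxx.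
(* The term [dq (z0 + h) * h] is replaced by [q (z0 + h) - q z0], using the expansion of
   [q] at [z0 + h]; both expansions have uniform constants. *)
have -> : dF (z0 + h) - dF z0 - 2 * a2 * h =
  (q (z0 + h) - q z0 - a2 * h) + (q z0 - q (z0 + h) - dq (z0 + h) * - h) +
  (q (z0 + h) - q z0 - a2 * h) by rewrite dFE -q0; ring.
apply: le_trans (cabsD _ _) _.
have := cabsD (q (z0 + h) - q z0 - a2 * h) (q z0 - q (z0 + h) - dq (z0 + h) * - h).
by move: T0 T1; rewrite -/C; lra.
Qed.

End LocalTheory.

(** * The index of a closed curve *)

Section GlobalCauchy.
Variable R : realType.
Implicit Types (z w h x : R[i]).

Lemma dquot_cont (F dF : R[i] -> R[i]) z w : cdiff F z (dF z) ->
  (exists d, cdiff F w d) -> cont_at (dquot F dF z) w.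
Proof.
move=> hz [d hd]; have [->|wz] := eqVneq w z; last first.
  exact: cdiff_cont (dquot_diff_off dF wz hd).
have [s [sc sz Fs]] := (cdiff_slope _ _ _).1 hz.
apply: (@cont_at_ext R 1 s) => // v _; rewrite /dquot; case: eqVneq => [->//|vz].
by rewrite Fs; field; exact: subf_neq0.
Qed.

Lemma dquot_sym (F dF : R[i] -> R[i]) z w : dquot F dF z w = dquot F dF w z.
Proof.
rewrite /dquot eq_sym; case: eqVneq => [->//|zw].
by field; rewrite !subf_neq0 // eq_sym.
Qed.

Lemma telescope_ord (V : zmodType) N (u : nat -> V) :
  \sum_(i < N) (u i.+1 - u i) = u N - u 0%N.
Proof. by rewrite -(big_mkord xpredT (fun i => u i.+1 - u i)) telescope_sumr. Qed.

Section Curve.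
Variables (gamma : R -> R[i]^o) (L : R).
Hypotheses (gc : unif_cont01 gamma) (gL : length_le gamma L) (L0 : 0 < L).
Hypothesis gcl : gamma 0 = gamma 1.

(** Distances from a curve are bounded below uniformly, and this bound is what all the
    estimates use. *)
Definition stays_off (w : R[i]) (d : R) : Prop :=
  forall s, 0 <= s <= 1 -> d <= cabs (gamma s - w).

Lemma stays_off_curve w : (forall s, 0 <= s <= 1 -> gamma s != w) ->
  exists2 d : R, 0 < d & stays_off w d.
Proof.
move=> gw.
have qc s : 0 <= s <= 1 -> cont_at (fun z => (z - w)^-1) (gamma s).
  by move=> s01; apply: cont_at_inv_sub; exact: gw.
have [B B0 hB] := unif_cont01_bounded (unif_cont01_comp gc qc).
exists B^-1 => [|s s01]; first by rewrite invr_gt0.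
have := hB s s01; rewrite -[nrm _]/(cabs ((gamma s - w)^-1)) cabsV.
have g0 : 0 < cabs (gamma s - w) by rewrite cabs_gt0 subr_eq0 gw.
by rewrite -[B in _ <= B -> _]invrK lef_pV2 ?posrE ?invr_gt0.
Qed.

Lemma stays_off_neq w (d : R) s : 0 < d -> stays_off w d -> 0 <= s <= 1 -> gamma s != w.
Proof.
move=> d0 wd s01; have := wd s s01; apply: contraTneq => ->.
by rewrite subrr cabs0 -ltNge.
Qed.

Lemma stays_off_shift w h (d e : R) : stays_off w d -> cabs h <= e -> stays_off (w + h) (d - e).
Proof.
move=> wd he s s01; have := wd s s01.
have -> : gamma s - (w + h) = (gamma s - w) - h by ring.
by have := cabs_gtB (gamma s - w) h; lra.
Qed.

Definition cauchy_transform (k : R[i] -> R[i]) w : R[i] :=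
  contour_integral gamma ((fun z => k z / (z - w)) : R[i] -> R[i]^o).

Lemma curve_integrable (q : R[i] -> R[i]) : (forall s, 0 <= s <= 1 -> cont_at q (gamma s)) ->
  is_contour_integral gamma (q : R[i] -> R[i]^o) (contour_integral gamma (q : R[i] -> R[i]^o)).
Proof. exact: contour_integralP gc gL. Qed.

Section Transform.
Variables (k : R[i] -> R[i]) (M : R).
Hypothesis kc : forall s, 0 <= s <= 1 -> cont_at k (gamma s).
Hypothesis kM : forall s, 0 <= s <= 1 -> cabs (k (gamma s)) <= M.

Let M0 : 0 <= M.
Proof.
have := kM (s := 0); rewrite lexx ler01 => /(_ isT); exact/le_trans/cabs_ge0.
Qed.

Lemma cont_at_pow_inv w z n : z != w -> cont_at (fun z => (z - w) ^- n) z.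
Proof.
move=> zw; apply: cont_atV; first by rewrite expf_neq0 // subr_eq0.
elim: n => [|n IH]; first exact: cont_at_cst.
have -> : (fun z => (z - w) ^+ n.+1) = (fun z => (z - w) * (z - w) ^+ n).
  by apply/funext => v; rewrite exprS.
by apply: cont_atM => //; exact: cdiff_cont (cdiff_sub _ _).
Qed.

Lemma cauchy_transformP w (d : R) : 0 < d -> stays_off w d ->
  is_contour_integral gamma ((fun z => k z / (z - w)) : R[i] -> R[i]^o) (cauchy_transform k w).
Proof.
move=> d0 wd; apply: curve_integrable => s s01; apply: cont_atM; first exact: kc.
by apply: cont_at_inv_sub; exact: stays_off_neq wd s01.
Qed.

Lemma cauchy_transform_le w (d : R) : 0 < d -> stays_off w d -> cabs (cauchy_transform k w) <= M / d * L.
Proof.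
move=> d0 wd; have B0 : 0 <= M / d := divr_ge0 M0 (ltW d0).
have hB s : 0 <= s <= 1 -> cabs (k (gamma s) / (gamma s - w)) <= M / d.
  move=> s01; rewrite cabsM cabsV; apply: ler_pM; rewrite ?cabs_ge0 ?invr_ge0 ?cabs_ge0 ?kM //.
  rewrite lef_pV2 ?posrE ?wd //; exact: lt_le_trans (wd s s01).
exact: (@contour_integral_le R (R[i]^o) _ _ _ _ _ gL B0 hB (cauchy_transformP d0 wd)).
Qed.

(** Differentiation under the integral sign: the error of the expansion of [1 / (z - w)]
    is bounded on the curve. *)
Lemma cauchy_transform_diff w (d : R) : 0 < d -> stays_off w d -> exists v,
  is_contour_integral gamma ((fun z => k z * (z - w) ^- 2) : R[i] -> R[i]^o) v /\
  forall h, cabs h <= d / 2 ->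
    cabs (cauchy_transform k (w + h) - cauchy_transform k w - v * h) <= 2 * M / d ^+ 3 * L * cabs h ^+ 2.
Proof.
move=> d0 wd.
have [v hv] : exists v,
    is_contour_integral gamma ((fun z => k z * (z - w) ^- 2) : R[i] -> R[i]^o) v.
  eexists; apply: curve_integrable => s s01; apply: cont_atM; first exact: kc.
  by apply: cont_at_pow_inv; exact: stays_off_neq wd s01.
exists v; split=> // h hd.
have d2 : 0 < d - d / 2 by lra.
have whd := stays_off_shift wd hd.
have hi := is_contour_integralB (is_contour_integralB (cauchy_transformP d2 whd) (cauchy_transformP d0 wd))
  (is_contour_integralZ h hv).
have B0 : 0 <= M * (cabs h ^+ 2 / (d ^+ 2 * (d / 2))).
  by rewrite mulr_ge0 // divr_ge0 ?exprn_ge0 ?cabs_ge0 // mulr_ge0 ?exprn_ge0 ?divr_ge0 // ltW.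
have hB s : 0 <= s <= 1 ->
   cabs (k (gamma s) / (gamma s - (w + h)) - k (gamma s) / (gamma s - w) -
    h *: (k (gamma s) * (gamma s - w) ^- 2 : R[i]^o)) <=
    M * (cabs h ^+ 2 / (d ^+ 2 * (d / 2))).
  move=> s01; have z1 := wd s s01; have z2 := whd s s01; have kz := kM s01.
  have n1 := subf_neq0 (stays_off_neq d0 wd s01); have n2 := subf_neq0 (stays_off_neq d2 whd s01).
  rewrite -[_ *: _]/(_ * _); move: (gamma s) z1 z2 kz n1 n2 => z z1 z2 kz n1 n2.
  have -> : k z / (z - (w + h)) - k z / (z - w) - h * (k z * (z - w) ^- 2) =
     k z * (h ^+ 2 / ((z - w) ^+ 2 * (z - (w + h)))) by field; rewrite n1 n2.
  rewrite (cabsM (k z)) (cabsM (h ^+ 2)) cabsV (cabsM ((z - w) ^+ 2)) !cabsX.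
  apply: ler_pM => //; rewrite ?cabs_ge0 //.
    by rewrite divr_ge0 ?mulr_ge0 ?exprn_ge0 ?cabs_ge0.
  rewrite ler_wpM2l ?exprn_ge0 ?cabs_ge0 // lef_pV2 ?posrE; first last.
  - by rewrite mulr_gt0 ?exprn_gt0 ?divr_gt0.
  - by rewrite mulr_gt0 ?exprn_gt0 ?cabs_gt0.
  apply: ler_pM; rewrite ?exprn_ge0 ?divr_ge0 ?(ltW d0) //.
    by rewrite ler_pXn2r ?nnegrE ?cabs_ge0 // ltW.
  by move: z2; lra.
have := @contour_integral_le R (R[i]^o) _ _ _ _ _ gL B0 hB hi.
rewrite -[nrm _]/(cabs (cauchy_transform k (w + h) - cauchy_transform k w - h * v)) (mulrC h) => /le_trans; apply.
rewrite le_eqVlt; apply/orP; left; apply/eqP; field; exact: lt0r_neq0.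
Qed.

End Transform.

Definition index := cauchy_transform (fun=> 1).

(** The integrand is the derivative of [- (z - w)^-1]. *)
Lemma inv2_integral0 w (d : R) v : 0 < d -> stays_off w d ->
  is_contour_integral gamma ((fun z => 1 * (z - w) ^- 2) : R[i] -> R[i]^o) v -> v = 0.
Proof.
move=> d0 wd; apply: (primitive_integral0 (u := fun z => - (z - w)^-1) gc gL L0 gcl) => e e0.
have d3 : 0 < d ^+ 3 by rewrite exprn_gt0.
exists (e * d ^+ 3) => [|s t s01 t01 step]; first by rewrite mulr_gt0.
have n1 := subf_neq0 (stays_off_neq d0 wd s01); have n2 := subf_neq0 (stays_off_neq d0 wd t01).
have c1 := wd _ s01; have c2 := wd _ t01.
move: (gamma s) (gamma t) step n1 n2 c1 c2 => a b step n1 n2 c1 c2.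
have -> : (b - a) * (1 * (a - w) ^- 2) - (- (b - w)^-1 - - (a - w)^-1) =
  (b - a) ^+ 2 / ((a - w) ^+ 2 * (b - w)) by field; rewrite ?n1 ?n2.
rewrite (cabsM (_ ^+ 2)) cabsV (cabsM (_ ^+ 2)) !cabsX.
have den : d ^+ 3 <= cabs (a - w) ^+ 2 * cabs (b - w).
  rewrite exprSr; apply: ler_pM; rewrite ?exprn_ge0 ?(ltW d0) //.
  by rewrite ler_pXn2r ?nnegrE ?cabs_ge0 // ltW.
apply: (@le_trans _ _ (cabs (b - a) ^+ 2 / d ^+ 3)).
  rewrite ler_wpM2l ?exprn_ge0 ?cabs_ge0 // lef_pV2 ?posrE //.
  exact: lt_le_trans den.
by rewrite ler_pdivrMr // expr2 mulrAC; apply: ler_wpM2r; rewrite ?cabs_ge0.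
Qed.

Lemma index_quadratic w (d : R) : 0 < d -> stays_off w d -> forall h, cabs h <= d / 2 ->
  cabs (index (w + h) - index w) <= 2 / d ^+ 3 * L * cabs h ^+ 2.
Proof.
move=> d0 wd h hd.
have kM (s : R) : 0 <= s <= 1 -> cabs (1 : R[i]) <= 1 by rewrite cabs1.
have [v [hv]] := cauchy_transform_diff (fun _ _ => cont_at_cst 1 _) kM d0 wd.
rewrite (inv2_integral0 d0 wd hv) => /(_ h hd).
by rewrite mul0r subr0 mulr1.
Qed.

(** The index has derivative zero, and the quadratic error sums to nothing over a fine
    subdivision of the segment. *)
Lemma index_segment a b (d : R) : 0 < d ->
  (forall s, 0 <= s <= 1 -> stays_off (seg a b s) d) -> index a = index b.
Proof.
move=> d0 hoff; pose C := 2 / d ^+ 3 * L; have C0 : 0 < C by rewrite !mulr_gt0 ?invr_gt0 ?exprn_gt0.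
apply/esym/eqP; rewrite -subr_eq0; apply/eqP/eps_eq0 => e e0.
pose l := cabs (b - a); have l0 : 0 <= l := cabs_ge0 _.
have l1 : 0 < l + 1 by lra.
have D0 : 0 < C * l ^+ 2 + 1 by have := mulr_ge0 (ltW C0) (exprn_ge0 2 l0); lra.
have [N1 [N10 h1]] := inv_nat_small (divr_gt0 (divr_gt0 d0 (ltr0n _ 2)) l1).
have [N2 [_ h2]] := inv_nat_small (divr_gt0 e0 D0).
pose N := maxn N1 N2.
have N0 : (0 < N)%N by rewrite (leq_trans N10) // leq_maxl.
have {}h1 := h1 N (leq_maxl _ _); have {}h2 := h2 N (leq_maxr _ _).
have NV : 0 < N%:R^-1 :> R by rewrite invr_gt0 ltr0n.
pose p i := seg a b (grid R N i).
have -> : index b - index a = \sum_(i < N) (index (p i.+1) - index (p i)).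
  rewrite (telescope_ord N (fun i => index (p i))).
  have -> : p N = b by rewrite /p /grid divff ?pnatr_eq0 -?lt0n // seg1.
  by have -> : p 0%N = a by rewrite /p /grid mul0r seg0.
apply: le_trans (cabs_sum _ _ _) _.
apply: (@le_trans _ _ (\sum_(i < N) C * (N%:R^-1 * l) ^+ 2)).
  apply: ler_sum => i _; have iN := ltn_ord i.
  have g1 : 0 <= grid R N i <= 1 by apply: grid01; exact: ltnW.
  have dp : cabs (p i.+1 - p i) = N%:R^-1 * l.
    rewrite /p segB gridS addrAC subrr add0r cabsM cabs_real ger0_norm //; exact: ltW.
  have := index_quadratic d0 (hoff _ g1) (h := p i.+1 - p i); rewrite -/(p i) dp.
  rewrite (_ : p i + (p i.+1 - p i) = p i.+1); last by ring.
  by apply; move: h1; rewrite ltr_pdivlMr //; lra.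
rewrite sumr_const card_ord -[leLHS]mulr_natl.
have -> : N%:R * (C * (N%:R^-1 * l) ^+ 2) = C * l ^+ 2 * N%:R^-1.
  by field; rewrite pnatr_eq0 -lt0n.
by move: h2; rewrite ltr_pdivlMr //; lra.
Qed.

Lemma curve_bounded : exists2 B : R, 0 < B & forall s, 0 <= s <= 1 -> cabs (gamma s) <= B.
Proof. exact: unif_cont01_bounded gc. Qed.

(** The index is constant along rays that leave the disc of the curve, and tends to 0
    at infinity. *)
Lemma index_far : exists2 B : R, 0 < B & forall w, B < cabs w -> index w = 0.
Proof.
have [B B0 hB] := curve_bounded; exists B => // w wB.
have far t : 1 <= t -> stays_off (t%:C * w) (cabs w - B).
  move=> t1 s s01; have := cabs_gtB (t%:C * w) (gamma s).
  rewrite cabsC cabsM cabs_real ger0_norm; last lra.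
  have := hB s s01; have := cabs_ge0 w; nra.
have d0 : 0 < cabs w - B by lra.
have kM (s : R) : 0 <= s <= 1 -> cabs (1 : R[i]) <= 1 by rewrite cabs1.
have segE (t s : R) : seg w (t%:C * w) s = (1 + s * (t - 1))%:C * w :> R[i].
  by rewrite /seg rmorphD rmorphM rmorphB rmorph1; ring.
apply: eps_eq0 => e e0.
pose t := 1 + L / (e * cabs w) + B / cabs w.
have w0 : 0 < cabs w by lra.
have ew0 : 0 < e * cabs w by rewrite mulr_gt0.
have t0 : 1 < t.
  have := divr_gt0 L0 ew0; have := divr_gt0 B0 w0; rewrite /t; lra.
rewrite (@index_segment w (t%:C * w) (cabs w - B)) //; last first.
  move=> s s01; rewrite segE.
  have s0 : 0 <= s by case/andP: s01.
  have st : 0 <= s * (t - 1) by apply: mulr_ge0 => //; move: t0; clear; lra.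
  by apply: far; move: st; clear; lra.
have dt : 0 < t * cabs w - B.
  have : 1 * cabs w < t * cabs w by rewrite ltr_pM2r.
  by move: wB; clear; lra.
have offt : stays_off (t%:C * w) (t * cabs w - B).
  move=> s s01; have := cabs_gtB (t%:C * w) (gamma s).
  rewrite cabsC cabsM cabs_real ger0_norm; last lra.
  by have := hB s s01; lra.
apply: le_trans (cauchy_transform_le (fun _ _ => cont_at_cst 1 _) kM dt offt) _.
rewrite mul1r mulrC ler_pdivrMr //.
have -> : e * (t * cabs w - B) = e * cabs w + L + e * B - e * B.
  by rewrite /t; field; rewrite (lt0r_neq0 w0) (lt0r_neq0 e0).
lra.
Qed.

End Curve.
End GlobalCauchy.

(** * Dixon's proof of Cauchy's formula for cycles *)

Section Dixon.
Variables (R : realType) (G : set R[i]) (f df : R[i] -> R[i]).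
Variables (gamma : R -> R[i]^o) (L : R).
Implicit Types (z w h x : R[i]).
Hypothesis Gopen : forall z, G z -> exists2 r : R, 0 < r & forall w, cabs (w - z) < r -> G w.
Hypothesis fd : forall z, G z -> cdiff f z (df z).
Hypotheses (gc : unif_cont01 gamma) (gL : length_le gamma L) (L0 : 0 < L).
Hypothesis gcl : gamma 0 = gamma 1.
Hypothesis gG : forall s, 0 <= s <= 1 -> G (gamma s).
Hypothesis index0 : forall w, ~ G w -> index gamma w = 0.

Let fc s : 0 <= s <= 1 -> cont_at f (gamma s).
Proof. by move=> s01; exact: cdiff_cont (fd (gG s01)). Qed.

Lemma curve_bound_f : exists2 M : R, 0 < M & forall s, 0 <= s <= 1 -> cabs (f (gamma s)) <= M.
Proof. exact: unif_cont01_bounded (unif_cont01_comp gc fc). Qed.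

(** Dixon's function: the integral of the difference quotient, which off [G]
    is continued by a Cauchy integral because the index vanishes there. *)
Definition dixon z : R[i] :=
  if `[< G z >] then contour_integral gamma ((fun w => dquot f df z w) : R[i] -> R[i]^o)
  else cauchy_transform gamma f z.

Lemma dixonP z : G z ->
  is_contour_integral gamma ((fun w => dquot f df z w) : R[i] -> R[i]^o) (dixon z).
Proof.
move=> Gz; rewrite /dixon asboolT //; apply: (curve_integrable gc gL) => s s01.
by apply: dquot_cont; [exact: fd|exists (df (gamma s)); exact/fd/gG].
Qed.

Lemma dixon_off z (d : R) : G z -> 0 < d -> stays_off gamma z d ->
  dixon z = cauchy_transform gamma f z - f z * index gamma z.
Proof.
move=> Gz d0 zd; apply: is_contour_integral_unique (dixonP Gz) _.
have h1 := cauchy_transformP gc gL fc d0 zd.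
have h2 := is_contour_integralZ (f z)
  (cauchy_transformP gc gL (fun _ _ => cont_at_cst 1 _) d0 zd).
apply: is_contour_integral_ext (is_contour_integralB h1 h2) => s s01.
have gz := stays_off_neq d0 zd s01.
rewrite /dquot (negPf gz) -[_ *: _]/(_ * _); field; exact: subf_neq0.
Qed.

Lemma dixon_index0 z (d : R) : 0 < d -> stays_off gamma z d -> index gamma z = 0 ->
  dixon z = cauchy_transform gamma f z.
Proof.
move=> d0 zd i0; have [Gz|Gz] := pselect (G z); last by rewrite /dixon asboolF.
by rewrite (dixon_off Gz d0 zd) i0 mulr0 subr0.
Qed.

(** The index vanishes in a neighbourhood of a point off [G], so that there the function
    is a Cauchy integral, whether the points belong to [G] or not. *)
Lemma dixon_diff_out z : ~ G z -> exists d, cdiff dixon z d.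
Proof.
move=> Gz.
have gz s : 0 <= s <= 1 -> gamma s != z.
  by move=> s01; apply/eqP => E; apply: Gz; rewrite -E; exact: gG.
have [d d0 zd] := stays_off_curve gc gz; have [M M0 hM] := curve_bound_f.
have ind h : cabs h <= d / 2 -> index gamma (z + h) = 0.
  move=> hd; rewrite -(index0 Gz); apply/esym.
  have d2 : 0 < d / 2 by rewrite divr_gt0.
  apply: (index_segment gc gL L0 gcl d2) => s s01.
  have -> : seg z (z + h) s = z + s%:C * h :> R[i] by rewrite /seg; ring.
  have -> : d / 2 = d - d / 2 by field.
  apply: stays_off_shift zd _; rewrite cabsM cabs_real ger0_norm; last by case/andP: s01.
  have := cabs_ge0 h; nra.
have [v [_ hv]] := cauchy_transform_diff gc gL fc hM d0 zd.
have d2 : 0 < d / 2 by rewrite divr_gt0.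
have C0 : 0 <= 2 * M / d ^+ 3 * L.
  apply: mulr_ge0; last exact: ltW.
  by apply: divr_ge0; [exact: mulr_ge0 (ler0n _ 2) (ltW M0)|exact: exprn_ge0 (ltW d0)].
exists v; apply: (cdiff_quadratic d2 C0) => h hd.
rewrite (dixon_index0 _ (stays_off_shift zd hd) (ind h hd)); last lra.
rewrite (dixon_index0 d0 zd (index0 Gz)); exact: hv.
Qed.

Lemma dixon_small (e : R) : 0 < e -> exists2 B : R, 0 < B & forall z, B < cabs z ->
  cabs (dixon z) <= e.
Proof.
move=> e0; have [B B0 hB] := curve_bounded gc; have [M M0 hM] := curve_bound_f.
have [B' B'0 hB'] := index_far gc gL L0 gcl.
have q0 : 0 < M * L / e by rewrite divr_gt0 ?mulr_gt0.
exists (B + B' + M * L / e) => [|z zB]; first lra.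
have d0 : 0 < cabs z - B by lra.
have zd : stays_off gamma z (cabs z - B).
  move=> s s01; have := cabs_gtB z (gamma s); rewrite cabsC.
  by have := hB s s01; lra.
rewrite (dixon_index0 d0 zd); last by apply: hB'; lra.
apply: le_trans (cauchy_transform_le gc gL fc hM d0 zd) _.
rewrite mulrAC ler_pdivrMr //.
have -> : M * L = e * (M * L / e) by field; exact: lt0r_neq0.
by rewrite ler_pM2l //; lra.
Qed.

(** Near a point of [G] the difference quotients are uniformly bounded, hence by
    Taylor's formula uniformly differentiable. *)
Lemma dquot_bounded z0 : G z0 -> exists r R1 M : R, [/\ 0 < r, r < R1, 0 < M,
  forall z, cabs (z - z0) < R1 -> G z &
  forall s z, 0 <= s <= 1 -> cabs (z - z0) = r -> cabs (dquot f df (gamma s) z) <= M].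
Proof.
move=> /Gopen[R1 R10 hR1]; pose r := R1 / 4.
have r0 : 0 < r by rewrite divr_gt0.
have [M2 M20 hM2] := curve_bound_f.
have fD : diff_disc f z0 R1 by move=> z /hR1 /fd; exists (df z).
have r2R : 2 * r < R1 by rewrite /r; lra.
have [M1 M10 hM1] := diff_disc_bounded fD r2R.
exists r, R1, (4 * M1 / r + (M1 + M2) / (r / 2)); split => //.
- by rewrite /r; lra.
- by rewrite addr_gt0 // divr_gt0 ?mulr_gt0 ?addr_gt0 ?divr_gt0.
have P1 : 0 < 4 * M1 / r by rewrite divr_gt0 ?mulr_gt0.
have P2 : 0 < (M1 + M2) / (r / 2) by rewrite divr_gt0 ?addr_gt0 ?divr_gt0.
move=> s z s01 zr; have kw := hM2 s s01; have Gw := gG s01.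
have zR : cabs (z - z0) < R1 by rewrite zr /r; lra.
have zM : cabs (f z) <= M1 by apply: hM1; rewrite zr; lra.
move: (gamma s) kw Gw => w kw Gw.
have [zw|zw] := leP (cabs (w - z)) (r / 2).
  have fDz : diff_disc f z (2 * r).
    move=> u uz; apply: fD; have -> : u - z0 = (u - z) + (z - z0) by ring.
    by apply: le_lt_trans (cabsD _ _) _; move: uz; rewrite zr /r; lra.
  have fMz u : cabs (u - z) = r -> cabs (f u) <= M1.
    move=> uz; apply: hM1; have -> : u - z0 = (u - z) + (z - z0) by ring.
    by apply: le_trans (cabsD _ _) _; lra.
  have r2 : r < 2 * r by lra.
  rewrite dquot_sym /dquot; case: eqVneq => [_|wz].
    have [h _] := Taylor2 fDz r0 r2 fMz (fd (hR1 _ zR)).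
    apply: le_trans h _; have -> : 2 * M1 / r = 4 * M1 / r / 2 by field; exact: lt0r_neq0.
    by move: P1 P2; lra.
  have := Lipschitz_at fDz r0 r2 fMz zw.
  have -> : z + (w - z) = w by ring.
  rewrite cabsM cabsV ler_pdivrMr ?cabs_gt0 ?subf_neq0 // => /le_trans; apply.
  by apply: ler_wpM2r; rewrite ?cabs_ge0 // lerDl ltW.
have wz : z != w by apply: contraTneq zw => ->; rewrite subrr cabs0 -leNgt; lra.
rewrite /dquot (negPf wz) cabsM cabsV.
apply: (@le_trans _ _ ((M1 + M2) / (r / 2))); last by rewrite lerDr ltW.
apply: ler_pM; rewrite ?cabs_ge0 ?invr_ge0 ?cabs_ge0 //.
  by apply: le_trans (cabsB _ _) _; lra.
rewrite lef_pV2 ?posrE ?divr_gt0 ?cabs_gt0 ?subf_neq0 //.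
by rewrite cabsC; exact: ltW.
Qed.

(** Differentiation under the integral sign, with the uniform estimate of
    [dquot_bounded]. *)
Lemma dixon_diff_in z0 : G z0 -> exists d, cdiff dixon z0 d.
Proof.
move=> Gz0; have [r [R1 [M [r0 rR M0 hG hM]]]] := dquot_bounded Gz0.
have R10 : 0 < R1 by lra.
have dd w (R2 : R) : 0 < R2 -> (forall z, cabs (z - w) < R2 -> G z) ->
    exists d, cdiff (dquot f df w) w d.
  move=> R20 hw; apply: (dquot_diff_at R20); first by move=> z /hw /fd; exists (df z).
  by apply/fd/hw; rewrite subrr cabs0.
have ddG w : G w -> exists d, cdiff (dquot f df w) w d.
  by move=> /Gopen[R2 R20 hR2]; exact: dd R20 hR2.
have [a2 ha2] := ddG z0 Gz0.
pose q := dquot f df z0; pose dq (_ : R[i]) := a2.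
(* The derivative of [z |-> dquot f df w z] at [z0] is the second difference
   quotient of [f], a continuous function of [w]. *)
have der w : G w -> cdiff (dquot f df w) z0 (dquot q dq z0 w).
  move=> Gw; rewrite /dquot; case: eqVneq => [->//|wz].
  have zw : z0 != w by rewrite eq_sym.
  have := dquot_diff_off df zw (fd Gz0); congr (cdiff _ _ _).
  rewrite /q /dquot eqxx (negPf wz); field.
  by rewrite !subf_neq0 // eq_sym.
have qdiff w : G w -> exists d, cdiff q w d.
  move=> Gw; have [->|wz] := eqVneq w z0; first by exists a2.
  by eexists; exact: dquot_diff_off wz (fd Gw).
have [v hv] : exists v,
    is_contour_integral gamma ((fun w => dquot q dq z0 w) : R[i] -> R[i]^o) v.
  eexists; apply: (curve_integrable gc gL) => s s01.
  by apply: dquot_cont => //; exact/qdiff/gG.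
have r2 : 0 < r / 2 by rewrite divr_gt0.
have C1 : 0 <= 4 * M / r ^+ 2.
  by apply: divr_ge0; [exact: mulr_ge0 (ler0n _ 4) (ltW M0)|exact: exprn_ge0 (ltW r0)].
have C0 : 0 <= 4 * M / r ^+ 2 * L := mulr_ge0 C1 (ltW L0).
exists v; apply: (cdiff_quadratic r2 C0) => h hr.
have hR : cabs (z0 + h - z0) < R1 by rewrite addrC addKr; lra.
have hi := is_contour_integralB (is_contour_integralB (dixonP (hG _ hR)) (dixonP Gz0))
  (is_contour_integralZ h hv).
have c2 : 0 <= cabs h ^+ 2 by rewrite exprn_ge0 ?cabs_ge0.
have B0 : 0 <= 4 * M / r ^+ 2 * cabs h ^+ 2 := mulr_ge0 C1 c2.
have hB s : 0 <= s <= 1 -> cabs (dquot f df (z0 + h) (gamma s) - dquot f df z0 (gamma s) -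
    h *: (dquot q dq z0 (gamma s) : R[i]^o)) <= 4 * M / r ^+ 2 * cabs h ^+ 2.
  move=> s01; rewrite -[_ *: _]/(_ * _) mulrC !(dquot_sym f df _ (gamma s)).
  have Gw := gG s01.
  have dD : diff_disc (dquot f df (gamma s)) z0 R1.
    move=> z /hG Gz; have [->|zw] := eqVneq z (gamma s); first exact: ddG.
    by eexists; exact: dquot_diff_off zw (fd Gz).
  have [_ T2] := Taylor2 dD r0 rR (fun z zr => hM s z s01 zr) (der _ Gw).
  exact: T2.
have := @contour_integral_le R (R[i]^o) _ _ _ _ _ gL B0 hB hi.
rewrite -[nrm _]/(cabs (dixon (z0 + h) - dixon z0 - h * v)) (mulrC h) => /le_trans; apply.
by rewrite mulrAC.
Qed.

(** Liouville's theorem, in the form of Cauchy's formula on large circles. *)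
Lemma dixon_eq0 x : dixon x = 0.
Proof.
have dixd z : exists d, cdiff dixon z d.
  by have [Gz|Gz] := pselect (G z); [exact: dixon_diff_in|exact: dixon_diff_out].
apply: eps_eq0 => e e0; have e2 : 0 < e / 2 by lra.
have [B B0 hB] := dixon_small e2.
have cx := cabs_ge0 x.
pose r := B + cabs x + 1; have r0 : 0 < r by rewrite /r; lra.
pose F h := dixon (x + h).
have Fd z : cabs z < r + 1 -> exists d, cdiff F z d.
  move=> _; have [d hd] := dixd (x + z); exists d => e1 e10.
  have [m m0 hm] := hd e1 e10; exists m => // w wz.
  by have := hm (x + w); rewrite opprD addrACA subrr add0r; exact.
have rR : r < r + 1 by lra.
have z0r : cabs (0 : R[i]) < r by rewrite cabs0.
have hi := Cauchy_formula Fd r0 rR z0r.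
have [gc' gL'] := circle_curve (ltW r0).
have B1 : 0 <= e / 2 / r by rewrite divr_ge0 // ltW.
have hM s : 0 <= s <= 1 -> cabs (F (circle r s) / (circle r s - 0)) <= e / 2 / r.
  move=> _; rewrite subr0 cabsM cabsV (cabs_circle _ (ltW r0)); apply: ler_wpM2r.
    by rewrite invr_ge0 ltW.
  apply: hB; have := cabs_gtB (circle r s) (- x); rewrite opprK cabsN (cabs_circle _ (ltW r0)).
  by rewrite (addrC x) /r; lra.
have := @contour_integral_le R (R[i]^o) _ _ _ _ _ gL' B1 hM hi.
rewrite -[nrm _]/(cabs (two_pi_i R * F 0)) cabsM cabs_two_pi_i /F addr0.
have -> : e / 2 / r * (4 * pi * r) = 2 * pi * e by field; exact: lt0r_neq0.
by rewrite ler_pM2l // pi2_gt0.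
Qed.

(** The homological form of Cauchy's formula: at points off the curve, the vanishing of
    Dixon's function is the formula. *)
Theorem global_Cauchy x : G x -> (forall s, 0 <= s <= 1 -> gamma s != x) ->
  is_contour_integral gamma ((fun z => f z / (z - x)) : R[i] -> R[i]^o)
    (f x * index gamma x).
Proof.
move=> Gx gx; have [d d0 xd] := stays_off_curve gc gx.
have := dixon_off Gx d0 xd; rewrite dixon_eq0 => /esym/eqP; rewrite subr_eq0 => /eqP <-.
have h := cauchy_transformP gc gL fc d0 xd. exact: h.
Qed.

End Dixon.

(** * Ellipses and their index *)

Section Ellipse.
Variable R : realType.
Implicit Types (z w v p : R[i]).

(** Cauchy's formula at the centre, for the function [z / (z - p)]. *)
Lemma circle_index_out (r : R) p : 0 < r -> r < cabs p ->
  is_contour_integral (circle r) ((fun z => (z - p)^-1) : R[i] -> R[i]^o) (0 : R[i]).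
Proof.
move=> r0 rp; pose F z := z * (z - p)^-1.
have Fd z : cabs z < cabs p -> exists d, cdiff F z d.
  move=> zp; have zp' : z != p by apply: contraTneq zp => ->; rewrite ltxx.
  by eexists; exact: cdiffM (cdiff_id z) (cdiff_inv_sub zp').
have z0 : cabs (0 : R[i]) < r by rewrite cabs0.
have := Cauchy_formula Fd r0 rp z0; rewrite /F mul0r mulr0.
apply: is_contour_integral_ext => s s01; rewrite subr0.
have c0 : circle r s != 0 by rewrite -cabs_gt0 (cabs_circle _ (ltW r0)).
have cp : circle r s - p != 0.
  apply: subf_neq0; apply: contraTneq rp => <-; by rewrite (cabs_circle _ (ltW r0)) ltxx.
by field; rewrite c0 cp.
Qed.

Variables (mu lam rho : R).
Hypotheses (lam0 : 0 < lam) (rho1 : 1 < rho).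

Let rho0 : 0 < rho. Proof. exact: lt_trans rho1. Qed.

(** An ellipse with foci [mu - 2 lam] and [mu + 2 lam], the image of a circle under
    the Joukowski map. *)
Definition ellipse (s : R) : R[i]^o := mu%:C + lam%:C * (circle rho s + (circle rho s)^-1).

Lemma circle_rho_abs s : cabs (circle rho s) = rho.
Proof. exact: cabs_circle (ltW rho0). Qed.

Lemma circle_rho_neq0 s : circle rho s != 0.
Proof. by rewrite -cabs_gt0 circle_rho_abs. Qed.

Lemma ellipse_lip s t : cabs (ellipse s - ellipse t) <= lam * 2 * (4 * pi * rho) * `|s - t|.
Proof.
have a0 := circle_rho_neq0 s; have b0 := circle_rho_neq0 t.
have -> : ellipse s - ellipse t = lam%:C * ((circle rho s - circle rho t) *
    (1 - (circle rho s * circle rho t)^-1)) by rewrite /ellipse; field; rewrite a0 b0.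
have -> : lam * 2 * (4 * pi * rho) * `|s - t| = lam * (4 * pi * rho * `|s - t| * 2) by ring.
rewrite cabsM cabs_real (gtr0_norm lam0) ler_pM2l // cabsM.
have k1 : cabs (circle rho s - circle rho t) <= 4 * pi * rho * `|s - t|.
  have -> : circle rho s - circle rho t = rho%:C * (cis s - cis t) by rewrite /circle; ring.
  by rewrite cabsM cabs_real (gtr0_norm rho0); have := cis_lip s t; have := rho0; nra.
have k2 : cabs (1 - (circle rho s * circle rho t)^-1) <= 2.
  apply: le_trans (cabsB _ _) _; rewrite cabs1 cabsV cabsM !circle_rho_abs.
  have : (rho * rho)^-1 <= 1 by rewrite invf_le1 ?mulr_gt0 //; have := rho1; nra.
  lra.
by apply: ler_pM; rewrite ?cabs_ge0.
Qed.

Lemma ellipse_curve : exists2 L : R, 0 < L & unif_cont01 ellipse /\ length_le ellipse L.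
Proof.
have L0 : 0 < lam * 2 * (4 * pi * rho) by rewrite !mulr_gt0 ?pi_gt0.
by exists (lam * 2 * (4 * pi * rho)) => //; exact: lipschitz_curve (ltW L0) ellipse_lip.
Qed.

(** [v] and [v^-1] are the two preimages of a point under the Joukowski map. *)
Lemma ellipse_sub v s : v != 0 -> ellipse s - (mu%:C + lam%:C * (v + v^-1)) =
  lam%:C * ((circle rho s - v) * (circle rho s - v^-1) / circle rho s).
Proof. by move=> v0; rewrite /ellipse; field; rewrite v0 circle_rho_neq0. Qed.

(** In the variable of the circle, [d z / (z - w)] becomes a sum of three simple
    fractions; the two integral sums over the same grid differ by terms of second order. *)
Lemma ellipse_integral v (u : R[i]) : v != 0 -> cabs v != rho -> cabs v^-1 != rho ->
  is_contour_integral (circle rho) ((fun z => (z - v)^-1 + (z - v^-1)^-1 - (z - 0)^-1)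
    : R[i] -> R[i]^o) u ->
  is_contour_integral ellipse
    ((fun z => (z - (mu%:C + lam%:C * (v + v^-1)))^-1) : R[i] -> R[i]^o) u.
Proof.
move=> v0 vr vr' hu; have [L L0 [gc gL]] := ellipse_curve.
have [cc cL] := circle_curve (ltW rho0).
set w := mu%:C + _.
have dist p s : `|rho - cabs p| <= cabs (circle rho s - p).
  rewrite ler_norml; have := cabs_gtB (circle rho s) p; have := cabs_gtB p (circle rho s).
  by rewrite (cabsC p) circle_rho_abs; lra.
pose D := `|rho - cabs v| * `|rho - cabs v^-1|.
have d1 : 0 < `|rho - cabs v| by rewrite normr_gt0 subr_eq0 eq_sym.
have d2 : 0 < `|rho - cabs v^-1| by rewrite normr_gt0 subr_eq0 eq_sym.
have D0 : 0 < D by rewrite mulr_gt0.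
have n1 s : circle rho s - v != 0 by rewrite -cabs_gt0 (lt_le_trans d1).
have n2 s : circle rho s - v^-1 != 0 by rewrite -cabs_gt0 (lt_le_trans d2).
have lamC : lam%:C != 0 :> R[i] by rewrite fmorph_eq0 lt0r_neq0.
have ew s : ellipse s != w.
  rewrite -subr_eq0 (ellipse_sub s v0) !mulf_neq0 ?invr_eq0 ?circle_rho_neq0 //.
have hx := contour_integralP gc gL (fun s _ => cont_at_inv_sub (ew s)).
set x := contour_integral _ _ in hx.
suff <- : x = u by [].
apply/eqP; rewrite -subr_eq0; apply/eqP/eps_eq0 => e e0.
have L1 : 0 < 4 * pi * rho by rewrite !mulr_gt0 ?pi_gt0.
have e3 : 0 < e / 3 by lra.
pose e1 := e / 3 * D / (4 * pi * rho).
have e10 : 0 < e1 by apply: divr_gt0 => //; exact: mulr_gt0.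
have [dd dd0 hdd] := cc _ e10.
have [N1 [N10 h1]] := inv_nat_small dd0.
have [N2 [_ h2]] := csum_grid hx e3.
have [N3 [_ h3]] := csum_grid hu e3.
pose N := maxn N1 (maxn N2 N3).
have N1N : (N1 <= N)%N by rewrite leq_maxl.
have N2N : (N2 <= N)%N by rewrite /N !leq_max leqnn orbT.
have N3N : (N3 <= N)%N by rewrite /N !leq_max leqnn !orbT.
have N0 : (0 < N)%N by rewrite (leq_trans N10).
have {}h1 := h1 _ N1N.
have := h2 _ N2N _ (@grid_left R N); have := h3 _ N3N _ (@grid_left R N).
set S3 := csum _ _ _ _ _; set S2 := csum ellipse _ _ _ _.
suff SS : cabs (S2 - S3) <= e / 3.
  move: SS; clearbody S2 S3 => SS k1 k2.
  have -> : x - u = (S2 - S3) - (S2 - x) + (S3 - u) by ring.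
  have := cabsD (S2 - S3 - (S2 - x)) (S3 - u); have := cabsB (S2 - S3) (S2 - x); lra.
pose a i := circle rho (grid R N i).
have -> : S2 - S3 = \sum_(i < N) (a i.+1 - a i) ^+ 2 /
    (a i * a i.+1 * ((a i - v) * (a i - v^-1))).
  rewrite /S2 /S3 /csum -sumrB; apply: eq_bigr => i _.
  rewrite /w (ellipse_sub _ v0) /ellipse -/(a i) -/(a i.+1).
  have := n1 (grid R N i); have := n2 (grid R N i); rewrite -/(a i).
  have := circle_rho_neq0 (grid R N i); have := circle_rho_neq0 (grid R N i.+1).
  rewrite -/(a i) -/(a i.+1); move: (a i) (a i.+1) => y y' k1 k2 k3 k4.
  have k3' : y * v - 1 != 0.
    by apply: contraNneq k3 => /eqP; rewrite subr_eq0 => /eqP E; rewrite -[X in _ - X]mul1r -E mulfK // subrr.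
  by field; rewrite ?k1 ?k2 ?k3 ?k4 ?v0 ?lamC ?k3'.
apply: le_trans (cabs_sum _ _ _) _.
apply: (@le_trans _ _ (\sum_(i < N) e1 / D * cabs (a i.+1 - a i))); last first.
  have -> : e / 3 = e1 / D * (4 * pi * rho).
    have Dn := lt0r_neq0 D0; have Kn := lt0r_neq0 L1.
    by rewrite /e1; move: (4 * pi * rho) Kn => K Kn; field; rewrite ?Dn ?Kn.
  rewrite -mulr_sumr; apply: ler_wpM2l; first exact: ltW (divr_gt0 e10 D0).
  by apply: cL; exact: grid_partition.
apply: ler_sum => i _; have iN := ltn_ord i.
have g1 : 0 <= grid R N i <= 1 by apply: grid01; exact: ltnW.
have g2 : 0 <= grid R N i.+1 <= 1 by apply: grid01.
have step : cabs (a i.+1 - a i) <= e1.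
  by apply: hdd => //; rewrite gridS addrAC subrr add0r ger0_norm.
have k1 : D <= cabs ((a i - v) * (a i - v^-1)).
  by rewrite cabsM; apply: ler_pM => //; exact: dist.
have k2 : D <= cabs (a i * a i.+1 * ((a i - v) * (a i - v^-1))).
  rewrite cabsM [cabs (a i * _)]cabsM !circle_rho_abs.
  apply: le_trans k1 _; rewrite ler_peMl ?cabs_ge0 //; have := rho1; nra.
rewrite (cabsM (_ ^+ 2)) cabsV cabsX.
apply: (@le_trans _ _ (cabs (a i.+1 - a i) ^+ 2 / D)).
  rewrite ler_wpM2l ?exprn_ge0 ?cabs_ge0 // lef_pV2 ?posrE //.
  exact: lt_le_trans k2.
rewrite [leRHS]mulrAC; apply: ler_wpM2r; first by rewrite invr_ge0 ltW.
by rewrite expr2; apply: ler_wpM2r; rewrite ?cabs_ge0.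
Qed.

Lemma ellipse_index_in v : v != 0 -> cabs v = 1 -> is_contour_integral ellipse
    ((fun z => (z - (mu%:C + lam%:C * (v + v^-1)))^-1) : R[i] -> R[i]^o) (two_pi_i R).
Proof.
move=> v0 v1; have vV : cabs v^-1 = 1 by rewrite cabsV v1 invr1.
have r1 : (1 == rho) = false by apply/negbTE; rewrite lt_eqF.
apply: ellipse_integral; rewrite ?v1 ?vV ?r1 //.
have z0 : cabs (0 : R[i]) < rho by rewrite cabs0.
have h1 : cabs v < rho by rewrite v1.
have h2 : cabs v^-1 < rho by rewrite vV.
have := is_contour_integralB (is_contour_integralD (circle_index h1) (circle_index h2))
  (circle_index z0).
by rewrite addrK.
Qed.

Lemma ellipse_index_out v : rho < cabs v -> is_contour_integral ellipse
    ((fun z => (z - (mu%:C + lam%:C * (v + v^-1)))^-1) : R[i] -> R[i]^o) (0 : R[i]).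
Proof.
move=> rv; have v0 : v != 0 by rewrite -cabs_gt0 (lt_trans _ rv).
have vV : cabs v^-1 < rho.
  rewrite cabsV (lt_trans _ rho1) // invf_lt1 ?cabs_gt0 //.
  exact: lt_trans rho1 rv.
apply: ellipse_integral; rewrite ?(gt_eqF rv) ?(lt_eqF vV) //.
have z0 : cabs (0 : R[i]) < rho by rewrite cabs0.
have := is_contour_integralB (is_contour_integralD (circle_index_out rho0 rv) (circle_index vV))
  (circle_index z0).
by rewrite add0r subrr.
Qed.

End Ellipse.

(** * Curves surrounding a real segment *)

Section Surround.
Variable R : realType.
Implicit Types (z w v p : R[i]).

Lemma open_disc (G : set R[i]^o) : open G ->
  forall z, G z -> exists2 r : R, 0 < r & forall w, cabs (w - z) < r -> G w.
Proof.
move=> Go z Gz; have /nbhs_ballP[_ /pos_complexP[r r0 ->] hr] := open_nbhs_nbhs (conj Go Gz).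
exists r => // w wz; apply: hr; rewrite /ball /= normcE_cabs ltcR cabsC.
exact: wz.
Qed.

Lemma unit_add_inv v : cabs v = 1 -> v + v^-1 = (2 * complex.Re v)%:C.
Proof.
move=> v1; rewrite invc_norm normcE_cabs v1 rmorph1 expr1n invr1 mul1r addcJ.
by rewrite rmorphM rmorph_nat.
Qed.

Lemma Joukowski_surj (y : R[i]) : exists v, [/\ v != 0, 1 <= cabs v & v + v^-1 = y].
Proof.
pose v := (y + sqrtc (y ^+ 2 - 4)) / 2.
have vE : v * (y - v) = 1.
  rewrite /v; have := sqr_sqrtc (y ^+ 2 - 4); move: (sqrtc _) => s s2.
  have -> : (y + s) / 2 * (y - (y + s) / 2) = (y ^+ 2 - s ^+ 2) / 4 by field.
  by rewrite s2; field.
have v0 : v != 0.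
  by apply: contra_eq_neq vE => ->; rewrite mul0r eq_sym oner_neq0.
have vV : v^-1 = y - v by apply: (mulfI v0); rewrite mulfV.
have [v1|v1] := leP 1 (cabs v); first by exists v; rewrite vV addrC subrK.
exists v^-1; rewrite invr_eq0 invrK vV subrK; split=> //.
by rewrite -vV cabsV -invr1 lef_pV2 ?posrE ?cabs_gt0 // ltW.
Qed.

Lemma Joukowski_real (y : R) : -2 <= y <= 2 -> exists v, [/\ v != 0, cabs v = 1 & v + v^-1 = y%:C].
Proof.
move=> y2; pose v : R[i] := (y / 2) +i* Num.sqrt (1 - (y / 2) ^+ 2).
have v1 : cabs v = 1.
  apply/eqP; rewrite -(@eqrXn2 _ 2) ?cabs_ge0 // cabs_ReIm /= sqr_sqrtr ?expr1n.
    by rewrite addrC subrK.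
  by rewrite expr2; nra.
exists v; split=> //; first by rewrite -cabs_gt0 v1.
by rewrite unit_add_inv //=; congr (_%:C); field.
Qed.

(** Curves confocal to the segment surround it as closely as desired. *)
Lemma surrounding_curve (G S : set R[i]^o) (m M : R) :
  open G -> m < M -> (forall x, m <= x <= M -> G x%:C) ->
  (forall z, S z -> exists2 x, m <= x <= M & z = x%:C) ->
  exists gamma, surrounds_in G S gamma.
Proof.
move=> /open_disc Go mM mMG SmM.
have [| |d d0 hd] := @lebesgue_number_itv R m M (fun x d => forall w, cabs (w - x%:C) < d -> G w).
- by move=> x d d' dd h w wx; apply: h; lra.
- move=> x /mMG /Go[r r0 hr]; exists (r / 2) => [|x' xx' w wx']; first lra.
  apply: hr; have -> : w - x%:C = (w - x'%:C) + (x' - x)%:C by rewrite rmorphB /=; ring.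
  by apply: le_lt_trans (cabsD _ _) _; rewrite cabs_real; lra.
pose lam := (M - m) / 4; pose mu := (m + M) / 2.
have lam0 : 0 < lam by rewrite /lam; lra.
pose rho := 1 + d / (4 * lam).
have q0 : 0 < d / (4 * lam) := divr_gt0 d0 (mulr_gt0 (ltr0n _ 4) lam0).
have rho1 : 1 < rho by rewrite /rho; lra.
have rhoE : 2 * lam * (rho - 1) = d / 2 by rewrite /rho; field; exact: lt0r_neq0.
have mE : m = mu - 2 * lam by rewrite /mu /lam; field.
have ME : M = mu + 2 * lam by rewrite /mu /lam; field.
clearbody rho; clearbody mu lam.
(* [u] is the radial projection of [v] to the unit circle, which the Joukowski map sends
   into the segment, at distance at most [2 * lam * (rho - 1)]. *)
have near_seg v : 1 <= cabs v -> cabs v <= rho -> G (mu%:C + lam%:C * (v + v^-1)).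
  move=> v1 vr; have v0 : 0 < cabs v by lra.
  have vC : (cabs v)%:C != 0 :> R[i] by rewrite fmorph_eq0 lt0r_neq0.
  pose u := v / (cabs v)%:C.
  have u1 : cabs u = 1 by rewrite /u cabsM cabsV cabs_real gtr0_norm // divff ?lt0r_neq0.
  have vu : v = (cabs v)%:C * u by rewrite /u mulrC divfK.
  clearbody u; have u0 : u != 0 by rewrite -cabs_gt0 u1.
  have uE := unit_add_inv u1.
  have uR : `|complex.Re u| <= 1 by rewrite -u1; exact: cabs_Re.
  apply: (hd (mu + lam * (2 * complex.Re u))).
    by move: uR; rewrite ler_norml => /andP[]; rewrite mE ME; nra.
  have -> : (mu + lam * (2 * complex.Re u))%:C = mu%:C + lam%:C * (u + u^-1).
    by rewrite uE -rmorphM -rmorphD.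
  have -> : mu%:C + lam%:C * (v + v^-1) - (mu%:C + lam%:C * (u + u^-1)) =
      lam%:C * ((cabs v - 1)%:C * u - (1 - (cabs v)^-1)%:C * u^-1).
    have cB : (cabs v - 1)%:C = (cabs v)%:C - 1 by rewrite rmorphB rmorph1.
    have cV : (1 - (cabs v)^-1)%:C = 1 - (cabs v)%:C^-1 by rewrite rmorphB rmorph1 fmorphV.
    rewrite cB cV; move: ((cabs v)%:C) vC vu => c c0 ->.
    by field; rewrite c0 u0.
  rewrite cabsM cabs_real gtr0_norm //.
  have vi : (cabs v)^-1 <= 1 by rewrite invf_le1.
  have vj : 1 - (cabs v)^-1 <= cabs v - 1.
    have cc : cabs v * (cabs v)^-1 = 1 by rewrite mulfV ?lt0r_neq0.
    have k1 : 0 <= cabs v - 1 by lra.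
    have k2 : 0 <= 1 - (cabs v)^-1 by lra.
    by have := mulr_ge0 k1 k2; lra.
  have := cabsB ((cabs v - 1)%:C * u) ((1 - (cabs v)^-1)%:C * u^-1).
  rewrite !cabsM cabsV u1 invr1 !mulr1 !cabs_real !ger0_norm ?subr_ge0 //.
  move: (cabs (_ - _)) => X XX.
  have k1 : X <= 2 * (rho - 1) by lra.
  by apply: le_lt_trans (_ : lam * (2 * (rho - 1)) < _); [rewrite ler_pM2l|lra].
have rho0 : 0 < rho by lra.
have ell_on s : G (ellipse mu lam rho s).
  by apply: near_seg; rewrite (cabs_circle _ (ltW rho0)) // ltW.
have seg_v x : m <= x <= M -> exists v, [/\ v != 0, cabs v = 1 &
    x%:C = mu%:C + lam%:C * (v + v^-1)].
  move=> xmM; have [|v [v0 v1 vE]] := @Joukowski_real ((x - mu) / lam).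
    by rewrite ler_pdivrMr // ler_pdivlMr //; lra.
  exists v; split=> //; rewrite vE -rmorphM -rmorphD /=; congr (_%:C).
  by field; exact: lt0r_neq0.
have [L L0 [gc gL]] := ellipse_curve mu lam0 rho1.
exists (ellipse mu lam rho); split.
- split.
  + exact: unif_cont01_within.
  + by rewrite /ellipse /circle cis0 cis1.
  + exists L => n t tp; under eq_bigr do rewrite normcE_cabs.
    by rewrite -rmorph_sum lecR; exact: gL.
- move=> u _; split=> // /SmM[x /seg_v[v [v0 v1 ->]]] /eqP.
  apply/negP; rewrite -subr_eq0 (ellipse_sub _ _ rho1) // !mulf_neq0 ?invr_eq0 //.
  + by rewrite fmorph_eq0 lt0r_neq0.
  + have := cabs_gtB (circle rho u) v; rewrite (cabs_circle _ (ltW rho0)) v1 => h.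
    by rewrite -cabs_gt0; lra.
  + have := cabs_gtB (circle rho u) v^-1; rewrite (cabs_circle _ (ltW rho0)) cabsV v1 invr1 => h.
    by rewrite -cabs_gt0; lra.
  + exact: circle_rho_neq0.
- move=> w /SmM[x /seg_v[v [v0 v1 ->]] ->].
  rewrite /winding_number (contour_integralE (ellipse_index_in mu lam0 rho1 v0 v1)).
  by rewrite mulVf // two_pi_i_neq0.
- move=> w Gw; have [v [v0 v1 vE]] := Joukowski_surj ((w - mu%:C) / lam%:C).
  have lamC : lam%:C != 0 :> R[i] by rewrite fmorph_eq0 lt0r_neq0.
  have wE : w = mu%:C + lam%:C * (v + v^-1) by rewrite vE; field.
  have rv : rho < cabs v.
    by rewrite ltNge; apply/negP => vr; apply: Gw; rewrite wE; exact: near_seg.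
  rewrite wE /winding_number (contour_integralE (ellipse_index_out mu lam0 rho1 rv)).
  by rewrite mulr0.
Qed.

End Surround.

(** * Inverses in Banach algebras *)

Section BanachAlgebraBasics.
Variables (R : realType) (A : banachAlgType R[i]).
Implicit Types (a b x y : A) (z w : R[i]).

Lemma nrmM x y : nrm (x * y) <= nrm x * nrm y.
Proof. by rewrite -lecR rmorphM /= -!normE_nrm; exact: bnormM_le. Qed.

Lemma nrm1_gt0 : 0 < nrm (1 : A).
Proof. by rewrite lt_def nrm_ge0 nrm_eq0 oner_eq0. Qed.

Lemma nrmX x n : nrm (x ^+ n) <= nrm (1 : A) * nrm x ^+ n.
Proof.
elim: n => [|n IH]; first by rewrite !expr0 mulr1.
rewrite !exprSr mulrA; apply: le_trans (nrmM _ _) _.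
by apply: ler_wpM2r; rewrite ?nrm_ge0.
Qed.

Lemma unit_witness x y : y * x = 1 -> x * y = 1 -> x \is a GRing.unit.
Proof. by move=> yx xy; apply/unitrP; exists y. Qed.

Lemma inv_diff x y : x \is a GRing.unit -> y \is a GRing.unit ->
  y^-1 - x^-1 = y^-1 * (x - y) * x^-1.
Proof. by move=> xu yu; rewrite mulrBr mulVr // mulrBl mulrK // mul1r. Qed.

(** Near [x] the norm of the inverse is at most doubled. *)
Lemma inv_cont x : x \is a GRing.unit -> forall e : R, 0 < e -> exists2 d : R, 0 < d &
  forall y, y \is a GRing.unit -> nrm (y - x) < d -> nrm (y^-1 - x^-1) <= e.
Proof.
move=> xu e e0; have N0 := nrm_ge0 x^-1; set N := nrm x^-1 in N0 *.
have N1 : 0 < 2 * (N + 1) by lra.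
have N2 : 0 < 2 * (N + 1) ^+ 2 by rewrite mulr_gt0 ?exprn_gt0 //; lra.
exists (Num.min (1 / (2 * (N + 1))) (e / (2 * (N + 1) ^+ 2))).
  by rewrite lt_min !divr_gt0.
move=> y yu; rewrite lt_min !ltr_pdivlMr // => /andP[h1 h2].
have C0 := nrm_ge0 (y - x).
have k1 : nrm (y^-1 - x^-1) <= nrm y^-1 * nrm (y - x) * N.
  rewrite inv_diff // (nrmC y); apply: le_trans (nrmM _ _) _.
  by apply: ler_wpM2r => //; exact: nrmM.
have := nrmD (y^-1 - x^-1) x^-1; rewrite subrK -/N => k2.
move: k1 k2 h1 h2 C0 (nrm_ge0 y^-1).
move: (nrm (y - x)) (nrm y^-1) (nrm (_ - _)) => C m D k1 k2 h1 h2 C0 m0.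
have m2 : m <= 2 * N by nra.
apply: le_trans k1 _; apply: (@le_trans _ _ (C * (2 * (N + 1) ^+ 2))); last exact: ltW.
by rewrite (mulrC m) -mulrA; apply: ler_wpM2l => //; nra.
Qed.

Lemma sum_geom_le (q : R) m k : 0 <= q < 1 ->
  \sum_(m <= i < m + k) q ^+ i <= q ^+ m / (1 - q).
Proof.
move=> /andP[q0 q1]; have q1' : 0 < 1 - q by rewrite subr_gt0.
rewrite ler_pdivlMr // mulr_suml.
have -> : \sum_(m <= i < m + k) q ^+ i * (1 - q) = q ^+ m - q ^+ (m + k).
  rewrite (eq_bigr (fun i => - (q ^+ i.+1 - q ^+ i))); last first.
    by move=> i _; rewrite exprSr; ring.
  by rewrite sumrN telescope_sumr ?leq_addr // opprB.
by rewrite gerBl exprn_ge0.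
Qed.

(** The Neumann series, under geometric decay of the powers. *)
Lemma Neumann_unit x (C q : R) : 0 <= q < 1 -> (forall n, nrm (x ^+ n) <= C * q ^+ n) ->
  1 - x \is a GRing.unit.
Proof.
move=> q01 hx; have /andP[q0 q1] := q01; have q1' : 0 < 1 - q by rewrite subr_gt0.
have C0 : 0 <= C.
  by have := hx 0%N; rewrite !expr0 mulr1; apply: le_trans; exact: nrm_ge0.
pose u n := \sum_(0 <= i < n) x ^+ i.
have uS m k : nrm (u (m + k)%N - u m) <= C / (1 - q) * q ^+ m.
  have -> : u (m + k)%N - u m = \sum_(m <= i < m + k) x ^+ i.
    by rewrite /u (@big_cat_nat _ _ _ m 0 (m + k)) ?leq_addr //= [X in X - _]addrC addrK.
  apply: le_trans (nrm_sum _ _ _) _.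
  apply: (@le_trans _ _ (\sum_(m <= i < m + k) C * q ^+ i)).
    by apply: ler_sum => i _; exact: hx.
  rewrite -mulr_sumr -mulrA; apply: ler_wpM2l => //.
  by rewrite mulrC; exact: sum_geom_le.
have D0 : 0 < C / (1 - q) + 1 by have := divr_ge0 C0 (ltW q1'); lra.
have small e : 0 < e -> exists N, forall n, (N <= n)%N -> C / (1 - q) * q ^+ n <= e.
  move=> e0; have [N hN] := pow_small q01 (divr_gt0 e0 D0).
  exists N => n /hN; rewrite ler_pdivlMr // => h.
  by apply: le_trans h; rewrite mulrC ler_wpM2l ?exprn_ge0 // lerDl.
have [|s hs] := @complete_seq_banach R A u.
  move=> e e0; have [N hN] := small (e / 2) ltac:(lra).
  exists N => m n /subnKC mN /subnKC nN; have h := hN N (leqnn _).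
  have := uS N (m - N)%N; have := uS N (n - N)%N; rewrite mN nN.
  have := nrm_triangle (u N) (u m) (u n); rewrite (nrmC (u N) (u n)); lra.
have lim (P : A -> A) (K : R) : 0 <= K -> (forall y y', nrm (P y - P y') <= K * nrm (y - y')) ->
    (forall n, P (u n) = 1 - x ^+ n) -> P s = 1.
  move=> K0 PK Pu; apply/eqP; rewrite -subr_eq0; apply/eqP/nrm_small_eq0 => e e0.
  have K1 : 0 < K + 1 by lra.
  have e2 : 0 < e / 2 by lra.
  have [N1 h1] := hs _ (divr_gt0 e2 K1).
  have C1 : 0 < C + 1 by lra.
  have [N2 h2] := pow_small q01 (divr_gt0 e2 C1).
  have := h1 _ (leq_maxl N1 N2); have := h2 _ (leq_maxr N1 N2).
  set N := maxn N1 N2; rewrite !ler_pdivlMr // => k2 k1.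
  have := PK s (u N); rewrite Pu (nrmC s) => k3.
  have -> : P s - 1 = (P s - (1 - x ^+ N)) - x ^+ N by rewrite opprB addrA addrAC addrK.
  apply: le_trans (nrmB _ _) _; have := hx N.
  have := nrm_ge0 (u N - s); have : 0 <= q ^+ N by rewrite exprn_ge0.
  by lra.
have N1x := nrm_ge0 (1 - x).
apply: (@unit_witness _ s).
  apply: (lim (fun y => y * (1 - x)) _ N1x).
    by move=> y y'; rewrite -mulrBl mulrC; exact: nrmM.
  move=> n; rewrite /u big_mkord -[LHS]opprK -mulrN opprB.
  have /(_ n) := subrX1 x; have -> : (\sum_(i < n) x ^+ i) * (x - 1) = (x - 1) * \sum_(i < n) x ^+ i.
    rewrite mulr_suml mulr_sumr; apply: eq_bigr => i _.
    by rewrite mulrBr mulrBl mulr1 mul1r -exprS -exprSr.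
  by move=> <-; rewrite opprB.
apply: (lim (fun y => (1 - x) * y) _ N1x).
  by move=> y y'; rewrite -mulrBr; exact: nrmM.
move=> n; rewrite /u big_mkord -[LHS]opprK -mulNr opprB -subrX1 opprB.
by [].
Qed.

Lemma unit_small x : nrm x < 1 -> 1 - x \is a GRing.unit.
Proof.
move=> x1; apply: (@Neumann_unit x (nrm (1 : A)) (nrm x)); first by rewrite nrm_ge0.
exact: nrmX.
Qed.

Lemma unit_scale z x : z != 0 -> (z *: x \is a GRing.unit) = (x \is a GRing.unit).
Proof.
by move=> z0; rewrite scaler_unit // unitfE.
Qed.

Lemma unit_resolvent z a : z != 0 ->
  (z%:A - a \is a GRing.unit) = (1 - z^-1 *: a \is a GRing.unit).
Proof.
move=> z0; rewrite -(@unit_scale z (1 - z^-1 *: a)) // scalerBr scalerA mulfV // scale1r.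
by [].
Qed.

Lemma spectrum_le z a : spectrum a z -> cabs z <= nrm a.
Proof.
move=> za; rewrite leNgt; apply/negP => az; move: za; rewrite /spectrum /=.
have z0 : z != 0 by rewrite -cabs_gt0 (le_lt_trans (nrm_ge0 a)).
rewrite unit_resolvent // unit_small //.
rewrite nrmZ cabsV mulrC ltr_pdivrMr ?cabs_gt0 // mul1r //.
Qed.

End BanachAlgebraBasics.

(** * The spectral radius after Rickart *)

Section SpectralRadius.
Variables (R : realType) (A : banachAlgType R[i]).
Implicit Types (a b x y : A) (z w : R[i]).

Definition power_bounded x : Prop := exists C : R, forall n, nrm (x ^+ n) <= C.

Section Rickart.
Variables (a : A) (s0 : R).
Hypothesis s00 : 0 < s0.
Hypothesis res : forall z, cabs z <= s0 -> 1 - z *: a \is a GRing.unit.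

Let Phi z : A := (1 - z *: a)^-1.

Lemma dilate_inv_cont z : cabs z <= s0 -> forall e : R, 0 < e -> exists2 d : R, 0 < d &
  forall w, cabs w <= s0 -> cabs (w - z) < d -> nrm (Phi w - Phi z) <= e.
Proof.
move=> zs e e0; have [d d0 hd] := inv_cont (res zs) e0.
have a1 : 0 < nrm a + 1 by have := nrm_ge0 a; lra.
exists (d / (nrm a + 1)) => [|w ws]; first by rewrite divr_gt0.
rewrite ltr_pdivlMr // => wz; apply: hd (res ws) _.
have -> : 1 - w *: a - (1 - z *: a) = (z - w) *: a.
  by rewrite scalerBl opprB addrC addrA subrK.
by rewrite nrmZ cabsC; have := cabs_ge0 (w - z); lra.
Qed.

Lemma dilate_inv_unif_cont (e : R) : 0 < e -> exists2 d : R, 0 < d &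
  forall z w, cabs z <= s0 -> cabs w <= s0 -> cabs (w - z) < d -> nrm (Phi w - Phi z) <= e.
Proof.
move=> e0; pose Q z (d : R) := cabs z <= s0 ->
  forall w, cabs w <= s0 -> cabs (w - z) < d -> nrm (Phi w - Phi z) <= e.
have [| |d d0 hd] := @lebesgue_number_disc R s0 Q.
- by move=> z d d' dd q zs w ws wz; apply: q => //; lra.
- move=> z zs; have [|d d0 hd] := dilate_inv_cont zs (e := e / 2); first lra.
  exists (d / 2) => [|z' z'z z's w ws wz']; first lra.
  have h1 : nrm (Phi z' - Phi z) <= e / 2 by apply: hd => //; lra.
  have h2 : nrm (Phi w - Phi z) <= e / 2.
    apply: hd => //; have -> : w - z = (w - z') + (z' - z) by ring.
    by apply: le_lt_trans (cabsD _ _) _; lra.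
  by have := nrm_triangle (Phi z) (Phi w) (Phi z'); rewrite (nrmC (Phi z)); lra.
by exists d => // z w zs; exact: hd.
Qed.

(** The average of the resolvent over the N-th roots of unity inverts
    [1 - (s a)^N] and is equicontinuous in [s], uniformly in [N]. *)
Let avg N (s : R) : A := (N%:R : R[i])^-1 *: \sum_(j < N) Phi (s%:C * cis N%:R^-1 ^+ j).

Let arg_abs N (s : R) j : 0 <= s -> cabs (s%:C * cis (N%:R^-1 : R) ^+ j) = s.
Proof. by move=> s0'; rewrite cabsM cabs_real cabsX cabs_cis expr1n mulr1 ger0_norm. Qed.

Lemma avgP N (s : R) : (0 < N)%N -> 0 <= s <= s0 -> avg N s * (1 - (s%:C *: a) ^+ N) = 1.
Proof.
move=> N0 /andP[s0' ss].
have NC : N%:R != 0 :> R[i] by rewrite pnatr_eq0 -lt0n.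
have omN : cis (N%:R^-1 : R) ^+ N = 1.
  by rewrite cisX divff ?cis1 // pnatr_eq0 -lt0n.
rewrite /avg -scalerAl.
rewrite (@sum_resolvent_roots R A N _ (s%:C *: a)
  (fun j => Phi (s%:C * cis N%:R^-1 ^+ j)) omN (fun k => @cis_root R N k)).
  have -> : (N%:R : A) = (N%:R : R[i]) *: 1 by rewrite scaler_nat.
  by rewrite scalerA mulVf // scale1r.
move=> j jN; rewrite (scalerA _ s%:C) (mulrC (_ ^+ j)); apply: mulVr; apply: res.
by rewrite arg_abs.
Qed.

Lemma avg_equicont (e d : R) N s t : (0 < N)%N ->
  (forall z w, cabs z <= s0 -> cabs w <= s0 -> cabs (w - z) < d -> nrm (Phi w - Phi z) <= e) ->
  0 <= s <= s0 -> 0 <= t <= s0 -> `|t - s| < d -> nrm (avg N t - avg N s) <= e.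
Proof.
move=> N0 hd /andP[s1 s2] /andP[t1 t2] ts.
have NR : 0 < N%:R :> R by rewrite ltr0n.
rewrite /avg -scalerBr nrmZ cabsV cabs_nat mulrC ler_pdivrMr // -sumrB.
apply: le_trans (nrm_sum _ _ _) _; rewrite [e * _]mulr_natr -[N in e *+ N]card_ord.
rewrite -sumr_const; apply: ler_sum => j _; apply: hd; rewrite ?arg_abs //.
have -> : t%:C * cis (N%:R^-1 : R) ^+ j - s%:C * cis N%:R^-1 ^+ j =
  (t - s)%:C * cis N%:R^-1 ^+ j by rewrite rmorphB /=; ring.
by rewrite cabsM cabs_real cabsX cabs_cis expr1n mulr1.
Qed.

Lemma power_bounded_from_eventually x (C : R) N0 :
  (forall n, (N0 <= n)%N -> nrm (x ^+ n) <= C) -> power_bounded x.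
Proof.
move=> h; exists (`|C| + \sum_(n < N0) nrm (x ^+ n)) => n.
have [nN|Nn] := ltnP n N0.
  rewrite (bigD1 (Ordinal nN)) //= addrCA lerDl addr_ge0 ?normr_ge0 //.
  by apply: sumr_ge0 => i _; exact: nrm_ge0.
apply: le_trans (h n Nn) _; apply: le_trans (ler_norm C) _; rewrite lerDl.
by apply: sumr_ge0 => i _; exact: nrm_ge0.
Qed.

(** One step outwards: at [s] the powers of [s a] tend to zero, so the average is
    close to 1, and by equicontinuity it stays so at [t]. *)
Lemma power_bounded_step (d s t : R) : 0 < d ->
  (forall z w, cabs z <= s0 -> cabs w <= s0 -> cabs (w - z) < d -> nrm (Phi w - Phi z) <= 1 / 4) ->
  0 <= s <= s0 -> 0 <= t <= s0 -> `|t - s| < d ->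
  (forall e : R, 0 < e -> exists N0, forall N, (N0 <= N)%N -> nrm ((s%:C *: a) ^+ N) <= e) ->
  power_bounded (t%:C *: a).
Proof.
move=> d0 hd ss ts st hs; have n1 := nrm1_gt0 A.
pose e := Num.min (1 / 2) (1 / 8 / nrm (1 : A)).
have e0 : 0 < e by rewrite lt_min !divr_gt0.
have [e1 e2] : e <= 1 / 2 /\ e <= 1 / 8 / nrm (1 : A) by rewrite /e !ge_min !lexx orbT.
have [N0 hN0] := hs e e0.
apply: (@power_bounded_from_eventually _ (3 * nrm (1 : A)) N0.+1) => N NN.
have Np : (0 < N)%N := leq_trans (ltn0Sn _) NN.
have {hN0} hx := hN0 N (ltnW NN).
have F1 := avgP Np ss; have F2 := avgP Np ts.
have F12 := avg_equicont Np hd ss ts st.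
move: (avg N s) (avg N t) F1 F2 F12 => F G F1 F2 F12.
move: ((s%:C *: a) ^+ N) hx F1 => x hx F1; move: ((t%:C *: a) ^+ N) F2 => y F2.
have FE : F = 1 + F * x by rewrite -F1 mulrBr mulr1 subrK.
have GE : 1 - y = 1 + (1 - G) * (1 - y) by rewrite mulrBl mul1r F2 [RHS]addrC subrK.
have f0 := nrm_ge0 F; have x0 := nrm_ge0 x.
have Fx : nrm (F * x) <= nrm F * nrm x := nrmM _ _.
have Fx2 : nrm F * nrm x <= nrm F * (1 / 2) by apply: ler_wpM2l => //; lra.
have Fn : nrm F <= 2 * nrm (1 : A) by have := nrmD (1 : A) (F * x); rewrite -FE; lra.
have F1n : nrm (1 - F) <= 1 / 4.
  have -> : 1 - F = - (F * x) by rewrite {1}FE opprD addrA subrr sub0r.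
  rewrite nrmN; apply: le_trans Fx _.
  have : nrm F * nrm x <= 2 * nrm (1 : A) * (1 / 8 / nrm (1 : A)) by apply: ler_pM => //; lra.
  by rewrite (_ : 2 * nrm (1 : A) * (1 / 8 / nrm (1 : A)) = 1 / 4) //; field; exact: lt0r_neq0.
have G1n : nrm (1 - G) <= 1 / 2.
  by have := nrm_triangle F (1 : A) G; rewrite (nrmC F G); lra.
have yn : nrm (1 - y) <= 2 * nrm (1 : A).
  have := nrmD (1 : A) ((1 - G) * (1 - y)); rewrite -GE.
  have := nrmM (1 - G : A) (1 - y : A); have := nrm_ge0 (1 - y : A).
  have : nrm (1 - G) * nrm (1 - y) <= 1 / 2 * nrm (1 - y) by apply: ler_wpM2r => //; exact: nrm_ge0.
  by lra.
by have := nrmB (1 : A) (1 - y : A); rewrite opprB addrC subrK; lra.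
Qed.

(** If the inverses of [1 - z a] exist on the closed disc of radius [s0], they are uniformly
    continuous there, and the interval from 0 to [s0] is covered by finitely many steps of
    equal length. *)
Lemma power_bounded_at : power_bounded (s0%:C *: a).
Proof.
have [d d0 hd] := dilate_inv_unif_cont (e := 1 / 4) ltac:(lra).
(* Each step is taken from a point strictly before the one where boundedness is known, so
   that powers tend to zero at its origin. *)
pose st k : R := Num.min s0 (k%:R * (d / 3)).
have d3 : 0 < d / 3 by lra.
have st01 k : 0 <= st k <= s0.
  by rewrite /st le_min ltW //= mulr_ge0 ?ler0n ?(ltW d3) //= ge_min lexx.
have Q k : power_bounded ((st k)%:C *: a).
  elim: k => [|k [C hC]].
    have -> : st 0%N = 0 by rewrite /st mul0r; apply/min_idPr; exact: ltW.
    rewrite scale0r; apply: (@power_bounded_from_eventually _ 0 1) => n n0.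
    by rewrite expr0n (gtn_eqF n0) nrm0.
  have /andP[k0 k1] := st01 k.
  pose s := Num.max 0 (st k - d / 3).
  have s0' : 0 <= s by rewrite /s le_max lexx.
  have ssk : s <= st k by rewrite /s ge_max k0 /=; lra.
  have hs : st k - d / 3 <= s by rewrite /s le_max lexx orbT.
  have Sk : st k.+1 <= st k + d / 3.
    rewrite /st -natr1 mulrDl mul1r; case: (leP s0 (k%:R * (d / 3))) => h.
      by rewrite ge_min; apply/orP; left; lra.
    by rewrite ge_min lexx orbT.
  have Sk' : st k <= st k.+1.
    rewrite /st le_min !ge_min lexx /=; apply/orP; right.
    by rewrite ler_wpM2r ?(ltW d3) // ler_nat.
  apply: (power_bounded_step d0 hd (s := s)); rewrite ?st01 ?s0' ?(le_trans ssk) //.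
    by rewrite ger0_norm; lra.
  move=> e e0; have [sz|sz] := leP s 0.
    have -> : s = 0 by apply/eqP; rewrite eq_le sz s0'.
    exists 1%N => N N1; rewrite scale0r expr0n; case: N N1 => // N _ /=.
    by rewrite nrm0 ltW.
  have k0' : 0 < st k by lra.
  have ks : s < st k by move: sz; rewrite /s lt_max gt_max ltxx /= => sz; lra.
  pose th := s / st k.
  have th01 : 0 <= th < 1 by rewrite divr_ge0 //= ltr_pdivrMr // mul1r.
  have C1 : 0 < `|C| + 1 by have := normr_ge0 C; lra.
  have [N0 hN0] := pow_small th01 (divr_gt0 e0 C1).
  exists N0 => N /hN0; rewrite ler_pdivlMr // => h.
  have -> : s%:C *: a = th%:C *: ((st k)%:C *: a).
    by rewrite scalerA -rmorphM /= /th divfK // lt0r_neq0.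
  rewrite exprZn nrmZ cabsX cabs_real ger0_norm; last by case/andP: th01.
  apply: le_trans h; apply: ler_wpM2l; first by rewrite exprn_ge0 //; case/andP: th01.
  by apply: le_trans (hC N) _; have := ler_norm C; lra.
pose k := (Num.truncn (s0 / (d / 3))).+1.
have <- : st k = s0; last exact: Q.
apply/min_idPl; rewrite -ler_pdivrMr //; apply: ltW; exact: truncnS_gt.
Qed.

End Rickart.

End SpectralRadius.

(** * Positive functionals on normal elements *)

Section SpectrumSum.
Variables (R : realType) (A : banachAlgType R[i]).
Implicit Types (a b x y : A) (z w : R[i]).

Lemma spectrum_unit a z : ~ spectrum a z -> z%:A - a \is a GRing.unit.
Proof. by rewrite /spectrum /= => /negP; rewrite negbK. Qed.

Lemma resolvent_unit a (r s : R) : 0 < s -> s * r < 1 ->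
  (forall z, spectrum a z -> cabs z <= r) ->
  forall z, cabs z <= s -> 1 - z *: a \is a GRing.unit.
Proof.
move=> s0 sr ha z zs; have [->|z0] := eqVneq z 0; first by rewrite scale0r subr0 unitr1.
rewrite -[z]invrK -unit_resolvent ?invr_eq0 //; apply: spectrum_unit => /ha.
rewrite cabsV; apply/negP; rewrite -ltNge.
have c0 : 0 < cabs z by rewrite cabs_gt0.
rewrite -[ltRHS]mul1r ltr_pdivlMr //.
have [r0|r0] := leP 0 r; last by have := mulr_lt0 r (cabs z); nra.
by apply: le_lt_trans sr; rewrite mulrC ler_wpM2r.
Qed.

Lemma power_bound a (r s : R) : 0 < s -> s * r < 1 ->
  (forall z, spectrum a z -> cabs z <= r) ->
  exists C : R, forall n, nrm (a ^+ n) <= C / s ^+ n.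
Proof.
move=> s0 sr ha; have [C hC] := power_bounded_at s0 (resolvent_unit s0 sr ha).
exists C => n; rewrite ler_pdivlMr ?exprn_gt0 // mulrC.
by have := hC n; rewrite exprZn nrmZ cabsX cabs_real gtr0_norm.
Qed.

(** Otherwise the powers of [a] would decay faster than any geometric sequence, whereas
    those of its inverse grow at most geometrically. *)
Lemma spectrum_nonempty a : exists z, spectrum a z.
Proof.
apply: contrapT => h; have {}h z : ~ spectrum a z by move=> za; apply: h; exists z.
have au : a \is a GRing.unit.
  by have := spectrum_unit (h 0); rewrite scale0r sub0r unitrN.
have b0 := nrm_ge0 a^-1; pose s := 2 * (nrm a^-1 + 1).
have s0 : 0 < s by rewrite /s; lra.
have sr : s * -1 < 1 by lra.
have [C hC] := power_bound s0 sr (fun z za => False_ind _ (h z za)).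
have n1 := nrm1_gt0 A.
have aV n : a ^+ n * a^-1 ^+ n = 1.
  by rewrite exprVn divrr // unitrX.
have step n : nrm (1 : A) <= C * nrm (1 : A) * (1 / 2) ^+ n.
  rewrite -{1}(aV n); apply: le_trans (nrmM _ _) _.
  have h1 := hC n; have h2 := nrmX a^-1 n.
  have h3 : nrm (1 : A) * nrm a^-1 ^+ n <= nrm (1 : A) * (s / 2) ^+ n.
    by rewrite ler_pM2l // lerXn2r ?nnegrE //; rewrite /s; lra.
  apply: (@le_trans _ _ (C / s ^+ n * (nrm (1 : A) * (s / 2) ^+ n))).
    by apply: ler_pM; rewrite ?nrm_ge0 // (le_trans h2 h3).
  rewrite !expr_div_n expr1n le_eqVlt; apply/orP; left; apply/eqP.
  by field; rewrite !expf_neq0 // lt0r_neq0.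
have C0 : 0 <= C by have := hC 0%N; rewrite expr0 divr1; apply: le_trans; exact: nrm_ge0.
have c1 : 0 < C * nrm (1 : A) + 1 by have := mulr_ge0 C0 (ltW n1); lra.
have half01 : 0 <= (1 / 2 : R) < 1 by lra.
have n2 : 0 < nrm (1 : A) / 2 by rewrite divr_gt0.
have [N hN] := pow_small half01 (divr_gt0 n2 c1).
have := hN N (leqnn _); rewrite ler_pdivlMr // => k.
have := step N; have : 0 <= (1 / 2 : R) ^+ N by rewrite exprn_ge0.
by move: k; move: ((1 / 2) ^+ N) (C * nrm (1 : A)) => X Y; lra.
Qed.

(** The spectral radius is subadditive on commuting elements; the binomial
    formula gives this for the growth of the powers. *)
Lemma spectrum_add_le a b (r : R) : 0 <= r -> a * b = b * a ->
  (forall z, spectrum a z -> cabs z <= r) -> (forall z, spectrum b z -> cabs z <= r) ->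
  forall z, spectrum (a + b) z -> cabs z <= 2 * r.
Proof.
move=> r0 ab ha hb z zab; rewrite leNgt; apply/negP => rz; move: zab; rewrite /spectrum /=.
have z0 : z != 0 by rewrite -cabs_gt0; lra.
have cz : 0 < cabs z by rewrite cabs_gt0.
rewrite unit_resolvent // => /negP; apply.
pose m := (2 * r + cabs z) / 2 / 2; have m0 : 0 < m by rewrite /m; lra.
have rm : r < m by rewrite /m; lra.
have mz : 2 * m < cabs z by rewrite /m; lra.
have sm : 0 < m^-1 by rewrite invr_gt0.
have mr : m^-1 * r < 1 by rewrite mulrC ltr_pdivrMr // mul1r.
clearbody m.
have [C hC] := power_bound sm mr ha; have [C' hC'] := power_bound sm mr hb.
have c0 : 0 <= C by have := hC 0%N; rewrite expr0 divr1; apply: le_trans; exact: nrm_ge0.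
have c0' : 0 <= C' by have := hC' 0%N; rewrite expr0 divr1; apply: le_trans; exact: nrm_ge0.
apply: (@Neumann_unit _ _ _ (C * C') (2 * m / cabs z)).
  rewrite (divr_ge0 (mulr_ge0 (ler0n _ 2) (ltW m0)) (ltW cz)) /=.
  by rewrite ltr_pdivrMr // mul1r.
move=> n; rewrite exprZn nrmZ cabsX cabsV (exprDn_comm _ ab).
have S : nrm (\sum_(i < n.+1) (a ^+ (n - i) * b ^+ i) *+ 'C(n, i)) <= C * C' * (2 * m) ^+ n.
  apply: le_trans (nrm_sum _ _ _) _.
  apply: (@le_trans _ _ (\sum_(i < n.+1) C * C' * m ^+ n *+ 'C(n, i))).
    apply: ler_sum => i _; have iN : (i <= n)%N by rewrite -ltnS ltn_ord.
    rewrite -scaler_nat nrmZ cabs_nat -[leRHS]mulr_natl; apply: ler_wpM2l; first by rewrite ler0n.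
    apply: le_trans (nrmM _ _) _.
    have h1 := hC (n - i)%N; have h2 := hC' i.
    have -> : C * C' * m ^+ n = (C * m ^+ (n - i)) * (C' * m ^+ i).
      by rewrite -{1}(subnK iN) exprD; ring.
    by apply: ler_pM; rewrite ?nrm_ge0 // -[m]invrK exprVn.
  rewrite sumrMnr.
  have -> : (\sum_(i < n.+1) 'C(n, i))%N = (2 ^ n)%N.
    by have := Pascal 1 1 n; rewrite addn1 => ->; apply: eq_bigr => i _; rewrite !exp1n !muln1.
  by rewrite -[leLHS]mulr_natr natrX exprMn; rewrite le_eqVlt; apply/orP; left; apply/eqP; ring.
rewrite expr_div_n exprVn mulrA mulrC; apply: ler_wpM2r => //.
by rewrite invr_ge0 exprn_ge0 // ltW.
Qed.

End SpectrumSum.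

Section Star.
Variables (R : realType) (A : banachAlgType R[i]) (star : A -> A) (psi : {scalar A}).
Implicit Types (a b c x y : A) (z w : R[i]).
Hypothesis invol : is_involution star.

Lemma star1 : star 1 = 1.
Proof.
have := starM invol 1 (star 1).
by rewrite mul1r (starK invol) mul1r => <-.
Qed.

Lemma star_alg z : star z%:A = (Num.conj z)%:A.
Proof. by rewrite (starZ invol) star1. Qed.

Lemma starN x : star (- x) = - star x.
Proof. by rewrite -scaleN1r (starZ invol) rmorphN rmorph1 scaleN1r. Qed.

Lemma star_unit x : x \is a GRing.unit -> star x \is a GRing.unit.
Proof.
move=> xu; apply: (@unit_witness _ _ _ (star x^-1)).
  by rewrite -(starM invol) divrr // star1.
by rewrite -(starM invol) mulVr // star1.
Qed.

Lemma starV x : x \is a GRing.unit -> star x^-1 = (star x)^-1.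
Proof.
move=> xu; apply: (mulrI (star_unit xu)).
by rewrite -(starM invol) mulVr // star1 divrr // star_unit.
Qed.

Lemma spectrum_star a z : spectrum (star a) z -> spectrum a (Num.conj z).
Proof.
apply: contraPP => /spectrum_unit /star_unit.
rewrite (starD invol) starN star_alg conjCK /spectrum /= => ->.
by [].
Qed.

Hypotheses (herm : hermitian_algebra star) (pos : positive_functional star psi).
Hypothesis psi1 : normalized psi.

Lemma psi_alg z : psi z%:A = z.
Proof. by rewrite linearZ /= psi1 mulr1. Qed.

(** Positivity is applied to [h + r]; this does not involve the norm of [h]. *)
Lemma psi_selfadjoint_ge h (r : R) : star h = h ->
  (forall z, spectrum h z -> - r <= complex.Re z) ->
  exists2 p : R, psi h = p%:C & - r <= p.
Proof.
move=> hs hr.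
have : nonneg star (h + r%:C%:A).
  split; first by rewrite /selfadjoint (starD invol) hs star_alg conj_Creal // complex_real.
  move=> z /= zh; have : spectrum h (z - r%:C).
    by move: zh; rewrite /spectrum /= scalerBl opprD addrA addrAC.
  move=> hz; have := herm hs hz; rewrite /= => /complex_realP[x zx].
  have zE : z = (x + r)%:C by rewrite rmorphD /= -zx subrK.
  by have := hr _ hz; rewrite zx /= zE ler0c; lra.
move=> /pos; rewrite linearD /= psi_alg => h0.
have [p pE] : exists p, psi h + r%:C = p%:C by apply/complex_realP; exact: ger0_real.
exists (p - r); first by rewrite rmorphB /= -pE addrK.
by move: h0; rewrite pE ler0c; lra.
Qed.

Lemma psi_selfadjoint_le h (r : R) : star h = h ->
  (forall z, spectrum h z -> `|complex.Re z| <= r) -> cabs (psi h) <= r.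
Proof.
move=> hs hr.
have [|p pE pr] := psi_selfadjoint_ge hs (r := r).
  by move=> z /hr; rewrite ler_norml => /andP[].
have hs' : star (- h) = - h by rewrite starN hs.
have [|q qE qr] := psi_selfadjoint_ge hs' (r := r).
  move=> z zh; have /hr : spectrum h (- z).
    move: zh; rewrite /spectrum /= opprK scaleNr -opprD unitrN.
    by [].
  by rewrite raddfN ler_norml => /andP[]; lra.
have : q = - p by apply: complexI; rewrite -qE linearN /= pE rmorphN.
by move=> qp; rewrite pE cabs_real ler_norml pr /=; lra.
Qed.

(** Although the involution need not be continuous, the spectral radius of [star a] is that
    of [a], and the spectrum of [a + star a] is bounded accordingly. *)
Lemma psi_normal_le a : a * star a = star a * a -> cabs (psi a) <= 2 * nrm a.
Proof.
move=> aa; have n0 := nrm_ge0 a.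
have ha z : spectrum a z -> cabs z <= nrm a := @spectrum_le _ _ z a.
have re (b : A) : b * star b = star b * b -> nrm b = nrm a ->
    cabs (psi (b + star b)) <= 2 * nrm a.
  move=> bb ba; apply: psi_selfadjoint_le; first by rewrite (starD invol) (starK invol) addrC.
  move=> z zb; apply: le_trans (cabs_Re z) _.
  apply: (spectrum_add_le n0 bb _ _ zb) => w; first by rewrite -ba; exact: spectrum_le.
  by move=> /spectrum_star /spectrum_le; rewrite cabs_conj ba.
have h1 := re a aa erefl.
pose b := - 'i *: a : A.
have ci : cabs 'i = 1 :> R by rewrite {1}/cabs normc_def /= expr0n expr1n add0r sqrtr1.
have ii : 'i * 'i = -1 :> R[i] by rewrite -expr2 sqr_i.
have sb : star b = 'i *: star a.
  rewrite /b (starZ invol); congr (_ *: _).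
  by apply/eqP; rewrite eq_complex /= oppr0 opprK !eqxx.
have h2 : cabs (psi (b + star b)) <= 2 * nrm a.
  apply: re; last by rewrite /b nrmZ cabsN ci mul1r.
  by rewrite sb /b -!scalerAl -!scalerAr aa !scalerA mulrC.
have aE : a = (2^-1 : R[i]) *: (a + star a) + ('i / 2) *: (b + star b).
  rewrite sb /b !scalerDr !scalerA.
  have -> : 'i / 2 * - 'i = 2^-1 :> R[i].
    by rewrite mulrN mulrAC ii mulN1r opprK.
  have -> : 'i / 2 * 'i = - 2^-1 :> R[i] by rewrite mulrAC ii mulN1r.
  rewrite scaleNr addrACA subrr addr0 -scalerDl.
  by rewrite (_ : 2^-1 + 2^-1 = 1) ?scale1r //; field.
rewrite {1}aE linearD !linearZ /=; apply: le_trans (cabsD _ _) _; rewrite !cabsM ci mul1r.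
rewrite -[2^-1 : R[i]](_ : (2^-1 : R)%:C = _); last by rewrite fmorphV rmorph_nat.
rewrite cabs_real ger0_norm ?invr_ge0 //.
by move: h1 h2; move: (cabs _) (cabs _) => X Y; lra.
Qed.

End Star.

(** * Rational functions of an element, and their limits *)

Section Rational.
Variables (R : realType) (A : banachAlgType R[i]) (c : A).
Implicit Types (a b : A) (z w : R[i]) (P Q : {poly R[i]}) (phi : R[i] -> R[i]).

Definition poly_ev P : A := horner_alg c P.

Lemma poly_evM P Q : poly_ev (P * Q) = poly_ev P * poly_ev Q. Proof. exact: rmorphM. Qed.
Lemma poly_evD P Q : poly_ev (P + Q) = poly_ev P + poly_ev Q. Proof. exact: rmorphD. Qed.
Lemma poly_evB P Q : poly_ev (P - Q) = poly_ev P - poly_ev Q. Proof. exact: raddfB. Qed.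
Lemma poly_ev1 : poly_ev 1 = 1. Proof. exact: rmorph1. Qed.
Lemma poly_evC z : poly_ev z%:P = z%:A. Proof. exact: horner_algC. Qed.
Lemma poly_evX : poly_ev 'X = c. Proof. exact: horner_algX. Qed.

Lemma poly_ev_comm P Q : poly_ev P * poly_ev Q = poly_ev Q * poly_ev P.
Proof. by rewrite -!poly_evM mulrC. Qed.

(** The factors of [P] vanish off the spectrum, hence become invertible. *)
Lemma poly_ev_unit P : P != 0 -> (forall x, spectrum c x -> P.[x] != 0) -> poly_ev P \is a GRing.unit.
Proof.
move=> P0 hP; have [r Pr] := closed_field_poly_normal P.
have hr z : z \in r -> c - z%:A \is a GRing.unit.
  move=> zr; rewrite -opprB unitrN; apply: spectrum_unit => /hP /negP; apply.
  by rewrite -rootE Pr rootZ ?lead_coef_eq0 // root_prod_XsubC.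
rewrite Pr -mul_polyC poly_evM poly_evC mulr_algl unit_scale ?lead_coef_eq0 //.
elim: r hr {Pr} => [|z r IH] hr; first by rewrite big_nil poly_ev1 unitr1.
rewrite big_cons poly_evM unitrMr; last by rewrite poly_evB poly_evX poly_evC hr // inE eqxx.
by apply: IH => w wr; apply: hr; rewrite inE wr orbT.
Qed.

Lemma nonvanishing_neq0 Q : (forall x, spectrum c x -> Q.[x] != 0) -> Q != 0.
Proof.
have [z zc] := spectrum_nonempty c; move=> /(_ z zc); apply: contraNneq => ->.
by rewrite horner0.
Qed.

(** A relation, since the values on the spectrum do not determine a rational function of
    [c] when [c] has nilpotent parts. *)
Definition is_ratfun phi a : Prop := exists P Q,
  [/\ forall x, spectrum c x -> Q.[x] != 0, a = poly_ev P / poly_ev Q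
    & forall x, spectrum c x -> phi x = P.[x] / Q.[x]].

Lemma den_unit Q : (forall x, spectrum c x -> Q.[x] != 0) -> poly_ev Q \is a GRing.unit.
Proof. by move=> hQ; apply: poly_ev_unit => //; exact: nonvanishing_neq0. Qed.

Lemma ratfun_poly P : is_ratfun (fun x => P.[x]) (poly_ev P).
Proof.
exists P, 1; split=> [x _||x _]; first by rewrite hornerC oner_neq0.
  by rewrite poly_ev1 divr1.
by rewrite hornerC divr1.
Qed.

Lemma poly_ev_inv_comm P Q : (forall x, spectrum c x -> Q.[x] != 0) ->
  poly_ev P * (poly_ev Q)^-1 = (poly_ev Q)^-1 * poly_ev P.
Proof.
move=> /den_unit Qu; apply: (mulrI Qu).
by rewrite mulrA divrr // mul1r mulrA poly_ev_comm mulrK.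
Qed.

Lemma ratfunM phi phi' a a' : is_ratfun phi a -> is_ratfun phi' a' -> is_ratfun (fun x => phi x * phi' x) (a * a').
Proof.
move=> [P [Q [Qn -> hP]]] [P' [Q' [Qn' -> hP']]].
exists (P * P'), (Q' * Q); split=> [x xc||x xc].
- by rewrite hornerM mulf_neq0 ?Qn ?Qn'.
- rewrite !poly_evM invrM ?den_unit // -[LHS]mulrA -[RHS]mulrA; congr (_ * _).
  by rewrite !mulrA -poly_ev_inv_comm.
by rewrite hP // hP' // !hornerM invfM; ring.
Qed.

Lemma ratfunD phi phi' a a' : is_ratfun phi a -> is_ratfun phi' a' -> is_ratfun (fun x => phi x + phi' x) (a + a').
Proof.
move=> [P [Q [Qn -> hP]]] [P' [Q' [Qn' -> hP']]].
exists (P * Q' + P' * Q), (Q * Q'); split=> [x xc||x xc].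
- by rewrite hornerM mulf_neq0 ?Qn ?Qn'.
- have Qu := den_unit Qn; have Qu' := den_unit Qn'.
  have QQu : poly_ev (Q * Q') \is a GRing.unit by rewrite poly_evM unitrMl.
  apply: (mulIr QQu); rewrite divrK // mulrDl poly_evD; congr (_ + _).
    by rewrite !poly_evM mulrA divrK.
  by rewrite [Q * Q']mulrC !poly_evM mulrA divrK.
have Qx := Qn x xc; have Qx' := Qn' x xc.
by rewrite hP // hP' // hornerD !hornerM; field; rewrite Qx Qx'.
Qed.

Lemma ratfun_ext phi phi' a : (forall x, spectrum c x -> phi x = phi' x) -> is_ratfun phi a -> is_ratfun phi' a.
Proof.
by move=> e [P [Q [h1 h2 h3]]]; exists P, Q; split=> // x xc; rewrite -e ?h3.
Qed.

Lemma ratfun_alg z : is_ratfun (fun=> z) z%:A.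
Proof. by rewrite -poly_evC; apply: ratfun_ext (ratfun_poly z%:P) => x _; rewrite hornerC. Qed.

Lemma ratfunZ z phi a : is_ratfun phi a -> is_ratfun (fun x => z * phi x) (z *: a).
Proof. by move=> h; rewrite -[z *: a]mulr_algl; exact: ratfunM (ratfun_alg z) h. Qed.

Lemma ratfun_c : is_ratfun id c.
Proof. by rewrite -{1}poly_evX; apply: ratfun_ext (ratfun_poly 'X) => x _; rewrite hornerX. Qed.

Lemma ratfun_sum (I : Type) (s : seq I) (phi : I -> R[i] -> R[i]) (F : I -> A) :
  (forall i, is_ratfun (phi i) (F i)) -> is_ratfun (fun x => \sum_(i <- s) phi i x) (\sum_(i <- s) F i).
Proof.
move=> h; elim: s => [|i s IH].
  have h0 := ratfun_alg 0; rewrite scale0r in h0; rewrite big_nil.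
  by apply: ratfun_ext h0 => x _; rewrite big_nil.
by rewrite big_cons; apply: ratfun_ext (ratfunD (h i) IH) => x _; rewrite big_cons.
Qed.

Lemma ratfun_unit phi a : is_ratfun phi a -> (forall x, spectrum c x -> phi x != 0) ->
  a \is a GRing.unit.
Proof.
move=> [P [Q [Qn -> hP]]] hphi; rewrite unitrMl ?unitrV ?den_unit //.
by move=> x xc; have := hphi x xc; rewrite hP //; apply: contraNneq => ->; rewrite mul0r.
Qed.

Lemma ratfun_resolvent z : ~ spectrum c z -> is_ratfun (fun x => (z - x)^-1) (z%:A - c)^-1.
Proof.
move=> zc; exists 1, (z%:P - 'X); split=> [x xc||x xc].
- by rewrite !hornerE subr_eq0; apply: contra_not_neq zc => ->.
- by rewrite poly_ev1 mul1r poly_evB poly_evC poly_evX.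
by rewrite !hornerE ?div1r.
Qed.

(** [z - a] is a rational function of [c] with values [z - phi x], invertible if these do
    not vanish. *)
Lemma ratfun_spectrum phi a z : is_ratfun phi a -> spectrum a z -> exists2 x, spectrum c x & z = phi x.
Proof.
move=> ha za; apply: contrapT => h; move: za; rewrite /spectrum /= => /negP; apply.
have h1 := ratfunD (ratfun_alg z) (ratfunZ (-1) ha); rewrite scaleN1r in h1.
apply: (ratfun_unit h1) => x xc; rewrite mulN1r subr_eq0.
by apply/eqP => zx; apply: h; exists x.
Qed.

Lemma ratfun_comm phi a (x : A) : is_ratfun phi a -> x * c = c * x -> x * a = a * x.
Proof.
move=> [P [Q [Qn -> _]]] xc.
have evx S : x * poly_ev S = poly_ev S * x.
  elim/poly_ind: S => [|p k IH]; first by rewrite /poly_ev rmorph0 mulr0 mul0r.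
  rewrite poly_evD poly_evM poly_evX poly_evC mulrDr mulrDl mulr_algl mulr_algr; congr (_ + _).
  by rewrite mulrA IH -!mulrA xc.
have Qu := den_unit Qn; rewrite mulrA evx -!mulrA; congr (_ * _).
by apply: (mulrI Qu); rewrite mulrA -evx -mulrA divrr // mulr1 mulrA divrr // mul1r.
Qed.

End Rational.

Section Representation.
Variables (R : realType) (A : banachAlgType R[i]) (star : A -> A) (psi : {scalar A}) (c : A).
Implicit Types (a b : A) (z w : R[i]) (P Q : {poly R[i]}) (phi : R[i] -> R[i]).
Hypotheses (invol : is_involution star) (herm : hermitian_algebra star).
Hypotheses (pos : positive_functional star psi) (psi1 : normalized psi).
Hypothesis cs : star c = c.

Lemma spectrum_real x : spectrum c x -> Num.conj x = x.
Proof. by move=> xc; apply: conj_Creal; exact: herm cs _ xc. Qed.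

Lemma star_poly_ev P : star (poly_ev c P) = poly_ev c (map_poly Num.conj P).
Proof.
elim/poly_ind: P => [|p k IH].
  by rewrite rmorph0 /poly_ev rmorph0 -(scale0r 1) (star_alg invol) rmorph0.
rewrite rmorphD rmorphM /= map_polyX map_polyC /= !poly_evD !poly_evM !poly_evX !poly_evC.
rewrite (starD invol) (starM invol) IH cs (star_alg invol); congr (_ + _).
by have := poly_ev_comm c 'X (map_poly Num.conj p); rewrite poly_evX.
Qed.

(** Conjugating the coefficients conjugates the values, since the spectrum is real. *)
Lemma ratfun_star phi a : is_ratfun c phi a -> is_ratfun c (fun x => Num.conj (phi x)) (star a).
Proof.
move=> [P [Q [Qn -> hP]]].
have hx (S : {poly R[i]}) x : spectrum c x -> (map_poly Num.conj S).[x] = Num.conj S.[x].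
  by move=> xc; rewrite -{1}(spectrum_real xc) horner_map.
have Qn' x : spectrum c x -> (map_poly Num.conj Q).[x] != 0.
  by move=> xc; rewrite hx // fmorph_eq0 Qn.
exists (map_poly Num.conj P), (map_poly Num.conj Q); split=> // [|x xc].
  by rewrite (starM invol) (starV invol) ?den_unit // !star_poly_ev poly_ev_inv_comm.
by rewrite !hx // hP // rmorphM fmorphV.
Qed.

(** Convergence in norm already implies uniform convergence on the spectrum, which is
    recorded to say what the limit is there. *)
Definition represents phi b : Prop := forall e : R, 0 < e -> exists a phia,
  [/\ is_ratfun c phia a, nrm (b - a) <= e
    & forall x, spectrum c x -> cabs (phi x - phia x) <= e].

Lemma represents_ratfun phi a : is_ratfun c phi a -> represents phi a.
Proof.
move=> ra e e0; exists a, phi; split=> // [|x _]; first by rewrite subrr nrm0 ltW.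
by rewrite subrr cabs0 ltW.
Qed.

Lemma representsD phi phi' b b' : represents phi b -> represents phi' b' ->
  represents (fun x => phi x + phi' x) (b + b').
Proof.
move=> h h' e e0; have e2 : 0 < e / 2 by lra.
have [a [pa [h1 h2 h3]]] := h _ e2; have [a' [pa' [h1' h2' h3']]] := h' _ e2.
exists (a + a'), (fun x => pa x + pa' x); split; first exact: ratfunD.
  by rewrite opprD addrACA; apply: le_trans (nrmD _ _) _; lra.
move=> x xc; rewrite opprD addrACA; apply: le_trans (cabsD _ _) _.
by have := h3 x xc; have := h3' x xc; lra.
Qed.

Lemma representsZ z phi b : represents phi b -> represents (fun x => z * phi x) (z *: b).
Proof.
move=> h e e0; have z0 := cabs_ge0 z; have z1 : 0 < cabs z + 1 by lra.
have [a [pa [h1 h2 h3]]] := h _ (divr_gt0 e0 z1).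
exists (z *: a), (fun x => z * pa x); split; first exact: ratfunZ.
  rewrite -scalerBr nrmZ; move: h2; rewrite ler_pdivlMr //.
  by have := nrm_ge0 (b - a); lra.
move=> x xc; rewrite -mulrBr cabsM; have := h3 x xc; rewrite ler_pdivlMr //.
by have := cabs_ge0 (phi x - pa x); lra.
Qed.

Lemma represents_cM phi b : represents phi b -> represents (fun x => x * phi x) (c * b).
Proof.
move=> h e e0; have z0 := nrm_ge0 c; have z1 : 0 < nrm c + 1 by lra.
have [a [pa [h1 h2 h3]]] := h _ (divr_gt0 e0 z1).
exists (c * a), (fun x => x * pa x); split; first exact: ratfunM (ratfun_c c) h1.
  rewrite -mulrBr; apply: le_trans (nrmM _ _) _; move: h2; rewrite ler_pdivlMr //.
  by have := nrm_ge0 (b - a); lra.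
move=> x xc; rewrite -mulrBr cabsM; have := h3 x xc; rewrite ler_pdivlMr //.
have d0 := cabs_ge0 (phi x - pa x); have := spectrum_le xc.
by have := cabs_ge0 x; nra.
Qed.

Lemma represents_comm phi b (x : A) : represents phi b -> x * c = c * x -> x * b = b * x.
Proof.
move=> h xc; apply/eqP; rewrite -subr_eq0; apply/eqP/nrm_small_eq0 => e e0.
have x0 := nrm_ge0 x; have x1 : 0 < 2 * nrm x + 1 by lra.
have [a [pa [h1 h2 _]]] := h _ (divr_gt0 e0 x1).
have xa := ratfun_comm h1 xc.
have -> : x * b - b * x = x * (b - a) - (b - a) * x.
  by rewrite mulrBr mulrBl xa opprB addrA subrK.
apply: le_trans (nrmB _ _) _; move: h2; rewrite ler_pdivlMr // => h2.
have := nrmM x (b - a); have := nrmM (b - a) x; have := nrm_ge0 (b - a); lra.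
Qed.

(** [b] commutes with what commutes with [c], hence [star b] commutes with [c], and with [b]. *)
Lemma represents_normal phi b : represents phi b -> b * star b = star b * b.
Proof.
move=> h; apply/esym/(represents_comm h).
have := represents_comm h (erefl (c * c)) => /(congr1 star).
by rewrite !(starM invol) cs.
Qed.

(** [a] is split as [(h + i k) / 2] with [h], [k] selfadjoint; the spectrum of [h] is almost
    nonnegative and that of [k] almost zero. *)
Lemma psi_ratfun_near_ge0 (e : R) phi phia a : 0 < e -> (forall x, spectrum c x -> 0 <= phi x) ->
  is_ratfun c phia a -> (forall x, spectrum c x -> cabs (phi x - phia x) <= e) ->
  - (2 * e) <= complex.Re (psi a) /\ `|complex.Im (psi a)| <= e.
Proof.
move=> e0 phi0 ra pe.
have phir x : spectrum c x -> complex.Im (phi x) = 0.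
  by move=> /phi0; exact: ger0_Im.
pose h := a + star a; pose k := - 'i *: a + star (- 'i *: a).
have hs : star h = h by rewrite /h (starD invol) (starK invol) addrC.
have ks : star k = k by rewrite /k (starD invol) (starK invol) addrC.
have rh := ratfunD ra (ratfun_star ra).
have rk := ratfunD (ratfunZ (- 'i) ra) (ratfun_star (ratfunZ (- 'i) ra)).
have [|p pE pr] := psi_selfadjoint_ge invol herm pos psi1 hs (r := 2 * e).
  move=> z /(ratfun_spectrum rh)[x xc ->].
  have := pe x xc; have := phi0 x xc; have := cabs_Re (phi x - phia x).
  rewrite ler_norml => /andP[_]; move: (phia x) (phi x) => [u v] [u' v'] /=.
  by rewrite lecE /= => h1 /andP[_ h2] h3; lra.
have qr : cabs (psi k) <= 2 * e.
  apply: (psi_selfadjoint_le invol herm pos psi1 ks) => z /(ratfun_spectrum rk)[x xc ->].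
  have := pe x xc; have := phir x xc; have := cabs_Im (phi x - phia x).
  move: (phia x) (phi x) => [u v] [u' v'] /= h1 v0 h3.
  have {}h1 : `|v| <= cabs ((u' +i* v') - (u +i* v)) by rewrite -normrN -sub0r -v0.
  rewrite (_ : _ + _ = v *+ 2); first by rewrite normrMn mulr2n; move: h1 h3; rewrite v0; lra.
  by rewrite mulr2n; ring.
have hE : psi h = psi a + psi (star a) by rewrite linearD.
have kE : psi k = - 'i * psi a + 'i * psi (star a).
  rewrite /k (starZ invol) linearD /= !linearZ /=; congr (_ + _ * _).
  by apply/eqP; rewrite eq_complex /= oppr0 opprK !eqxx.
have := cabs_Im (psi k); have := cabs_Re (psi k); move: qr; rewrite kE.
move: hE; rewrite pE.
move: (cabs (- 'i * psi a + 'i * psi (star a))) (psi a) (psi (star a)) => C [u v] [u' v'] /=.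
move=> [hu hv] hC; rewrite !ler_norml => /andP[h1 h2] /andP[h3 h4].
by split; last (apply/andP; split); lra.
Qed.

(** Approximation by rational functions carries positivity from functions on the
    spectrum to the algebra; [psi] is continuous along the approximation because the
    elements involved are normal. *)
Lemma represents_psi_ge0 phi b : represents phi b -> (forall x, spectrum c x -> 0 <= phi x) -> 0 <= psi b.
Proof.
move=> h phi0.
have key (e : R) : 0 < e -> - (4 * e) <= complex.Re (psi b) /\ `|complex.Im (psi b)| <= 3 * e.
  move=> e0; have [a [pa [ra ba pe]]] := h e e0.
  have [h1 h2] := psi_ratfun_near_ge0 e0 phi0 ra pe.
  have rb : represents (fun x => phi x + -1 * pa x) (b + -1 *: a).
    by apply: representsD h _; apply/representsZ/represents_ratfun.
  have := psi_normal_le invol herm pos psi1 (represents_normal rb).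
  rewrite scaleN1r linearB /=; move: h1 h2 ba.
  have := cabs_Re (psi b - psi a); have := cabs_Im (psi b - psi a).
  move: (cabs (psi b - psi a)) (psi a) (psi b) => C [u v] [u' v'] /=.
  rewrite !ler_norml => /andP[h3 h4] /andP[h5 h6] h1 /andP[h2 h2'] h7 h8.
  by split; last (apply/andP; split); lra.
rewrite lecE; apply/andP; split.
  rewrite eq_le; apply/andP; split; apply/ler_addgt0Pr => e e0.
    have e3 : 0 < e / 3 by lra.
    by have [_] := key _ e3; rewrite ler_norml /= => /andP[]; lra.
  have e3 : 0 < e / 3 by lra.
  by have [_] := key _ e3; rewrite ler_norml /= => /andP[]; lra.
apply/ler_addgt0Pr => e e0; have e3 : 0 < e / 4 by lra.
by have [] := key _ e3; rewrite /=; lra.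
Qed.

End Representation.

(** * The holomorphic calculus as a limit of rational functions *)

Section Rate.
Variables (R : realType) (V : normedModType R[i]) (gamma : R -> R[i]^o) (F : R[i] -> V) (L : R).
Hypotheses (gc : unif_cont01 gamma) (gL : length_le gamma L) (L0 : 0 < L).
Hypotheses (Fc : unif_cont01 (F \o gamma)) (Vc : complete_seq V).

(** [contour_integral] is chosen among the integrals; there is only one, so that it
    inherits the rate. *)
Lemma contour_integral_rate (e d : R) n t s : 0 <= e ->
  (forall x y, 0 <= x <= 1 -> 0 <= y <= 1 -> `|x - y| < 2 * d ->
     nrm (F (gamma x) - F (gamma y)) <= e) ->
  is_tagged d n t s ->
  nrm (riemann_stieltjes_sum gamma F n t s - contour_integral gamma F) <= e * L.
Proof.
have [w hw] := contour_integral_exists gc gL L0 Fc Vc.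
suff wI : is_contour_integral gamma F w by rewrite (contour_integralE wI); exact: hw.
apply/is_contour_integralP => r r0; have r2 : 0 < r / (2 * L) by rewrite divr_gt0 ?mulr_gt0.
have [p p0 hp] := Fc r2; have p2 : 0 < p / 2 by rewrite divr_gt0.
exists (p / 2) => // n' t' s' ts; apply: le_lt_trans (hw _ _ _ _ _ (ltW r2) _ ts) _.
  by move=> x y x01 y01 xy; apply: hp => //; lra.
rewrite (_ : _ * L = r / 2); last by field; exact: lt0r_neq0.
by lra.
Qed.

End Rate.

Lemma unif_cont01_scale (R : realType) (V : normedModType R[i]) (u : R -> R[i]^o) (H : R -> V) :
  unif_cont01 u -> unif_cont01 H -> unif_cont01 (fun s => u s *: H s).
Proof.
move=> uc Hc; have [B B0 hB] := unif_cont01_bounded uc.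
have [B' B'0 hB'] := unif_cont01_bounded Hc; move=> e e0.
have e1 : 0 < e / (2 * B') by rewrite divr_gt0 ?mulr_gt0.
have e2 : 0 < e / (2 * B) by rewrite divr_gt0 ?mulr_gt0.
have [d d0 hd] := uc _ e1; have [d' d'0 hd'] := Hc _ e2.
exists (Num.min d d') => [|s t s01 t01]; first by rewrite lt_min d0.
rewrite lt_min => /andP[/(hd _ _ s01 t01) h1 /(hd' _ _ s01 t01) h2].
have -> : u s *: H s - u t *: H t = (u s - u t) *: H s + u t *: (H s - H t).
  by rewrite scalerBl scalerBr addrA subrK.
apply: le_trans (nrmD _ _) _; rewrite !nrmZ.
have -> : e = e / (2 * B') * B' + B * (e / (2 * B)) by field; rewrite !lt0r_neq0.
by apply: lerD; apply: ler_pM; rewrite ?cabs_ge0 ?nrm_ge0 ?hB' //; exact: hB.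
Qed.

Section Resolvent.
Variables (R : realType) (A : banachAlgType R[i]) (c : A).
Implicit Types (x z w : R[i]).

Definition resolvent z : A := (z%:A - c)^-1.

(** The perturbation of an invertible element by less than the inverse of the norm of its
    inverse stays invertible. *)
Lemma resolvent_far z x : ~ spectrum c z -> spectrum c x ->
  1 <= nrm (resolvent z) * cabs (z - x).
Proof.
move=> /spectrum_unit zu xc; rewrite leNgt; apply/negP => h; move: xc.
rewrite /spectrum /= => /negP; apply.
have -> : x%:A - c = (z%:A - c) * (1 - (z - x) *: resolvent z).
  rewrite mulrBr mulr1 -scalerAr divrr // scalerBl opprB.
  by rewrite [RHS]addrC addrA subrK.
by rewrite unitrMl // unit_small // nrmZ mulrC.
Qed.

Lemma resolvent_curve_cont (gamma : R -> R[i]^o) : unif_cont01 gamma ->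
  (forall s, 0 <= s <= 1 -> ~ spectrum c (gamma s)) -> unif_cont01 (resolvent \o gamma).
Proof.
move=> gc gS; have gu s : 0 <= s <= 1 -> (gamma s)%:A - c \is a GRing.unit.
  by move=> /gS; exact: spectrum_unit.
apply: pointwise_unif_cont01 => s s01 e e0 /=; have [d d0 hd] := inv_cont (gu s s01) e0.
have n1 := nrm1_gt0 A; have d2 : 0 < d / (2 * nrm (1 : A)) by rewrite divr_gt0 ?mulr_gt0.
have [p p0 hp] := gc _ d2; exists p => // t t01 st; rewrite nrmC; apply: hd (gu t t01) _.
have -> : (gamma t)%:A - c - ((gamma s)%:A - c) = (gamma t - gamma s) *: 1.
  by rewrite scalerBl opprB addrA subrK.
have := hp s t s01 t01 st; rewrite nrmZ -[nrm _]/(cabs (gamma s - gamma t)) cabsC.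
by rewrite ler_pdivlMr ?mulr_gt0 //; lra.
Qed.

End Resolvent.

Section HolCalc.
Variables (R : realType) (A : banachAlgType R[i]) (c : A).
Variables (G : set R[i]^o) (g dg : R[i] -> R[i]) (gamma : R -> R[i]^o).
Implicit Types (x z w : R[i]).
Hypothesis Gopen : forall z, G z -> exists2 r : R, 0 < r & forall w, cabs (w - z) < r -> G w.
Hypothesis gd : forall z, G z -> cdiff g z (dg z).
Hypothesis SG : spectrum c `<=` G.
Hypothesis gsur : surrounds_in G (spectrum c) gamma.

(** A Riemann-Stieltjes sum for [g(c)] is a rational function of [c], whose value at a
    point of the spectrum is the corresponding sum for Cauchy's formula; both kinds of
    sums converge at a rate governed by the mesh alone. *)
Lemma represents_hol_calc :
  represents c g ((two_pi_i R)^-1 *: contour_integral gamma (fun z => g z *: resolvent c z)).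
Proof.
have [[gcont gcl /rectifiableP[L L0 gL]] gGS windS windG] := gsur.
have gc := within_unif_cont01 gcont.
have index_wind w : index gamma w = two_pi_i R * winding_number gamma w.
  rewrite /winding_number mulrA divff ?two_pi_i_neq0 // mul1r /index /cauchy_transform.
  by apply: (congr1 (contour_integral (V := R[i]^o) gamma)); apply/funext => z; rewrite div1r.
have gG s : 0 <= s <= 1 -> G (gamma s) by move=> /gGS[].
have gS s : 0 <= s <= 1 -> ~ spectrum c (gamma s) by move=> /gGS[].
have rc := resolvent_curve_cont gc gS.
have ggc : unif_cont01 ((g : R[i] -> R[i]^o) \o gamma).
  by apply: unif_cont01_comp gc _ => s s01; exact: cdiff_cont (gd (gG s s01)).
have Fc := unif_cont01_scale ggc rc.
have [B B0 hB] := unif_cont01_bounded rc.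
have [M M0 hM] := unif_cont01_bounded ggc.
have far s x : 0 <= s <= 1 -> spectrum c x -> cabs ((gamma s - x)^-1) <= B.
  move=> s01 xc; have := resolvent_far (gS s s01) xc; have := hB s s01 => /= h1 h2.
  rewrite cabsV; have p : 0 < cabs (gamma s - x).
    by rewrite cabs_gt0 subr_eq0; apply/eqP => E; apply: (gS s s01); rewrite E.
  by rewrite invf_ple ?posrE // -div1r ler_pdivrMr //; nra.
move=> e e0; have K0 : 0 < cabs (two_pi_i R)^-1 by rewrite cabs_gt0 invr_eq0 two_pi_i_neq0.
have [e1 e10 eE] : exists2 e1, 0 < e1 & cabs (two_pi_i R)^-1 * (e1 * L) = e.
  move: (cabs _) K0 => K K0; exists (e / (K * L)); first by rewrite divr_gt0 ?mulr_gt0.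
  by field; rewrite !lt0r_neq0.
have e2 : 0 < e1 / (2 * B) by rewrite divr_gt0 ?mulr_gt0.
have e3 : 0 < e1 / (2 * M * B ^+ 2) by rewrite divr_gt0 ?mulr_gt0 ?exprn_gt0.
have [d1 d10 hd1] := Fc _ e10; have [d2 d20 hd2] := ggc _ e2; have [d3 d30 hd3] := gc _ e3.
pose d := Num.min d1 (Num.min d2 d3).
have d0 : 0 < d by rewrite /d !lt_min d10 d20.
have [N [N0 hN]] := inv_nat_small (divr_gt0 d0 (ltr0n R 2)).
have tag : is_tagged (d / 2) N (grid R N) (grid R N).
  by apply: grid_tagged => //; [exact: hN|exact: grid_left].
have split_d (x y : R) : `|x - y| < 2 * (d / 2) ->
    [/\ `|x - y| < d1, `|x - y| < d2 & `|x - y| < d3].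
  rewrite (_ : 2 * (d / 2) = d); last by field.
  by rewrite /d !lt_min => /and3P[].
have gridS01 i : (i < N)%N -> 0 <= grid R N i <= 1 by move=> /ltnW; exact: grid01.
exists ((two_pi_i R)^-1 *: riemann_stieltjes_sum gamma (fun z => g z *: resolvent c z) N
  (grid R N) (grid R N)).
exists (fun x => (two_pi_i R)^-1 * \sum_(i < N)
  ((gamma (grid R N i.+1) - gamma (grid R N i)) * (g (gamma (grid R N i)) / (gamma (grid R N i) - x)))).
split.
- apply/ratfunZ/ratfun_sum => i; apply/ratfunZ/ratfunZ/ratfun_resolvent; exact/gS/gridS01.
- rewrite -scalerBr nrmZ nrmC -[leRHS]eE ler_wpM2l ?(ltW K0) //.
  apply: (contour_integral_rate gc gL L0 Fc (@complete_seq_banach R A) (ltW e10) _ tag).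
  by move=> x y x01 y01 /split_d[h _ _]; exact: hd1.
move=> x xc; pose q z : R[i]^o := g z / (z - x).
have gx s : 0 <= s <= 1 -> gamma s != x.
  by move=> s01; apply/eqP => E; apply: (gS s s01); rewrite E.
have qc : unif_cont01 (q \o gamma).
  apply: (unif_cont01_comp (q := q) gc) => s s01.
  apply: cont_atM; first exact: cdiff_cont (gd (gG s s01)).
  apply: cont_atV; first by rewrite subr_eq0 gx.
  by apply: cont_atD; [exact: cont_at_id|exact: cont_at_cst].
have index0 w : ~ G w -> index gamma w = 0 by move=> /windG; rewrite index_wind => ->; rewrite mulr0.
have := global_Cauchy Gopen gd gc gL L0 gcl gG index0 (SG xc) gx.
rewrite index_wind windS // mulr1 => /contour_integralE qE.
have -> : g x = (two_pi_i R)^-1 * contour_integral gamma q.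
  by rewrite [contour_integral _ _]qE mulrC mulfK // two_pi_i_neq0.
rewrite -mulrBr cabsM cabsC -[leRHS]eE ler_wpM2l ?(ltW K0) //.
apply: (contour_integral_rate gc gL L0 qc (@complete_seq_complex R) (ltW e10) _ tag).
move=> s t s01 t01 /split_d[_ h2 h3]; have {}h2 := hd2 s t s01 t01 h2; have {}h3 := hd3 s t s01 t01 h3.
have fs := far s x s01 xc; have ft := far t x t01 xc; have Mt := hM t t01.
have qE2 : q (gamma s) - q (gamma t) = (g (gamma s) - g (gamma t)) * (gamma s - x)^-1
    + g (gamma t) * ((gamma t - gamma s) * ((gamma s - x)^-1 * (gamma t - x)^-1)).
  by rewrite /q; field; rewrite !subr_eq0 !gx.
rewrite qE2 -[nrm _]/(cabs _); apply: le_trans (cabsD _ _) _; rewrite !cabsM cabsC.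
have {}h2 : cabs (g (gamma t) - g (gamma s)) <= e1 / (2 * B) by rewrite cabsC.
have {}h3 : cabs (gamma t - gamma s) <= e1 / (2 * M * B ^+ 2) by rewrite cabsC.
have -> : e1 = e1 / (2 * B) * B + M * (e1 / (2 * M * B ^+ 2) * (B * B)).
  by field; rewrite !lt0r_neq0.
by apply: lerD; repeat apply: ler_pM; rewrite ?mulr_ge0 ?cabs_ge0.
Qed.

End HolCalc.

(** * Taylor's formula on a real segment *)

Section RealTaylor.
Variable R : realType.
Implicit Types (x y t m M q : R) (F : R[i] -> R[i]).

Lemma cdiff_Re F x (d : R[i]) : cdiff F x%:C d ->
  is_derive x 1 (fun y : R => complex.Re (F y%:C)) (complex.Re d).
Proof.
move=> Fx; pose u y := complex.Re (F y%:C).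
have lim1 : (fun h => h^-1 *: (u (h + x) - u x)) @ (0 : R)^' --> complex.Re d.
  apply/cvgrPdist_le => e e0.
  have [r r0 hr] := Fx e e0; rewrite near_withinE; apply/nbhs_ballP.
  exists r => // h; rewrite /ball /= sub0r normrN => hr0 h0.
  have := hr (h + x)%:C; rewrite -rmorphB addrK cabs_real => /(_ hr0).
  have -> : complex.Re d - h^-1 *: (u (h + x) - u x) =
      - (complex.Re (F (h + x)%:C - F x%:C - d * h%:C) / h).
    rewrite -[_ *: _]/(_ * _) /u; move: (F _) (F _) d {Fx hr} => [? ?] [? ?] [? ?] /=.
    by field.
  rewrite normrN normrM normfV ler_pdivrMr ?normr_gt0 // => k.
  by apply: le_trans k; exact: cabs_Re.
have eq : (fun h : R => h^-1 *: (u (h *: 1 + x) - u x)) = (fun h => h^-1 *: (u (h + x) - u x)).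
  by apply/funext => h; rewrite -[_ *: 1]/(_ * 1) mulr1.
have D : derivable u x 1 by rewrite /derivable eq; apply/cvg_ex; exists (complex.Re d).
by apply: DeriveDef => //; rewrite /derive eq; exact: cvg_lim lim1.
Qed.

(** The mean value theorem is applied twice, to the real parts of the remainder and of its
    derivative. The point [y] depends on [q], which is to be a bound for [F2]. *)
Lemma Taylor_Lagrange F F1 F2 m M q :
  (forall x, m <= x <= M -> cdiff F x%:C (F1 x%:C)) ->
  (forall x, m <= x <= M -> cdiff F1 x%:C (F2 x%:C)) ->
  forall x t, m <= x <= M -> m <= t <= M ->
  exists y p : R, [/\ m <= y <= M, 0 <= p &
    complex.Re (F x%:C - F t%:C - F1 t%:C * (x%:C - t%:C)) - q / 2 * (x - t) ^+ 2
      = (complex.Re (F2 y%:C) - q) * p].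
Proof.
move=> Fd F1d x t xm tm.
pose H z := F z + (- (F t%:C) + (- F1 t%:C * (z + - t%:C) + - (q / 2)%:C * ((z + - t%:C) * (z + - t%:C)))).
pose H1 z := F1 z + (- F1 t%:C + - q%:C * (z + - t%:C)).
have sub z : cdiff (fun w => w + - t%:C) z (1 + 0) by apply: cdiffD (cdiff_id z) (cdiff_cst _ z).
have Hd y : m <= y <= M -> is_derive y 1 (fun s : R => complex.Re (H s%:C)) (complex.Re (H1 y%:C)).
  move=> ym; apply: cdiff_Re.
  have := cdiffD (Fd y ym) (cdiffD (cdiff_cst (- F t%:C) y%:C)
    (cdiffD (cdiffM (cdiff_cst (- F1 t%:C) y%:C) (sub y%:C))
      (cdiffM (cdiff_cst (- (q / 2)%:C) y%:C) (cdiffM (sub y%:C) (sub y%:C))))).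
  by congr (cdiff _ _ _); rewrite /H1 rmorphM fmorphV rmorph_nat; field.
have H1d y : m <= y <= M -> is_derive y 1 (fun s : R => complex.Re (H1 s%:C))
    (complex.Re (F2 y%:C - q%:C)).
  move=> ym; apply: cdiff_Re.
  have := cdiffD (F1d y ym) (cdiffD (cdiff_cst (- F1 t%:C) y%:C)
    (cdiffM (cdiff_cst (- q%:C) y%:C) (sub y%:C))).
  by congr (cdiff _ _ _); ring.
have [th th01 E] := MVT_segment Hd tm xm.
have ym : m <= t + th * (x - t) <= M by apply/andP; split; nra.
have [th' th'01 E'] := MVT_segment H1d tm ym.
exists (t + th' * (t + th * (x - t) - t)), (th * (x - t) ^+ 2).
split.
- by apply/andP; split; nra.
- by rewrite mulr_ge0 ?sqr_ge0 //; case/andP: th01.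
have H1t : complex.Re (H1 t%:C) = 0 by rewrite /H1 subrr mulr0 addr0 subrr.
have Ht : complex.Re (H t%:C) = 0 by rewrite /H subrr !mulr0 !addr0 subrr.
move: E E'; rewrite Ht H1t !subr0 => E E'.
have -> : complex.Re (F x%:C - F t%:C - F1 t%:C * (x%:C - t%:C)) - q / 2 * (x - t) ^+ 2
    = complex.Re (H x%:C).
  rewrite /H -!rmorphB -[- (q / 2)%:C]rmorphN /=; move: (F _) (F _) (F1 _) => [? ?] [? ?] [? ?] /=.
  by ring.
rewrite E E' [complex.Re (_ - q%:C)]raddfB /=.
by ring.
Qed.

End RealTaylor.

(** * Convexity inequalities *)

(** The imaginary part of the remainder is the real part for [- i F], whose second
    derivative has real part zero. *)
Lemma Taylor_bounds (R : realType) (F F1 F2 : R[i] -> R[i]) (m M k K : R) :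
  (forall x : R, m <= x <= M -> cdiff F x%:C (F1 x%:C)) ->
  (forall x : R, m <= x <= M -> cdiff F1 x%:C (F2 x%:C)) ->
  (forall x : R, m <= x <= M -> k%:C <= F2 x%:C <= K%:C) ->
  forall x t : R, m <= x <= M -> m <= t <= M ->
  2^-1 * k%:C * (x%:C - t%:C) ^+ 2 <= F x%:C - F t%:C - F1 t%:C * (x%:C - t%:C)
    <= 2^-1 * K%:C * (x%:C - t%:C) ^+ 2.
Proof.
move=> Fd F1d kK x t xm tm.
have half (q : R) : 2^-1 * q%:C * (x%:C - t%:C) ^+ 2 = (q / 2 * (x - t) ^+ 2)%:C.
  by rewrite !rmorphM /= fmorphV rmorph_nat rmorphB /= -expr2; ring.
have im : complex.Im (F x%:C - F t%:C - F1 t%:C * (x%:C - t%:C)) = 0.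
  have mulNi (G G1 : R[i] -> R[i]) z : cdiff G z (G1 z) ->
      cdiff (fun w => - 'i * G w) z (- 'i * G1 z).
    by move=> /(cdiffM (cdiff_cst (- 'i) z)); rewrite mul0r add0r.
  have [y [p [ym _]]] := Taylor_Lagrange (F1 := fun w => - 'i * F1 w)
    (F2 := fun w => - 'i * F2 w) 0 (fun x h => mulNi F F1 _ (Fd x h))
    (fun x h => mulNi F1 F2 _ (F1d x h)) xm tm.
  have -> : complex.Re (- 'i * F2 y%:C) = 0.
    by have := kK y ym; move: (F2 _) => [a b]; rewrite lecE /= => /andP[/andP[/eqP -> _] _]; ring.
  rewrite !mul0r !subr0 mul0r => E; rewrite -[RHS]E.
  move: (F _) (F _) (F1 _) => [? ?] [? ?] [? ?] /=; ring.
have Fk y : m <= y <= M -> k <= complex.Re (F2 y%:C) <= K.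
  by move=> /kK; rewrite !lecE /= => /andP[/andP[_ ->] /andP[_ ->]].
rewrite !half !lecE im /= !eqxx /=; apply/andP; split; rewrite -subr_ge0.
  have [y [p [/Fk/andP[ym _] p0 ->]]] := Taylor_Lagrange k Fd F1d xm tm.
  by rewrite mulr_ge0 // subr_ge0.
have [y [p [/Fk/andP[_ yM] p0]]] := Taylor_Lagrange K Fd F1d xm tm.
by move=> /(congr1 -%R); rewrite opprB => ->; rewrite -mulNr mulr_ge0 // opprB subr_ge0.
Qed.

Section Analytic.
Variables (R : realType) (G : set R[i]^o) (f : R[i]^o -> R[i]^o).
Hypothesis fG : analytic_in G f.

Lemma analytic_cdiff z : G z -> cdiff f z (derive1 f z).
Proof. by move=> Gz; apply: derivable_cdiff; case: fG => _; exact. Qed.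

Lemma analytic_derive1 : analytic_in G (derive1 f).
Proof.
split; first by case: fG.
move=> z Gz; have [r r0 hr] := open_disc (fG.1) Gz.
have [d dd] := derivative_diff r0 (fun w wr => analytic_cdiff (hr w wr)).
by have [] := cdiff_derivable dd.
Qed.

Lemma represents_hol_calc_analytic (A : banachAlgType R[i]) (c : A) (m M : R) : m < M ->
  (forall x : R, m <= x <= M -> G x%:C) ->
  (forall z, spectrum c z -> exists2 x : R, m <= x <= M & z = x%:C) ->
  represents c f (hol_calc G f c).
Proof.
move=> mM mMG cS; have [gamma gsur] := surrounding_curve (fG.1) mM mMG cS.
rewrite /hol_calc; case: xgetP => [b _ [g0 g0s ->]|/(_ ((two_pi_i R)^-1 *:
    contour_integral gamma (fun z => f z *: (z%:A - c)^-1)))]; last by case; exists gamma.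
apply: (represents_hol_calc (open_disc (fG.1)) analytic_cdiff _ g0s).
by move=> z /cS[x xm ->]; exact: mMG.
Qed.

End Analytic.

Lemma represents_psi_le (R : realType) (A : banachAlgType R[i]) (star : A -> A) (psi : {scalar A})
  (c : A) (phi phi' : R[i] -> R[i]) (b b' : A) :
  is_involution star -> hermitian_algebra star -> positive_functional star psi ->
  normalized psi -> star c = c -> represents c phi b -> represents c phi' b' ->
  (forall x, spectrum c x -> phi x <= phi' x) -> psi b <= psi b'.
Proof.
move=> invol herm pos psi1 cs rb rb' le.
have := represents_psi_ge0 invol herm pos psi1 cs (representsD rb' (representsZ (-1) rb)).
rewrite scaleN1r linearB /= subr_ge0; apply=> x xc.
by rewrite mulN1r subr_ge0 le.
Qed.

Unset Implicit Arguments.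

Theorem theorem5 (R : realType) (A : banachAlgType R[i]) (star : A -> A)
    (psi : {scalar A})
    (G : set R[i]^o) (f : R[i]^o -> R[i]^o) (I : set R) (m M k K : R) :
  is_involution star -> hermitian_algebra star ->
  positive_functional star psi -> normalized psi ->
  analytic_in G f ->
  is_interval I -> [set x%:C | x in I] `<=` G ->
  m < M -> `[m, M] `<=` I ->
  0 <= k -> k < K ->
  (forall x : R, m <= x <= M -> k%:C <= derive1 (derive1 f) x%:C <= K%:C) ->
  forall (c : A) (t : R),
    selfadjoint star c -> spectrum c `<=` [set x%:C | x in `[m, M]] ->
    m <= t <= M ->
    let fc := hol_calc G f c in
    let f'c := hol_calc G (derive1 f) c in
    let q := psi ((c - t%:C%:A) ^+ 2) in
    (2^-1 * k%:C * q
       <= psi fc - derive1 f t%:C * (psi c - t%:C) - f t%:C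
       <= 2^-1 * K%:C * q)
    /\
    (2^-1 * k%:C * q
       <= psi (c * f'c) - t%:C * psi f'c + f t%:C - psi fc
       <= 2^-1 * K%:C * q).
Proof.
move=> invol herm pos psi1 fG _ IG mM mMI _ _ kK c t cs cS tm.
have mMG (x : R) : m <= x <= M -> G x%:C.
  by move=> xm; apply: IG; exists x => //; apply: mMI; rewrite /= in_itv.
have cS' z : spectrum c z -> exists2 x : R, m <= x <= M & z = x%:C.
  by move=> /cS[x]; rewrite /= in_itv /= => xm <-; exists x.
have f1G := analytic_derive1 fG.
have rf := represents_hol_calc_analytic fG mM mMG cS'.
have rf1 := represents_hol_calc_analytic f1G mM mMG cS'.
have le_psi := represents_psi_le invol herm pos psi1 cs.
have taylor := Taylor_bounds (fun x h => analytic_cdiff fG (mMG x h))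
  (fun x h => analytic_cdiff f1G (mMG x h)) kK.
move=> fc f'c q; rewrite -/fc in rf; rewrite -/f'c in rf1; clearbody fc f'c.
have rd : is_ratfun c (fun x => x + - t%:C) (c - t%:C%:A).
  by rewrite -scaleNr; exact: ratfunD (ratfun_c c) (ratfun_alg c _).
have rq (a : R) : represents c (fun x => 2^-1 * a%:C * ((x + - t%:C) * (x + - t%:C)))
    ((2^-1 * a%:C) *: (c - t%:C%:A) ^+ 2).
  by apply/representsZ/represents_ratfun; rewrite expr2; exact: ratfunM.
have psiD a b : psi (a + b) = psi a + psi b by rewrite linearD.
have psiB a b : psi (a - b) = psi a - psi b by rewrite linearB.
have psiZ z a : psi (z *: a) = z * psi a by rewrite linearZ.
have qE (a : R) : 2^-1 * a%:C * q = psi ((2^-1 * a%:C) *: (c - t%:C%:A) ^+ 2) by rewrite linearZ.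
have r1 := representsD (representsD rf (representsZ (- derive1 f t%:C) (represents_ratfun rd)))
  (represents_ratfun (ratfun_alg c (- f t%:C))).
have r2 := representsD (representsD (representsD (represents_cM rf1) (representsZ (- t%:C) rf1))
  (represents_ratfun (ratfun_alg c (f t%:C)))) (representsZ (-1) rf).
have E1 : psi fc - derive1 f t%:C * (psi c - t%:C) - f t%:C =
    psi (fc + - derive1 f t%:C *: (c - t%:C%:A) + (- f t%:C)%:A).
  by rewrite !psiD !psiZ psiB psiZ psi1 !mulr1 mulNr.
have E2 : psi (c * f'c) - t%:C * psi f'c + f t%:C - psi fc =
    psi (c * f'c + - t%:C *: f'c + (f t%:C)%:A + -1 *: fc).
  by rewrite !psiD !psiZ psi1 mulr1 mulNr mulN1r.
rewrite !qE E1 E2; split; apply/andP; split.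
- apply: le_psi (rq k) r1 _ => _ /cS'[x xm ->]; have /andP[+ _] := taylor x t xm tm.
  by congr (_ <= _); ring.
- apply: le_psi r1 (rq K) _ => _ /cS'[x xm ->]; have /andP[_] := taylor x t xm tm.
  by congr (_ <= _); ring.
- apply: le_psi (rq k) r2 _ => _ /cS'[x xm ->]; have /andP[+ _] := taylor t x tm xm.
  by congr (_ <= _); ring.
- apply: le_psi r2 (rq K) _ => _ /cS'[x xm ->]; have /andP[_] := taylor t x tm xm.
  by congr (_ <= _); ring.
Qed.
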